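(* Let $d\ge 1$, $k\ge 0$ and $0\le l\le d$ be integers. Set \[ E_{l,k,d}(n)=\begin{cases}2^{-(k+2)n}(n+1)^{d-1}, & l=0,\\ 2^{-(k+1)n}(n+1)^{l-1}, & 1\le l\le d.\end{cases} \] Then there is a constant $C_{k,d,l}$, depending only on $k,d,l$ (in particular independent of $n$ and $\omega$), such that for every $n\in\mathbb N_0$ and every $l$-form $\omega=\sum_{|I|=l}u_I\,\mathrm dx_I$ with each coefficient $u_I\in\mathcal X_I^k$, \[ \|\omega-\mathcal I_n^l\omega\|_{L^2\Lambda^l(\Omega)}\le C_{k,d,l}\,E_{l,k,d}(n)\,\|\omega\|_{\mathcal X_l^k}. \]
   Context: $\Omega=(0,1)^d$, $[d]=\{1,\dots,d\}$, $\mathbb N_0=\{0,1,2,\dots\}$. For $I=\{i_1<\dots<i_l\}\subseteq[d]$ put $\mathrm dx_I=\mathrm dx_{i_1}\wedge\cdots\wedge\mathrm dx_{i_l}$. An $l$-form is $\omega=\sum_{|I|=l}u_I\,\mathrm dx_I$ with $I\subseteq[d]$, and $\|\omega\|_{L^2\Lambda^l(\Omega)}^2=\sum_{|I|=l}\|u_I\|_{L^2(\Omega)}^2$. Mixed regularity. For $I\subseteq[d]$ let $r_s=k+1$ if $s\in I$ and $r_s=k+2$ if $s\notin I$, and $\boldsymbol r=(r_1,\dots,r_d)$. $\mathcal X_I^k$ is the space of $v\in L^2(\Omega)$ with weak derivatives $\partial_{x_1}^{q_1}\cdots\partial_{x_d}^{q_d}v\in L^2(\Omega)$ for all $\boldsymbol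 q\in\mathbb N_0^d$ with $\boldsymbol 0\le\boldsymbol q\le\boldsymbol r$ (componentwise), normed by $\|v\|_{\mathcal X_I^k}^2=\sum_{\boldsymbol 0\le\boldsymbol q\le\boldsymbol r}\|\partial_{x_1}^{q_1}\cdots\partial_{x_d}^{q_d}v\|_{L^2(\Omega)}^2$. $\mathcal X_l^k$ is the space of $l$-forms with $u_I\in\mathcal X_I^k$ for all $|I|=l$, with $\|\omega\|_{\mathcal X_l^k}^2=\sum_{|I|=l}\|u_I\|_{\mathcal X_I^k}^2$. One-dimensional interpolants. $\mathbb P_r(K)$ denotes polynomials of degree at most $r$ on the interval $K$, $\mathbb P_{-1}(K)=\{0\}$. $\mathcal T_m$ is the uniform partition of $(0,1)$ into $2^m$ cells; $S_m^{k+1}=\{v\in C^0([0,1]):v|_K\in\mathbb P_{k+1}(K)\ \forall K\in\mathcal T_m\}$, $Q_m^k=\{q\in L^2(0,1):q|_K\in\mathbb P_k(K)\ \forall K\in\mathcal T_m\}$. For $v\in H^1(0,1)$, $\Pi_m^0v\in S_m^{k+1}$ is the unique function that, on each $K\in\mathcal T_m$, agrees with $v$ at both endpoints of $K$ and satisfies $\int_K(\Pi_m^0v-v)w\,\mathrm dx=0$ for all $w\in\mathbb P_{k-1}(K)$. For $q\in L^2(0,1)$, $\Pi_m^1q$ is the $L^2(0,1)$-orthogonal projection of $q$ onto $Q_m^k$. Put $\Pi_{-1}^0=\Pi_{-1}^1=0$ and $\Delta_m^r=\Pi_m^r-\Pi_{m-1}^r$ for $r\in\{0,1\}$, $m\in\mathbb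 N_0$. $\Delta_{s,m}^r$ denotes $\Delta_m^r$ acting only in the variable $x_s$ (other variables are parameters); operators in different variables commute. Sparse interpolant. For $\boldsymbol m=(m_1,\dots,m_d)\in\mathbb N_0^d$ let $H_{\boldsymbol m}^I=\big(\prod_{i\in I}\Delta_{i,m_i}^1\big)\big(\prod_{j\notin I}\Delta_{j,m_j}^0\big)$. With $\mathcal M_n=\{\boldsymbol m\in\mathbb N_0^d: m_1+\dots+m_d\le n+d-1\}$, set $\mathcal I_n^Iu_I=\sum_{\boldsymbol m\in\mathcal M_n}H_{\boldsymbol m}^Iu_I$ and $\mathcal I_n^l\omega=\sum_{|I|=l}(\mathcal I_n^Iu_I)\,\mathrm dx_I$. *)

(* Defs.v *)
From HB Require Import structures.
From mathcomp Require Import all_boot all_order all_algebra.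
From mathcomp Require Import all_classical all_reals all_analysis.

Set Implicit Arguments.
Unset Strict Implicit.
Unset Printing Implicit Defensive.

Import Order.TTheory GRing.Theory Num.Theory.
Import numFieldNormedType.Exports.

Local Open Scope classical_set_scope.
Local Open Scope ring_scope.

(* R^n is 'rV[R]_n with the sigma-algebra generated by the coordinates, i.e.
   the product sigma-algebra, as the library does for n.-tuple. *)
Definition measure_rV_display : measure_display -> measure_display.
Proof. exact. Qed.

Section measurable_rV.
Context {disp : measure_display} {T : measurableType disp} (n : nat).

Let coors : 'I_n -> 'rV[T]_n -> T := fun i x => x 0 i.

Let rV_set0 : g_sigma_preimage coors set0.
Proof. exact: sigma_algebra0. Qed.

Let rV_setC A : g_sigma_preimage coors A -> g_sigma_preimage coors (~` A).
Proof. exact: sigma_algebraC. Qed.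

Let rV_bigcup (F : _^nat) : (forall i, g_sigma_preimage coors (F i)) ->
  g_sigma_preimage coors (\bigcup_i (F i)).
Proof. exact: sigma_algebra_bigcup. Qed.

HB.instance Definition _ := @isMeasurable.Build (measure_rV_display disp)
  'rV[T]_n (g_sigma_preimage coors) rV_set0 rV_setC rV_bigcup.

Lemma measurable_coord (i : 'I_n) :
  measurable_fun [set: 'rV[T]_n] (fun x : 'rV[T]_n => x 0 i).
Proof.
move=> _ Y mY; rewrite setTI; apply: sub_sigma_algebra => /=.
rewrite -bigcup_seq/=; exists i => /=; first by rewrite mem_index_enum.
by exists Y => //; rewrite setTI.
Qed.

Lemma measurable_fun_coordP {disp' : measure_display}
    {T' : measurableType disp'} (f : T' -> 'rV[T]_n) :
  (forall i, measurable_fun [set: T'] (fun x => f x 0 i)) ->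
  measurable_fun [set: T'] f.
Proof.
move=> mf _ Y mY; rewrite setTI.
suff : g_sigma_preimage coors `<=` [set A | measurable (f @^-1` A)] by apply.
apply: smallest_sub.
  split=> /= [|A mA|F mF].
  - by rewrite preimage_set0.
  - by rewrite setTD preimage_setC; apply: measurableC.
  - by rewrite preimage_bigcup; apply: bigcup_measurable => i _; exact: mF.
rewrite -bigcup_seq/= => A [i _ [B mB <-]] /=; rewrite setTI.
by have := mf i measurableT B mB; rewrite setTI.
Qed.

End measurable_rV.

Section lebesgue_rV.
Context {R : realType}.

Definition rV_cons n (x : R * 'rV[R]_n) : 'rV[R]_n.+1 :=
  \row_i (if unlift ord0 i is Some j then x.2 0 j else x.1).

Definition rV_uncons n (x : 'rV[R]_n.+1) : R * 'rV[R]_n :=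
  (x 0 ord0, \row_i x 0 (lift ord0 i)).

Lemma rV_consK n : cancel (@rV_cons n) (@rV_uncons n).
Proof.
move=> [a v]; rewrite /rV_uncons /rV_cons; congr pair.
  by rewrite mxE unlift_none.
by apply/rowP => i; rewrite !mxE liftK.
Qed.

Lemma measurable_rV_cons n : measurable_fun setT (@rV_cons n).
Proof.
apply: measurable_fun_coordP => i; rewrite /rV_cons.
under eq_fun do rewrite mxE.
case: unliftP => [j _|_]; last exact: measurable_fst.
apply: (measurableT_comp (f := fun y : 'rV[R]_n => y 0 j)).
  exact: measurable_coord.
exact: measurable_snd.
Qed.

Lemma measurable_rV_uncons n : measurable_fun setT (@rV_uncons n).
Proof.
apply: measurable_fun_pair; first exact: measurable_coord.
apply: measurable_fun_coordP => i; under eq_fun do rewrite mxE.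
exact: measurable_coord.
Qed.

Section step.
Local Open Scope ereal_scope.
Context (n : nat) (mu : {sigma_finite_measure set 'rV[R]_n -> \bar R}).

Definition lebesgue_rV_step : set 'rV[R]_n.+1 -> \bar R :=
  pushforward (@lebesgue_measure R \x mu) (@rV_cons n).

Let mcons := @measurable_rV_cons n.

Let step0 : lebesgue_rV_step set0 = 0.
Proof. exact: measure0. Qed.

Let step_ge0 A : 0 <= lebesgue_rV_step A.
Proof. exact: measure_ge0. Qed.

Let step_sigma_additive : semi_sigma_additive lebesgue_rV_step.
Proof. exact: measure_semi_sigma_additive. Qed.

HB.instance Definition _ := isMeasure.Build _ _ _ lebesgue_rV_step
  step0 step_ge0 step_sigma_additive.

Let step_sigma_finite : sigma_finite setT lebesgue_rV_step.
Proof.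
have /sigma_finiteP[A [AT ndA Aoo]] := sigma_finiteT (@lebesgue_measure R).
have /sigma_finiteP[B [BT ndB Boo]] := sigma_finiteT mu.
pose F k := A k `*` B k.
have FT : setT = \bigcup_k F k.
  apply/seteqP; split => // -[x y] _.
  have [i _ Aix] : (\bigcup_k A k) x by rewrite -AT.
  have [j _ Bjy] : (\bigcup_k B k) y by rewrite -BT.
  exists (maxn i j) => //; split => /=.
    by move: x Aix; exact/subsetPset/ndA/leq_maxl.
  by move: y Bjy; exact/subsetPset/ndB/leq_maxr.
have Foo k : measurable (F k) /\ (@lebesgue_measure R \x mu) (F k) < +oo.
  have [? ?] := Aoo k; have [? ?] := Boo k.
  split; first exact: measurableX.
  by rewrite product_measure1E// lte_mul_pinfty// ge0_fin_numE.
exists (fun k => @rV_uncons n @^-1` F k).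
  by rewrite -preimage_bigcup -FT preimage_setT.
move=> k; have [mF Fk] := Foo k; split.
  by rewrite -[X in measurable X]setTI; exact: measurable_rV_uncons.
rewrite /lebesgue_rV_step /pushforward -comp_preimage.
by rewrite (_ : _ @^-1` _ = F k)//; apply/seteqP; split => x /=; rewrite rV_consK.
Qed.

HB.instance Definition _ := Measure_isSigmaFinite.Build _ _ _ lebesgue_rV_step
  step_sigma_finite.

End step.

(* Lebesgue measure on R^n: the n-fold product of the one on R. *)
Fixpoint lebesgue_rV (n : nat) : {sigma_finite_measure set 'rV[R]_n -> \bar R} :=
  if n is n'.+1 then lebesgue_rV_step (lebesgue_rV n')
  else \d_(0 : 'rV[R]_0).

End lebesgue_rV.

Lemma measurable_box (R : realType) n (A : 'I_n -> set R) :
  (forall i, measurable (A i)) ->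
  measurable [set x : 'rV[R]_n | forall i, A i (x 0 i)].
Proof.
move=> mA.
rewrite (_ : [set _ | _] =
    \big[setI/setT]_(i < n) ((fun x : 'rV[R]_n => x 0 i) @^-1` A i)).
  apply: bigsetI_measurable => i _; rewrite -[X in measurable X]setTI.
  exact: measurable_coord.
rewrite -bigcap_seq; apply/seteqP; split => x /= Ax i; last exact: (Ax i (mem_index_enum i)).
by move=> _; exact: Ax.
Qed.

Lemma lebesgue_rV_box (R : realType) n (A : 'I_n -> set R) :
  (forall i, measurable (A i)) ->
  (lebesgue_rV n [set x : 'rV[R]_n | forall i, A i (x ord0 i)]
     = \prod_i lebesgue_measure (A i))%E.
Proof.
elim: n A => [|n IH] A mA.
  by rewrite big_ord0 /= diracE mem_set// => -[].
rewrite big_ord_recl -IH//= /lebesgue_rV_step /pushforward.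
have mB := @measurable_box R n _ (fun i => mA (lift ord0 i)).
have E := @product_measure1E _ _ _ _ R (@lebesgue_measure R) (lebesgue_rV n) _ _ (mA ord0) mB.
refine (etrans _ E).
congr (_ _); apply/seteqP; split => -[a v] /= Aav.
  split; first by have := Aav ord0; rewrite /rV_cons mxE unlift_none.
  by move=> i; have := Aav (lift ord0 i); rewrite /rV_cons mxE liftK.
move=> i; rewrite /rV_cons mxE; case: unliftP => [j ->|->]; by [apply Aav.2|exact: Aav.1].
Qed.

(* L^2(D). As elements of L^2(D) are classes modulo null sets, a function
   belongs to it as soon as it agrees a.e. on D with a Borel function which is
   square-integrable. Since the integral of a non-measurable function
   is a lower integral, the norm is set to +oo outside L^2(D). *)
Section L2.
Context {disp : measure_display} {T : measurableType disp} {R : realType}.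
Variables (mu : {measure set T -> \bar R}) (D : set T).

Definition L2 (f : T -> R) : Prop :=
  exists2 g : T -> R, g \in Lfun mu 2%:E & f = g %[ae mu in D].

Definition L2norm (f : T -> R) : \bar R :=
  if `[< L2 f >] then 'N[mu]_2%:E [EFin \o (f \_ D)]%E else +oo%E.

End L2.

Section one_dimension.
Context {R : realType}.
Local Notation leb := (@lebesgue_measure R).
Implicit Types (v p q : R -> R) (m k : nat).

Definition test_fun1 (phi : R -> R) : Prop :=
  (forall j x, derivable (derive1n j phi) x 1) /\
  exists2 K : set R, compact K /\ K `<=` `]0, 1[ &
    forall x, ~ K x -> phi x = 0.

Definition weak_derive1 v g : Prop := forall phi, test_fun1 phi ->
  \int[leb]_(x in `]0, 1[) (v x * derive1 phi x) =
  - \int[leb]_(x in `]0, 1[) (g x * phi x).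

Definition H1 v : Prop :=
  L2 leb `]0, 1[ v /\ exists2 g, L2 leb `]0, 1[ g & weak_derive1 v g.

Definition node m (i : nat) : R := i%:R / 2 ^+ m.

(* A polynomial w is in P_r iff size w <= r + 1. *)
Definition splineS k m : set (R -> R) :=
  [set p : R -> R | {within `[0 : R, 1], continuous p} /\
    forall i, (i < 2 ^ m)%N -> exists2 w : {poly R}, (size w <= k.+2)%N &
      {in `[node m i, node m i.+1], forall x, p x = w.[x]}].

(* Each class of Q_m^k is represented by a function which is polynomial at
   every point of the open cells; only its values at the nodes are free. *)
Definition splineQ k m : set (R -> R) :=
  [set p : R -> R | forall i, (i < 2 ^ m)%N ->
    exists2 w : {poly R}, (size w <= k.+1)%N &
      {in `]node m i, node m i.+1[, forall x, p x = w.[x]}].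

(* [vc] is the continuous representative of an element of H^1(0,1). *)
Definition interpolates k m (vc p : R -> R) : Prop :=
  forall i, (i < 2 ^ m)%N ->
    [/\ p (node m i) = vc (node m i), p (node m i.+1) = vc (node m i.+1)
      & forall w : {poly R}, (size w <= k)%N ->
          \int[leb]_(x in `[node m i, node m i.+1])
            ((p x - vc x) * w.[x]) = 0].

Definition Pi0 k m v : R -> R :=
  xget (fun=> 0) [set p : R -> R | H1 v /\
    exists vc : R -> R, [/\ {within `[0 : R, 1], continuous vc},
      v = vc %[ae leb in `]0, 1[%classic], splineS k m p & interpolates k m vc p]].

Definition Pi1 k m q : R -> R :=
  xget (fun=> 0) [set p : R -> R | [/\ L2 leb `]0, 1[ q, splineQ k m p &
    forall w, splineQ k m w ->
      \int[leb]_(x in `]0, 1[) ((p x - q x) * w x) = 0]].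

Definition Pi_op (r : bool) k m v : R -> R :=
  if r then Pi1 k m v else Pi0 k m v.

Definition Delta (r : bool) k m v : R -> R := fun x =>
  if m is m'.+1 then Pi_op r k m v x - Pi_op r k m' v x else Pi_op r k 0 v x.

End one_dimension.

Section unit_cube.
Context {R : realType} {d : nat}.
Local Notation space := 'rV[R]_d.
Local Notation leb := (@lebesgue_rV R d).
Implicit Types (u v g phi : space -> R) (I : {set 'I_d}) (k n : nat).

Definition Omega : set space := [set x | forall i, 0 < x 0 i < 1].

Definition partial (i : 'I_d) phi : space -> R := 'D_(delta_mx 0 i) phi.

Definition partials (s : seq 'I_d) phi : space -> R := foldr partial phi s.

Definition multi_partial (q : 'I_d -> nat) phi : space -> R :=
  partials (flatten [seq nseq (q i) i | i <- enum 'I_d]) phi.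

Definition test_fun phi : Prop :=
  (forall s, continuous (partials s phi) /\
     forall i x, derivable (partials s phi) x (delta_mx 0 i)) /\
  exists2 K : set space, compact K /\ K `<=` Omega &
    forall x, ~ K x -> phi x = 0.

Definition weak_partial (q : 'I_d -> nat) v g : Prop :=
  forall phi, test_fun phi ->
    \int[leb]_(x in Omega) (v x * multi_partial q phi x) =
    (-1) ^+ (\sum_i q i)%N * \int[leb]_(x in Omega) (g x * phi x).

Definition mixed_order k I (s : 'I_d) : nat := if s \in I then k.+1 else k.+2.

Definition Xspace k I v : Prop :=
  L2 leb Omega v /\
  forall q : 'I_d -> nat, (forall s, (q s <= mixed_order k I s)%N) ->
    exists2 g, L2 leb Omega g & weak_partial q v g.

(* The weak derivative, which is unique up to a.e. equality. *)
Definition wpartial (q : 'I_d -> nat) v : space -> R :=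
  xget (fun=> 0) [set g | L2 leb Omega g /\ weak_partial q v g].

(* The multi-indices 0 <= q <= r all have entries below k + 3. *)
Definition Xnorm k I v : \bar R :=
  ((\sum_(q : {ffun 'I_d -> 'I_k.+3}
          | [forall s, (q s <= mixed_order k I s)%N])
      L2norm leb Omega (wpartial (fun s => q s) v) ^+ 2) `^ 2^-1)%E.

Definition set_coord (s : 'I_d) (t : R) (x : space) : space :=
  \row_j (if j == s then t else x 0 j).

(* The operator T acting in the variable x_s, the others being parameters. *)
Definition acting_in (s : 'I_d) (T : (R -> R) -> R -> R) u : space -> R :=
  fun x => T (fun t => u (set_coord s t x)) (x 0 s).

Definition H_op k I (m : 'I_d -> nat) u : space -> R :=
  foldr (fun s => acting_in s (Delta (s \in I) k (m s))) u
    (enum I ++ enum (~: I)).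

(* The entries of m in M_n are at most n + d - 1. *)
Definition sparse_interp k n I u : space -> R := fun x =>
  \sum_(m : {ffun 'I_d -> 'I_(n + d)} | (\sum_i m i <= n + d - 1)%N)
    H_op k I (fun s => m s) u x.

End unit_cube.

Section forms.
Context {R : realType} {d l : nat}.

(* An l-form on Omega is the family of its coefficients u_I, |I| = l. *)
Definition lform : Type := {I : {set 'I_d} | #|I| == l} -> 'rV[R]_d -> R.

Implicit Types (omega : lform) (k n : nat).

Definition form_norm omega : \bar R :=
  ((\sum_I L2norm (@lebesgue_rV R d) Omega (omega I) ^+ 2) `^ 2^-1)%E.

Definition form_Xspace k omega : Prop :=
  forall I, Xspace k (val I) (omega I).

Definition form_Xnorm k omega : \bar R :=
  ((\sum_I Xnorm k (val I) (omega I) ^+ 2) `^ 2^-1)%E.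

Definition form_sparse_interp k n omega : lform :=
  fun I => sparse_interp k n (val I) (omega I).

Definition form_sub omega1 omega2 : lform :=
  fun I x => omega1 I x - omega2 I x.

End forms.
Arguments lform : clear implicits.

Definition error_rate (R : realType) (l k d n : nat) : R :=
  if l is l'.+1 then 2 ^- (k.+1 * n) * n.+1%:R ^+ l'
  else 2 ^- (k.+2 * n) * n.+1%:R ^+ (d - 1).

(* Main.v *)
(* Off a null set, an element of X_I^k is a function all of whose required
   derivatives are iterated primitives of one another along almost every line
   parallel to an axis. On such functions both one-dimensional interpolants are
   kernel operators: with P_m the L^2 projection onto piecewise polynomials of
   degree k and J the primitive vanishing at 0, Pi_m^1 = P_m, and
   v - Pi_m^0 v = J (v' - P_m v') since J (v' - P_m v') vanishes at the nodes and
   is orthogonal to polynomials of degree k - 1. Kernel operators in different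
   variables commute up to null sets, so the estimates
   |v - Pi_m^r v| <= 2^(-m (k + 2 - r)) |v^(k + 2 - r)| tensorize:
   |H_m u| <= c prod_s 2^(-r_s m_s) |u|. The increments sum to the identity,
   so the error is the sum of the H_m over |m| >= n + d, with the last level of
   each direction standing for the whole remainder. Writing a = min r_s and
   A = {s | r_s = a}, the weight is 2^(-a |m|) times a factor that is summable
   in the m_s with s outside A; summing one coordinate of A geometrically
   leaves a factor at most 2 (n + 1) for each of the #|A| - 1 others. *)
Require Import Defs.
From HB Require Import structures.
From mathcomp Require Import all_boot all_order all_algebra.
From mathcomp Require Import all_classical all_reals all_analysis.
From mathcomp Require Import measurable_realfun ring lra.

Set Implicit Arguments.
Unset Strict Implicit.
Unset Printing Implicit Defensive.

Import Order.TTheory GRing.Theory Num.Theory.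
Import numFieldNormedType.Exports.

Local Open Scope classical_set_scope.
Local Open Scope ring_scope.

(** The data are rough: an element of [L2] is only a.e. equal to a Borel function, and [Pi0], [Pi1],
    [wpartial] are arbitrary choices from their defining sets. Hence integrals must tolerate
    non-measurable integrands, and every object is exchanged for a Borel representative as early as
    possible. An operator with a bounded kernel has measurable images, respects a.e. equality and is
    bounded on L^2, all at once. This is why even the relation of being a primitive in $x_s$ is
    phrased through such operators: it then survives every operator acting in a different direction.
    The passage from weak derivatives to primitives on lines tests only with products of
    one-variable bumps. Since the decomposition into increments is a finite identity, no series has
    to converge in a mixed space. The constant is $2^{(k+3)d}$, one increment costing at most
    $2^{k+3}$ per direction, times $2^d$ from the geometric sums. *)

Section integral_nonmeasurable.
Local Open Scope ereal_scope.
Context {d} {T : measurableType d} {R : realType}.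
Variable mu : {measure set T -> \bar R}.

Import HBNNSimple.

(** The integral of a nonnegative function is the supremum over the simple functions below it, and
    cutting a simple function to zero on a null set does not change its integral. This argument
    works for non-measurable [f] and [g]. *)
Let le_ae_integral (D : set T) (f g : T -> \bar R) : measurable D ->
  (forall x, 0 <= f x) -> (forall x, 0 <= g x) ->
  f = g %[ae mu in D] ->
  \int[mu]_(x in D) f x <= \int[mu]_(x in D) g x.
Proof.
move=> mD f0 g0 [N [mN N0 fgN]].
have r0 (h : T -> \bar R) : (forall x, 0 <= h x) -> forall x, 0 <= (h \_ D) x.
  by move=> h0 x; rewrite patchE; case: ifP.
rewrite integral_mkcond [leRHS]integral_mkcond.
rewrite !ge0_integralTE; [|exact: r0..].
apply: ge_ereal_sup => _ [h /= hf <-].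
apply: ereal_sup_ubound => /=.
exists (proj_nnsfun h (measurableC mN)).
  move=> x; rewrite /= mindicE; have [xN|xN] := boolP (x \in ~` N); last first.
    by rewrite mulr0; exact: r0.
  rewrite mulr1 (le_trans (hf x))// !patchE; case: ifPn => //; rewrite inE => Dx.
  move: xN; rewrite inE => xN; rewrite (_ : f x = g x)//.
  by apply: contrapT => fgx; apply: xN; apply: fgN => /= /(_ Dx).
rewrite -!integralT_nnsfun; apply: ge0_ae_eq_integral => //.
- by apply/measurable_EFinP.
- by apply/measurable_EFinP.
- by move=> x _; rewrite lee_fin.
- by move=> x _; rewrite lee_fin.
exists N; split => // x /= hx; apply: contrapT => Nx; apply: hx => _.
by rewrite /= mindicE mem_set// mulr1.
Qed.

Lemma ae_eq_integralW (D : set T) (f g : T -> \bar R) : measurable D ->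
  f = g %[ae mu in D] ->
  \int[mu]_(x in D) f x = \int[mu]_(x in D) g x.
Proof.
move=> mD fg; rewrite integralE [RHS]integralE; congr (_ - _).
- apply/eqP; rewrite eq_le; apply/andP; split; apply: le_ae_integral => //;
    apply: filterS fg => x /= fg Dx; by rewrite !funeposE fg.
- apply/eqP; rewrite eq_le; apply/andP; split; apply: le_ae_integral => //;
    apply: filterS fg => x /= fg Dx; by rewrite !funenegE fg.
Qed.

(** A simple function and its product with the indicator of [D] have the same integral for the
    restricted and the original measure, so the two suprema agree, again for any nonnegative [f]. *)
Let ge0_integral_mrestr (D : set T) (mD : measurable D) (f : T -> \bar R) :
  (forall x, 0 <= f x) ->
  \int[mrestr mu mD]_x f x = \int[mu]_(x in D) f x.
Proof.
move=> f0.
have r0 (h : T -> \bar R) : (forall x, 0 <= h x) -> forall x, 0 <= (h \_ D) x.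
  by move=> h0 x; rewrite patchE; case: ifP.
rewrite integral_mkcond !ge0_integralTE//; last exact: r0.
have sE (h : {nnsfun T >-> R}) :
    sintegral (mrestr mu mD) h = sintegral mu (proj_nnsfun h mD).
  rewrite !sintegralET; apply: eq_fsbigr => r _.
  have [->|rn0] := eqVneq r 0%R; first by rewrite !mul0e.
  congr (_ * _); rewrite /mrestr; congr (mu _); apply/seteqP; split => x /=; rewrite ?mindicE.
    by move=> [<- Dx]; rewrite mem_set// mulr1.
  have [|xD] := boolP (x \in D).
    by rewrite inE mulr1.
  by rewrite mulr0 => /esym r_0; rewrite r_0 eqxx in rn0.
apply/eqP; rewrite eq_le; apply/andP; split; apply: ge_ereal_sup => _ [h /= hf <-];
  apply: ereal_sup_ubound => /=.
- exists (proj_nnsfun h mD) => [x|]; last by rewrite sE.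
  rewrite /= mindicE patchE.
  by case: ifPn => xD; rewrite ?mulr1 ?mulr0.
- exists h => [x|]; first by rewrite (le_trans (hf x))// patchE; case: ifP.
  rewrite sE; apply: eq_sintegral => x /=; rewrite mindicE.
  have [|xD] := boolP (x \in D); first by rewrite mulr1.
  rewrite mulr0; apply/esym/eqP; rewrite eq_le.
  apply/andP; split; last exact: fun_ge0.
  by rewrite -lee_fin (le_trans (hf x))// patchE (negbTE xD).
Qed.

Lemma integral_mrestr (D : set T) (mD : measurable D) (f : T -> \bar R) :
  \int[mrestr mu mD]_x f x = \int[mu]_(x in D) f x.
Proof. by rewrite [LHS]integralE [RHS]integralE !ge0_integral_mrestr. Qed.

Lemma ae_mrestr (D : set T) (mD : measurable D) (Q : set T) :
  {ae mrestr mu mD, forall x, Q x} <-> {ae mu, forall x, D x -> Q x}.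
Proof.
split=> -[N [mN N0 QN]].
  exists (N `&` D); split => //; first exact: measurableI.
  move=> x /= nQ; split; last by apply: contrapT => nD; apply: nQ.
  by apply: QN => /= Qx; apply: nQ.
exists (N `|` ~` D); split => //.
- by apply: measurableU => //; exact: measurableC.
- rewrite /mrestr setIUl setICl setU0; apply/eqP; rewrite -measure_le0 -N0.
  by apply: le_measure; rewrite ?inE//; exact: measurableI.
- move=> x /= nQ; have [Dx|nD] := pselect (D x); [left|by right].
  by apply: QN => /= /(_ Dx).
Qed.

End integral_nonmeasurable.

(** * Square-integrable functions *)

Section square_integrable.
Context {d} {T : measurableType d} {R : realType}.

Definition sqI (mu : {measure set T -> \bar R}) (f : T -> R) : \bar R :=
  (\int[mu]_x ((f x) ^+ 2)%:E)%E.

Definition sqint (mu : {measure set T -> \bar R}) (f : T -> R) : Prop :=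
  measurable_fun setT f /\ (sqI mu f < +oo)%E.

Section any_measure.
Variable mu : {measure set T -> \bar R}.
Implicit Types f g : T -> R.

Lemma integrable_leM f g (c : R) : measurable_fun setT f ->
  (forall x, `|f x| <= c * `|g x|) ->
  mu.-integrable setT (EFin \o g) -> mu.-integrable setT (EFin \o f).
Proof.
move=> mf fg ig; have ig' := integrableZl measurableT c ig.
apply: (le_integrable measurableT _ _ ig'); first exact/measurable_EFinP.
by move=> x _ /=; rewrite lee_fin normrM (le_trans (fg x))// ler_wpM2r// ler_norm.
Qed.

Lemma sqI_ge0 f : (0 <= sqI mu f)%E.
Proof. by apply: integral_ge0 => x _; rewrite lee_fin sqr_ge0. Qed.

Lemma eq_sqI f g : f =1 g -> sqI mu f = sqI mu g.
Proof. by move=> fg; apply: eq_integral => x _; rewrite fg. Qed.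

Lemma ae_eq_sqI f g : {ae mu, forall x, f x = g x} -> sqI mu f = sqI mu g.
Proof.
move=> fg; apply: ae_eq_integralW => //.
by apply: filterS fg => x /= fg _; rewrite fg.
Qed.

Lemma le_sqI f g : measurable_fun setT f -> measurable_fun setT g ->
  {ae mu, forall x, `|f x| <= `|g x|} -> (sqI mu f <= sqI mu g)%E.
Proof.
move=> mf mg fg; apply: ae_ge0_le_integral => //.
- by move=> x _; rewrite lee_fin sqr_ge0.
- by apply/measurable_EFinP/measurable_funX.
- by move=> x _; rewrite lee_fin sqr_ge0.
- by apply/measurable_EFinP/measurable_funX.
apply: filterS fg => x fg _; rewrite lee_fin -[f x ^+ 2]real_normK ?num_real//.
by rewrite -[g x ^+ 2]real_normK ?num_real// lerXn2r ?nnegrE.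
Qed.

Lemma sqint_sqr f : sqint mu f -> mu.-integrable setT (EFin \o (fun x => f x ^+ 2)).
Proof.
move=> [mf fo]; apply/integrableP; split.
  by apply/measurable_EFinP/measurable_funX.
apply: le_lt_trans fo; rewrite le_eqVlt; apply/orP; left; apply/eqP.
by apply: eq_integral => x _ /=; rewrite ger0_norm// sqr_ge0.
Qed.

Lemma sqI_fin f : sqint mu f -> sqI mu f = (\int[mu]_x (f x ^+ 2))%:E.
Proof.
move=> sf; rewrite /Rintegral fineK//.
exact: (integrable_fin_num measurableT (sqint_sqr sf)).
Qed.

Lemma sqint_ae f g : measurable_fun setT f -> {ae mu, forall x, f x = g x} -> sqint mu g ->
  sqint mu f.
Proof. by move=> mf fg [mg go]; split=> //; rewrite (ae_eq_sqI fg). Qed.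

Lemma sqint_le f g : measurable_fun setT f -> sqint mu g ->
  {ae mu, forall x, `|f x| <= `|g x|} -> sqint mu f.
Proof.
by move=> mf [mg go] fg; split=> //; apply: le_lt_trans go; exact: le_sqI.
Qed.

Lemma sqintM f g : sqint mu f -> sqint mu g ->
  mu.-integrable setT (EFin \o (fun x => f x * g x)).
Proof.
move=> sf sg; have [mf _] := sf; have [mg _] := sg.
apply: (le_integrable measurableT _ _ (integrableD measurableT (sqint_sqr sf) (sqint_sqr sg))).
  by apply/measurable_EFinP/measurable_funM.
move=> x _ /=; rewrite lee_fin [leRHS]ger0_norm ?addr_ge0 ?sqr_ge0//.
rewrite ler_norml; apply/andP; split; nra.
Qed.

Lemma sqintZ a f : sqint mu f -> sqint mu (fun x => a * f x).
Proof.
move=> sf; have [mf fo] := sf; split; first exact: measurable_funM.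
rewrite /sqI; under eq_integral do rewrite exprMn EFinM.
rewrite integralZl//; last exact: sqint_sqr.
by rewrite lte_mul_pinfty// ?lee_fin ?sqr_ge0.
Qed.

Lemma sqintD f g : sqint mu f -> sqint mu g -> sqint mu (fun x => f x + g x).
Proof.
move=> sf sg; have [mf _] := sf; have [mg _] := sg.
split; first exact: measurable_funD.
have i2 := integrableZl measurableT 2 (integrableD measurableT (sqint_sqr sf) (sqint_sqr sg)).
apply: le_lt_trans (integrable_lty measurableT i2).
apply: ge0_le_integral => //.
- by move=> x _; rewrite lee_fin sqr_ge0.
- by apply/measurable_EFinP/measurable_funX/measurable_funD.
- by case/integrableP : i2.
- by move=> x _ /=; rewrite -EFinD -EFinM lee_fin; have := sqr_ge0 (f x - g x); nra.
Qed.

Lemma sqintB f g : sqint mu f -> sqint mu g -> sqint mu (fun x => f x - g x).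
Proof.
move=> sf /(sqintZ (-1)) /(sqintD sf); congr (sqint mu _).
by apply/funext => x; rewrite mulN1r.
Qed.

Lemma sqint_bM (b f : T -> R) (M : R) : measurable_fun setT b ->
  (forall x, `|b x| <= M) -> sqint mu f -> sqint mu (fun x => b x * f x).
Proof.
move=> mb bM sf; have [mf fo] := sf.
apply: (@sqint_le _ (fun x => M * f x)); [exact: measurable_funM|exact: sqintZ|].
apply: aeW => x; rewrite !normrM ler_wpM2r//.
by rewrite (le_trans (bM x))// ler_norm.
Qed.

Lemma sqint0 : sqint mu (cst 0).
Proof.
split => //; rewrite /sqI; under eq_integral do rewrite expr0n.
by rewrite integral0.
Qed.

Lemma sqint_sum I (s : seq I) (P : pred I) (F : I -> T -> R) :
  (forall i, P i -> sqint mu (F i)) -> sqint mu (fun x => \sum_(i <- s | P i) F i x).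
Proof.
move=> sF; elim: s => [|i s IH].
  by under eq_fun do rewrite big_nil; exact: sqint0.
have [Pi|nPi] := boolP (P i).
  by under eq_fun do rewrite big_cons Pi; apply: sqintD => //; exact: sF.
by under eq_fun do rewrite big_cons (negbTE nPi).
Qed.

(** The integral of $(tf-g)^2$ is a quadratic polynomial in $t$ without negative values, so its
    discriminant is not positive. *)
Lemma cauchy_schwarz_int f g : sqint mu f -> sqint mu g ->
  (\int[mu]_x (f x * g x)) ^+ 2 <=
  (\int[mu]_x (f x ^+ 2)) * (\int[mu]_x (g x ^+ 2)).
Proof.
move=> sf sg.
set A := \int[mu]_x (f x ^+ 2); set B := \int[mu]_x (f x * g x).
set C := \int[mu]_x (g x ^+ 2).
have A0 : 0 <= A by apply: Rintegral_ge0 => x _; exact: sqr_ge0.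
have quad t : 0 <= t ^+ 2 * A - t * 2 * B + C.
  have iA := sqint_sqr sf; have iB := sqintM sf sg; have iC := sqint_sqr sg.
  have iA' : mu.-integrable setT (EFin \o (fun x => t ^+ 2 * f x ^+ 2)).
    exact: (integrableZl measurableT (t ^+ 2) iA).
  have iB' : mu.-integrable setT (EFin \o (fun x => (t * 2) * (f x * g x))).
    exact: (integrableZl measurableT (t * 2) iB).
  rewrite -(RintegralZl (t ^+ 2) measurableT iA) -(RintegralZl (t * 2) measurableT iB).
  rewrite -(RintegralB measurableT iA' iB').
  rewrite -(RintegralD measurableT (integrableB measurableT iA' iB') iC).
  by apply: Rintegral_ge0 => x _; have := sqr_ge0 (t * f x - g x); nra.
have [A_0|An0] := eqVneq A 0.
  rewrite A_0 mul0r; have [->|Bn0] := eqVneq B 0; first by rewrite expr0n.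
  (* For $A=0$ the polynomial is affine, and at this $t$ it takes the value $-1$. *)
  have := quad ((C + 1) / (2 * B)); rewrite A_0 mulr0 sub0r -mulrA.
  rewrite divfK ?mulf_neq0// => h; lra.
have := quad (B / A); rewrite -(pmulr_lge0 _ (_ : 0 < A)) ?lt_def ?An0//.
have -> : (((B / A) ^+ 2 * A - B / A * 2 * B) + C) * A = C * A - B ^+ 2 by field.
by rewrite subr_ge0 [C * A]mulrC.
Qed.

End any_measure.

Section finite_measure.
Variable mu : {finite_measure set T -> \bar R}.
Implicit Types f g : T -> R.

Lemma sqint_cst (c : R) : sqint mu (cst c).
Proof.
split => //; rewrite /sqI /= integral_cst//.
by rewrite lte_mul_pinfty// ?lee_fin ?sqr_ge0// -ge0_fin_numE// fin_num_measure.
Qed.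

Lemma sqint_bounded f (M : R) : measurable_fun setT f ->
  (forall x, `|f x| <= M) -> sqint mu f.
Proof.
move=> mf fM; apply: (sqint_le mf (sqint_cst M)).
by apply: aeW => x /=; rewrite (le_trans (fM x))// ler_norm.
Qed.

Lemma sqint_integrable f : sqint mu f -> mu.-integrable setT (EFin \o f).
Proof.
move=> /sqintM /(_ (sqint_cst 1)); congr (integrable _ _ _).
by apply/funext => x /=; rewrite mulr1.
Qed.

End finite_measure.

End square_integrable.

(** * Slices of the unit cube *)

Section ray_boxes.
Context {R : realType} {d : nat}.
Local Notation space := 'rV[R]_d.

(** Products of upper rays generate the sigma-algebra, are stable under intersection and have
    indicators that are limits of smooth bumps. The same class thus serves for the uniqueness of
    measures and for the fundamental lemma of the calculus of variations. *)
Definition ray_box (a : 'I_d -> R) : set space := [set x | forall i, a i < x 0 i].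

Definition ray_boxes : set (set space) := [set B | exists a, B = ray_box a].

Lemma measurable_ray_box a : measurable (ray_box a).
Proof.
have -> : ray_box a = [set x : space | forall i, `]a i, +oo[%classic (x 0 i)].
  apply/seteqP; split => x /= ax i; by have := ax i; rewrite in_itv/= andbT.
by apply: (@measurable_box R d (fun i => `]a i, +oo[%classic)) => i; exact: measurable_itv.
Qed.

Lemma setI_closed_ray_boxes : setI_closed ray_boxes.
Proof.
move=> _ _ [a ->] [b ->]; exists (fun i => Num.max (a i) (b i)).
apply/seteqP; split => x /=; first by move=> [ax bx] i; rewrite gt_max ax bx.
by move=> abx; split => i; have := abx i; rewrite gt_max => /andP[].
Qed.

Lemma measurable_rVE : measurable = <<s ray_boxes >> :> set (set space).
Proof.
rewrite eqEsubset; split; last first.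
  apply: smallest_sub; first exact: sigma_algebra_measurable.
  by move=> _ [a ->]; exact: measurable_ray_box.
apply: smallest_sub; first exact: smallest_sigma_algebra.
rewrite -bigcup_seq/= => _ [i _ [A mA <-]]; rewrite setTI.
pose S := [set A : set R | <<s ray_boxes >> ((fun x : space => x 0 i) @^-1` A)].
suff : measurable `<=` S by apply.
rewrite (_ : measurable = <<s @RGenOInfty.G R >>); last exact: RGenOInfty.measurableE.
apply: smallest_sub.
  split => /= [|B mB|F mF]; rewrite /S/=.
  - by rewrite preimage_set0; exact: sigma_algebra0.
  - by rewrite setTD preimage_setC -setTD; apply: sigma_algebraCD.
  - by rewrite preimage_bigcup; apply: sigma_algebra_bigcup.
move=> _ [a ->]; rewrite /S/=.
(* The other coordinates are bounded below by $-n$, so the half-space is an increasing union of ray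
   boxes. *)
have -> : (fun x : space => x 0 i) @^-1` `]a, +oo[ =
    \bigcup_n ray_box (fun j => if j == i then a else - n%:R).
  apply/seteqP; split => x /=.
    rewrite in_itv/= andbT => ax.
    exists (\max_(j < d) Num.truncn `|x ord0 j|).+1 => // j /=.
    case: eqP => [->//|_].
    rewrite ltrNl (le_lt_trans (ler_norm _))// normrN.
    apply: lt_le_trans (truncnS_gt _) _; rewrite ler_nat ltnS.
    exact: (leq_bigmax j).
  move=> [n _ /(_ i)]; rewrite eqxx in_itv/= andbT.
  by [].
apply: sigma_algebra_bigcup => n; apply: sub_sigma_algebra; by eexists.
Qed.

Lemma rV_measure_unique (m1 m2 : {measure set space -> \bar R}) :
  (m1 setT < +oo)%E -> (forall a, m1 (ray_box a) = m2 (ray_box a)) ->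
  forall A, measurable A -> m1 A = m2 A.
Proof.
move=> m1oo m12.
apply: (measure_unique ray_boxes (fun n => ray_box (fun=> - n%:R))).
- exact: measurable_rVE.
- exact: setI_closed_ray_boxes.
- by move=> n; eexists.
- apply/seteqP; split => // x _.
  exists (\max_(j < d) Num.truncn `|x ord0 j|).+1 => // j /=.
  rewrite ltrNl (le_lt_trans (ler_norm _))// normrN.
  apply: lt_le_trans (truncnS_gt _) _; rewrite ler_nat ltnS.
  exact: (leq_bigmax j).
- by move=> _ [a ->].
- move=> n; apply: le_lt_trans m1oo; apply: le_measure; rewrite ?inE//.
  exact: measurable_ray_box.
Qed.

End ray_boxes.

(** * The uniform measures on the interval and on the cube *)

Section unit_cube_measure.
Context {R : realType}.

Definition u01 := mrestr (@lebesgue_measure R) (measurable_itv `]0%R : R, 1%R[).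

HB.instance Definition _ := Measure.on u01.

Lemma u01T : u01 setT = 1%E.
Proof.
rewrite /u01 /mrestr setTI.
by rewrite lebesgue_measure_itv/= lte_fin ltr01 EFinN sube0.
Qed.

Let u01_fin : fin_num_fun u01.
Proof. by apply: lty_fin_num_fun; rewrite /= u01T ltry. Qed.

HB.instance Definition _ := @Measure_isFinite.Build _ _ _ u01 u01_fin.

Variable d : nat.
Local Notation space := 'rV[R]_d.

Lemma OmegaE : (Omega : set space) = [set x | forall i, `]0, 1[%classic (x 0 i)].
Proof. by apply/seteqP; split => x /= ox i; have := ox i; rewrite in_itv. Qed.

Lemma measurable_Omega : measurable (Omega : set space).
Proof. by rewrite OmegaE; apply: (@measurable_box R d (fun=> `]0, 1[%classic)) => i; exact: measurable_itv. Qed.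

Lemma lebesgue_Omega : lebesgue_rV d (Omega : set space) = 1%E.
Proof.
rewrite OmegaE (lebesgue_rV_box (A := fun=> `]0%R, 1%R[%classic))//.
by apply: big1 => i _; rewrite lebesgue_measure_itv/= lte_fin ltr01 EFinN sube0.
Qed.

Definition cube := mrestr (@lebesgue_rV R d) measurable_Omega.

HB.instance Definition _ := Measure.on cube.

Lemma cubeT : cube setT = 1%E.
Proof. by rewrite /cube /mrestr setTI; exact: lebesgue_Omega. Qed.

Let cube_fin : fin_num_fun cube.
Proof. by apply: lty_fin_num_fun; rewrite /= cubeT ltry. Qed.

HB.instance Definition _ := @Measure_isFinite.Build _ _ _ cube cube_fin.

Lemma cube_box (A : 'I_d -> set R) : (forall i, measurable (A i)) ->
  cube [set x | forall i, A i (x 0 i)] = (\prod_i u01 (A i))%E.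
Proof.
move=> mA; rewrite /cube /u01 /mrestr.
rewrite -(lebesgue_rV_box (A := fun i => A i `&` `]0%R, 1%R[)); last first.
  by move=> i; exact: measurableI.
congr (lebesgue_rV _ _); apply/seteqP; split => x /=.
  by move=> [ax ox] i; split; [exact: ax|rewrite in_itv/= ox].
by move=> h; split => i; have [] := h i => //; rewrite in_itv.
Qed.

Lemma integral_cube (f : space -> \bar R) :
  (\int[cube]_x f x = \int[lebesgue_rV d]_(x in Omega) f x)%E.
Proof. exact: integral_mrestr. Qed.

Lemma integral_u01 (f : R -> \bar R) :
  (\int[u01]_x f x = \int[lebesgue_measure]_(x in `]0%R, 1%R[) f x)%E.
Proof. exact: integral_mrestr. Qed.

Lemma ae_cube (Q : set space) :
  {ae cube, forall x, Q x} <-> {ae lebesgue_rV d, forall x, Omega x -> Q x}.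
Proof. exact: ae_mrestr. Qed.

Lemma ae_u01 (Q : set R) : {ae u01, forall x, Q x} <->
  {ae lebesgue_measure, forall x : R, `]0%R, 1%R[%classic x -> Q x}.
Proof. exact: ae_mrestr. Qed.

End unit_cube_measure.

#[global] Instance ae_u01_filter (R : realType) :
  Filter (nbhs (almost_everywhere (@u01 R))).
Proof. exact: ae_filter_ringOfSetsType. Qed.

#[global] Instance ae_cube_filter (R : realType) (d : nat) :
  Filter (nbhs (almost_everywhere (@cube R d))).
Proof. exact: ae_filter_ringOfSetsType. Qed.

(** * Replacing one coordinate: Fubini along lines *)

Section coordinates.
Context {R : realType} {d : nat}.
Local Notation space := 'rV[R]_d.
Implicit Types (x : space) (s : 'I_d) (t : R).

Lemma set_coordE s t x i : set_coord s t x 0 i = if i == s then t else x 0 i.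
Proof. by rewrite mxE. Qed.

Lemma set_coord_same s t x : set_coord s t x 0 s = t.
Proof. by rewrite mxE eqxx. Qed.

Lemma set_coord_neq s t x i : i != s -> set_coord s t x 0 i = x 0 i.
Proof. by move=> /negbTE h; rewrite mxE h. Qed.

Lemma set_coordK s t u x : set_coord s t (set_coord s u x) = set_coord s t x.
Proof. by apply/rowP => i; rewrite !mxE; case: eqP. Qed.

Lemma set_coordC s s' t t' x : s != s' ->
  set_coord s t (set_coord s' t' x) = set_coord s' t' (set_coord s t x).
Proof.
move=> ss'; apply/rowP => i; rewrite !mxE.
by case: (i =P s) => [->|//]; rewrite (negbTE ss').
Qed.

Lemma measurable_set_coord2 s :
  measurable_fun setT (fun p : space * measurableTypeR R => set_coord s p.2 p.1).
Proof.
apply: measurable_fun_coordP => i.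
have [->|ins] := eqVneq i s.
  by under eq_fun do rewrite set_coord_same; exact: measurable_snd.
under eq_fun do rewrite set_coord_neq//.
apply: (measurableT_comp (f := fun y : space => y 0 i)) => //.
exact: measurable_coord.
Qed.

Lemma measurable_set_coord s x : measurable_fun setT (fun t : measurableTypeR R => set_coord s t x).
Proof.
apply: measurable_fun_coordP => i.
have [->|ins] := eqVneq i s; first by under eq_fun do rewrite set_coord_same; exact: measurable_id.
by under eq_fun do rewrite set_coord_neq//; exact: measurable_cst.
Qed.

(** Resampling one coordinate by an independent uniform variable preserves the uniform law on the
    cube. Fubini in $x_s$ thus requires no splitting of the space: the outer integral still runs
    over the whole cube, and its own integration in $x_s$ has mass one. *)
Lemma cube_pushforward s (A : set space) : measurable A ->
  @cube R d A = pushforward (@cube R d \x @u01 R)%E (fun p => set_coord s p.2 p.1) A.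
Proof.
have mphi := measurable_set_coord2 s.
move=> mA; move: A mA; apply: rV_measure_unique => //.
  by rewrite [X in (X < _)%E]cubeT ltry.
move=> a; rewrite /pushforward.
pose A i := `]a i, +oo[%classic.
(* The old coordinate [s] is overwritten, so its constraint disappears from the first factor. *)
pose A' (i : 'I_d) : set R := if i == s then setT else A i.
have mA i : measurable (A i) by exact: measurable_itv.
have mA' i : measurable (A' i) by rewrite /A'; case: ifP.
have E : (fun p : space * measurableTypeR R => set_coord s p.2 p.1) @^-1` ray_box a =
    [set x : space | forall i, A' i (x 0 i)] `*` A s.
  apply/seteqP; split => -[x t] /=.
    move=> h; split=> [i|]; last first.
      by have := h s; rewrite set_coord_same /A/= in_itv/= andbT.
    rewrite /A'; case: eqP => // /eqP si.
    by have := h i; rewrite set_coord_neq// /A/= in_itv/= andbT.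
  rewrite /A/= in_itv/= andbT => -[h at_] i; rewrite set_coordE.
  case: eqP => [->//|/eqP si]; have := h i.
  by rewrite /A' (negbTE si) /A/= in_itv/= andbT.
have RE : ray_box a = [set x : space | forall i, A i (x 0 i)].
  by apply/seteqP; split => x /= h i; have := h i; rewrite /A/= in_itv/= andbT.
transitivity ((@cube R d \x @u01 R)%E
    ([set x : space | forall i, A' i (x 0 i)] `*` A s)); last first.
  rewrite -E; reflexivity.
rewrite product_measure1E; [|exact: (@measurable_box R d A' mA')|exact: mA].
rewrite [in LHS]RE [X in X = _]cube_box// [X in (X * _)%E]cube_box//.
rewrite (bigD1 s)//= [in RHS](bigD1 s)//=.
rewrite /A' eqxx [u01 setT]u01T mul1e muleC; congr (_ * _)%E.
by apply: eq_bigr => i /negbTE ->.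
Qed.

Lemma cube_fubini s (F : space -> \bar R) : measurable_fun setT F ->
  (forall x, (0 <= F x)%E) ->
  (\int[@cube R d]_x F x = \int[@cube R d]_x \int[@u01 R]_y F (set_coord s y x))%E.
Proof.
move=> mF F0; have mphi := measurable_set_coord2 s.
have mFp : measurable_fun setT (fun p : space * measurableTypeR R => F (set_coord s p.2 p.1)).
  exact: measurableT_comp mphi.
transitivity (\int[@cube R d \x @u01 R]_p F (set_coord s p.2 p.1))%E; last first.
  apply: (fubini_tonelli1 (m1 := @cube R d) (m2 := @u01 R)
    (fun p : space * measurableTypeR R => F (set_coord s p.2 p.1))) => //.
rewrite (eq_measure_integral (pushforward (@cube R d \x @u01 R)%E
  (fun p => set_coord s p.2 p.1))); last by move=> A mA _; exact: cube_pushforward.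
by rewrite ge0_integral_pushforward// => x _.
Qed.

Lemma ae_slice s (Q : set space) : {ae @cube R d, forall x, Q x} ->
  {ae @cube R d, forall x, {ae @u01 R, forall y, Q (set_coord s y x)}}.
Proof.
move=> [N [mN N0 QN]].
have mN1 : measurable_fun setT (EFin \o (\1_N : space -> R)).
  by apply/measurable_EFinP.
have : (\int[@cube R d]_x \int[@u01 R]_y (\1_N (set_coord s y x))%:E = 0)%E.
  rewrite -(cube_fubini s mN1); last by move=> x; rewrite lee_fin.
  by rewrite integral_indic// setIT.
move=> i0.
have mI : measurable_fun setT
    (fun x => (\int[@u01 R]_y (\1_N (set_coord s y x))%:E)%E).
  apply: (measurable_fun_fubini_tonelli_F (m2 := @u01 R)
    (fun p : space * measurableTypeR R => (\1_N (set_coord s p.2 p.1))%:E)) => //=.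
  apply: (measurableT_comp mN1); exact: measurable_set_coord2.
have := (ae_eq_integral_abs (@cube R d) measurableT mI).1.
under eq_integral do rewrite gee0_abs ?integral_ge0//.
move=> /(_ i0) h.
apply: filterS h => x /= /(_ Logic.I) h.
have mNx : measurable [set y | N (set_coord s y x)].
  by rewrite -[X in measurable X]setTI; exact: measurable_set_coord.
exists [set y | N (set_coord s y x)]; split => //; last first.
  by move=> y /= nQ; apply: QN.
transitivity (\int[@u01 R]_y (\1_[set y | N (set_coord s y x)] y)%:E)%E.
  by rewrite integral_indic// setIT.
move: h => /= <-; apply: eq_integral => y _; rewrite !indicE.
by congr (_%:R)%:E; apply/idP/idP; rewrite !inE.
Qed.

Lemma sqI_slice s (f : space -> R) : measurable_fun setT f ->
  sqI (@cube R d) f =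
  (\int[@cube R d]_x sqI (@u01 R) (fun y => f (set_coord s y x)))%E.
Proof.
move=> mf; apply: (cube_fubini s (F := fun x => (f x ^+ 2)%:E)).
- by apply/measurable_EFinP/measurable_funX.
- by move=> x; rewrite lee_fin sqr_ge0.
Qed.

Lemma measurable_sqI_slice s (f : space -> R) : measurable_fun setT f ->
  measurable_fun setT (fun x => sqI (@u01 R) (fun y => f (set_coord s y x))).
Proof.
move=> mf; apply: (measurable_fun_fubini_tonelli_F (m2 := @u01 R)
    (fun p : space * measurableTypeR R => ((f (set_coord s p.2 p.1)) ^+ 2)%:E)); last first.
  by move=> x; rewrite lee_fin sqr_ge0.
apply/measurable_EFinP/measurable_funX.
by apply: (measurableT_comp mf); exact: measurable_set_coord2.
Qed.

Lemma measurable_slice s x (f : space -> R) : measurable_fun setT f ->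
  measurable_fun setT (fun y : measurableTypeR R => f (set_coord s y x)).
Proof. by move=> mf; apply: (measurableT_comp mf); exact: measurable_set_coord. Qed.

Lemma ae_sqint_slice s (f : space -> R) : sqint (@cube R d) f ->
  {ae @cube R d, forall x, sqint (@u01 R) (fun y => f (set_coord s y x))}.
Proof.
move=> [mf]; rewrite (sqI_slice s)// => fo.
have : (@cube R d).-integrable setT
    (fun x => sqI (@u01 R) (fun y => f (set_coord s y x))).
  apply/integrableP; split; first exact: measurable_sqI_slice.
  by under eq_integral do rewrite gee0_abs ?sqI_ge0//.
move=> /(integrable_ae measurableT); apply: filterS => x /= /(_ Logic.I) h.
split; first exact: measurable_slice.
by rewrite -ge0_fin_numE// sqI_ge0.
Qed.

End coordinates.

(** * Kernel operators in one variable *)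

Section Rintegral_fubini.
Context {d1 d2} {T1 : measurableType d1} {T2 : measurableType d2} {R : realType}.
Variables (m1 : {finite_measure set T1 -> \bar R}).
Variables (m2 : {finite_measure set T2 -> \bar R}).
Implicit Type h : T1 * T2 -> R.

Lemma measurable_Rintegral_param h : measurable_fun setT h ->
  measurable_fun setT (fun x => \int[m2]_y h (x, y)).
Proof.
move=> mh; apply: (measurableT_comp (f := fine)) => //.
have mE : measurable_fun setT (EFin \o h) by exact/measurable_EFinP.
rewrite (_ : (fun x => _) = ((fun x => \int[m2]_y (EFin \o h)^\+ (x, y)) \-
  (fun x => \int[m2]_y (EFin \o h)^\- (x, y)))%E); last first.
  apply/funext => x; rewrite integralE /=; congr (_ - _)%E;
    apply: eq_integral => y _; by rewrite ?(funeposE, funenegE).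
apply: emeasurable_funB.
  apply: (measurable_fun_fubini_tonelli_F (m2 := m2) ((EFin \o h)^\+)%E) => //.
  exact: measurable_funepos.
apply: (measurable_fun_fubini_tonelli_F (m2 := m2) ((EFin \o h)^\-)%E) => //.
exact: measurable_funeneg.
Qed.

(** The inner real integral represents the extended one only on integrable slices, hence for almost
    every [x]; elsewhere [fine] may return a default value. *)
Lemma Rintegral12 h : (m1 \x m2)%E.-integrable setT (EFin \o h) ->
  \int[(m1 \x m2)%E]_z h z = \int[m1]_x \int[m2]_y h (x, y).
Proof.
move=> ih; rewrite /Rintegral; congr fine.
rewrite -(integral12_prod_meas1 ih); apply: ae_eq_integralW => //.
apply: filterS (ae_integrable1 ih) => x ix _.
by rewrite /fubini_F fineK//; exact: (integrable_fin_num measurableT ix).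
Qed.

Lemma Rintegral21 h : (m1 \x m2)%E.-integrable setT (EFin \o h) ->
  \int[(m1 \x m2)%E]_z h z = \int[m2]_y \int[m1]_x h (x, y).
Proof.
move=> ih; rewrite /Rintegral; congr fine.
rewrite -(integral21_prod_meas1 ih); apply: ae_eq_integralW => //.
apply: filterS (ae_integrable2 ih) => x ix _.
by rewrite /fubini_G fineK//; exact: (integrable_fin_num measurableT ix).
Qed.

End Rintegral_fubini.

Section cube_Rintegral.
Context {R : realType} {d : nat}.
Local Notation space := 'rV[R]_d.
Local Notation cube := (@cube R d).
Local Notation u01 := (@u01 R).

Lemma integrable_cube_prod s (F : space -> R) :
  cube.-integrable setT (EFin \o F) ->
  (cube \x u01)%E.-integrable setT
    (EFin \o (fun p : space * measurableTypeR R => F (set_coord s p.2 p.1))).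
Proof.
move=> /integrableP[/measurable_EFinP mF Fo].
have mFp : measurable_fun setT (fun p : space * measurableTypeR R => F (set_coord s p.2 p.1)).
  by apply: (measurableT_comp mF); exact: measurable_set_coord2.
have [_ H] := @integrable12ltyP _ _ _ _ R cube u01
  (EFin \o (fun p : space * measurableTypeR R => F (set_coord s p.2 p.1)))
  ((measurable_EFinP setT _).2 mFp).
apply: H.
move: Fo => /=; rewrite (cube_fubini s)//.
by apply/measurable_EFinP; exact: measurableT_comp.
Qed.

Lemma cube_Rfubini s (F : space -> R) : cube.-integrable setT (EFin \o F) ->
  \int[cube]_x F x = \int[cube]_x \int[u01]_y F (set_coord s y x).
Proof.
move=> iF; have iFp := integrable_cube_prod s iF.
rewrite -[RHS](Rintegral12 iFp).
rewrite /Rintegral; congr fine.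
have mphi := @measurable_set_coord2 R d s.
have /integrableP[mF _] := iF.
rewrite (eq_measure_integral (pushforward (cube \x u01)%E
  (fun p => set_coord s p.2 p.1))); last by move=> A mA _; exact: cube_pushforward.
by have := @integral_pushforward _ _ _ _ R _ mphi _ setT (EFin \o F)
  mF iFp measurableT.
Qed.

Lemma sqint_cube_slice s (F f : space -> R) (c : R) : 0 <= c ->
  measurable_fun setT F -> sqint cube f ->
  {ae cube, forall x, sqI u01 (fun y => F (set_coord s y x)) <=
     c%:E * sqI u01 (fun y => f (set_coord s y x))}%E ->
  (sqI cube F <= c%:E * sqI cube f)%E.
Proof.
move=> c0 mF [mf fo] Ff; rewrite (sqI_slice s mF) (sqI_slice s mf).
rewrite -ge0_integralZl//; last first.
- by move=> x _; exact: sqI_ge0.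
- exact: measurable_sqI_slice.
apply: ae_ge0_le_integral => //.
- by move=> x _; exact: sqI_ge0.
- exact: measurable_sqI_slice.
- by move=> x _; rewrite mule_ge0// sqI_ge0.
- by apply: measurable_funeM; exact: measurable_sqI_slice.
- by apply: filterS Ff.
Qed.

End cube_Rintegral.

Section kernel_operators.
Context {R : realType}.
Local Notation u01 := (@u01 R).

(** Joint measurability gives measurable images; the uniform bound gives, by Cauchy-Schwarz on a
    space of mass one, the bound on L^2. *)
Definition bounded_kernel (k : R -> R -> R) : Prop :=
  measurable_fun setT (fun p : measurableTypeR R * measurableTypeR R => k p.1 p.2) /\
  exists M, forall t y, `|k t y| <= M.

Definition kop1 (k : R -> R -> R) (v : R -> R) : R -> R :=
  fun t => \int[u01]_y (k t y * v y).

Lemma bounded_kernelT k : bounded_kernel k -> bounded_kernel (fun t y => k y t).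
Proof.
move=> [mk [M kM]]; split; last by exists M.
apply: (measurableT_comp mk (g := fun p : measurableTypeR R * measurableTypeR R => (p.2, p.1))).
exact: measurable_swap.
Qed.

Lemma kernel_boundW k : bounded_kernel k ->
  exists2 M, 0 <= M & forall t y, `|k t y| <= M.
Proof. by move=> [_ [M kM]]; exists M => //; apply: le_trans (kM 0 0). Qed.

Lemma measurable_kernel1 k t : bounded_kernel k -> measurable_fun setT (k t : measurableTypeR R -> R).
Proof. by move=> [mk _]; apply: (measurableT_comp mk (g := pair t)); exact: pair1_measurable. Qed.

Lemma measurable_kernel2 k y : bounded_kernel k -> measurable_fun setT (k^~ y : measurableTypeR R -> R).
Proof. by move=> [mk _]; apply: (measurableT_comp mk (g := pair^~ y)); exact: pair2_measurable. Qed.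

Lemma sqint_kernel1 k t v : bounded_kernel k -> sqint u01 v ->
  sqint u01 (fun y => k t y * v y).
Proof.
move=> bk sv; have [M M0 kM] := kernel_boundW bk.
by apply: (@sqint_bM _ _ _ _ _ _ M) => //; exact: measurable_kernel1.
Qed.

Lemma integrable_kernel1 k t v : bounded_kernel k -> sqint u01 v ->
  u01.-integrable setT (EFin \o (fun y => k t y * v y)).
Proof. by move=> bk sv; apply: sqint_integrable; exact: sqint_kernel1. Qed.

Lemma measurable_kop1 k v : bounded_kernel k -> measurable_fun setT (v : measurableTypeR R -> R) ->
  measurable_fun setT (kop1 k v : measurableTypeR R -> R).
Proof.
move=> [mk _] mv; apply: (@measurable_Rintegral_param _ _ _ _ _ u01
  (fun p : measurableTypeR R * measurableTypeR R => k p.1 p.2 * v p.2)).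
by apply: measurable_funM => //; exact: measurableT_comp.
Qed.

Lemma Rintegral_u01_cst (c : R) : \int[u01]_y c = c.
Proof. by rewrite Rintegral_cst//= [X in fine X]u01T mulr1. Qed.

Lemma kop1_bound k v M : bounded_kernel k -> (forall t y, `|k t y| <= M) ->
  sqint u01 v -> forall t, kop1 k v t ^+ 2 <= M ^+ 2 * \int[u01]_y (v y ^+ 2).
Proof.
move=> bk kM sv t.
have sk : sqint u01 (k t) by exact: (sqint_bounded _ (measurable_kernel1 t bk) (kM t)).
apply: le_trans (cauchy_schwarz_int sk sv) _.
apply: ler_wpM2r; first by apply: Rintegral_ge0 => x _; exact: sqr_ge0.
rewrite -[leRHS]Rintegral_u01_cst; apply: le_Rintegral => //.
- exact: sqint_sqr.
- exact: (sqint_integrable (sqint_cst _ _)).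
- by move=> y _; rewrite -real_normK ?num_real// lerXn2r ?nnegrE// (le_trans _ (kM t y)).
Qed.

Lemma sqint_kop1 k v : bounded_kernel k -> sqint u01 v -> sqint u01 (kop1 k v).
Proof.
move=> bk sv; have [M M0 kM] := kernel_boundW bk.
have := kop1_bound bk kM sv.
set C := M ^+ 2 * _ => kC.
have C0 : 0 <= C by apply: le_trans (kC 0); exact: sqr_ge0.
apply: (@sqint_bounded _ _ _ _ _ (Num.sqrt C)).
  by apply: measurable_kop1 => //; case: sv.
by move=> t; rewrite -sqrtr_sqr ler_sqrt.
Qed.

Lemma sqI_kop1 k v M : bounded_kernel k -> (forall t y, `|k t y| <= M) ->
  sqint u01 v -> (sqI u01 (kop1 k v) <= (M ^+ 2)%:E * sqI u01 v)%E.
Proof.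
move=> bk kM sv; rewrite (sqI_fin sv) -EFinM (sqI_fin (sqint_kop1 bk sv)) lee_fin.
rewrite -[leRHS]Rintegral_u01_cst; apply: le_Rintegral => //.
- exact/sqint_sqr/sqint_kop1.
- exact: (sqint_integrable (sqint_cst _ _)).
- by move=> t _; exact: kop1_bound.
Qed.

Lemma eq_kop1 k v w t : {ae u01, forall y, v y = w y} -> kop1 k v t = kop1 k w t.
Proof.
move=> vw; rewrite /kop1 /Rintegral; congr fine; apply: ae_eq_integralW => //.
by apply: filterS vw => y /= vw _; rewrite vw.
Qed.

Lemma kop1B k v w t : bounded_kernel k -> sqint u01 v -> sqint u01 w ->
  kop1 k (fun y => v y - w y) t = kop1 k v t - kop1 k w t.
Proof.
move=> bk sv sw; rewrite /kop1 -RintegralB//; [|exact: integrable_kernel1..].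
by apply: eq_Rintegral => y _; rewrite mulrBr.
Qed.

(** Both sides are the integral of $k(t,y)k'(t',y')v(y,y')$ over the square. The kernel factor
    leaves the inner integral on slices where [v] is integrable, which are almost all. *)
Lemma kop1C k k' (v : R -> R -> R) t t' : bounded_kernel k -> bounded_kernel k' ->
  (u01 \x u01)%E.-integrable setT (EFin \o (fun p => v p.1 p.2)) ->
  kop1 k (fun y => kop1 k' (v y) t') t =
  kop1 k' (fun y' => kop1 k (fun y => v y y') t) t'.
Proof.
move=> bk bk' iv.
have [M M0 kM] := kernel_boundW bk; have [M' M'0 kM'] := kernel_boundW bk'.
have mv : measurable_fun setT (fun p : measurableTypeR R * measurableTypeR R => v p.1 p.2).
  by case/integrableP : iv => /measurable_EFinP.
pose h (p : measurableTypeR R * measurableTypeR R) : R := k t p.1 * (k' t' p.2 * v p.1 p.2).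
have mh : measurable_fun setT h.
  apply: measurable_funM.
    apply: measurableT_comp => //; exact: measurable_kernel1.
  apply: measurable_funM => //.
  apply: measurableT_comp => //; exact: measurable_kernel1.
have ih : (u01 \x u01)%E.-integrable setT (EFin \o h).
  apply: (integrable_leM (c := M * M') mh _ iv) => p.
  by rewrite /h !normrM mulrA ler_wpM2r// ler_pM.
transitivity (\int[u01]_y \int[u01]_y' h (y, y')).
  rewrite /kop1 /Rintegral; congr fine; apply: ae_eq_integralW => //.
  apply: filterS (ae_integrable1 iv) => y /= iy _.
  congr EFin; rewrite -/(Rintegral _ _ _) -RintegralZl//.
  apply: (integrable_leM (c := M') _ _ iy).
    apply: measurable_funM; first exact: measurable_kernel1.
    by case/integrableP : iy => /measurable_EFinP.
  by move=> y'; rewrite normrM ler_wpM2r.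
rewrite -(Rintegral12 ih) (Rintegral21 ih).
rewrite /kop1 /Rintegral; congr fine; apply: ae_eq_integralW => //.
apply: filterS (ae_integrable2 iv) => y' /= iy _.
congr EFin; rewrite -/(Rintegral _ _ _) -RintegralZl//.
  by apply: eq_Rintegral => y _; rewrite /h/= mulrCA.
apply: (integrable_leM (c := M) _ _ iy).
  apply: measurable_funM; first exact: measurable_kernel1.
  by case/integrableP : iy => /measurable_EFinP.
by move=> y; rewrite normrM ler_wpM2r.
Qed.

End kernel_operators.

Section kernel_adjoint.
Context {R : realType}.
Local Notation u01 := (@u01 R).
Local Notation Rm := (measurableTypeR R).

Lemma integrable_snd (v : R -> R) : u01.-integrable setT (EFin \o v) ->
  (u01 \x u01)%E.-integrable setT (EFin \o (fun p : Rm * Rm => v p.2)).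
Proof.
move=> /integrableP[/measurable_EFinP mv vo].
have mv2 : measurable_fun setT (fun p : Rm * Rm => v p.2).
  by apply: (measurableT_comp mv).
have [_ H] := @integrable12ltyP _ _ _ _ R u01 u01
  (EFin \o (fun p : Rm * Rm => v p.2)) ((measurable_EFinP setT _).2 mv2).
apply: H => /=.
by rewrite integral_cst// [X in (_ * X)%E]u01T mule1.
Qed.

(** For the kernel [primk] this becomes integration by parts. *)
Lemma kop1_adjoint (k : R -> R -> R) (c v : R -> R) (Mc : R) :
  bounded_kernel k -> sqint u01 v ->
  measurable_fun setT (c : Rm -> R) -> (forall t, `|c t| <= Mc) ->
  \int[u01]_t (kop1 k v t * c t) = \int[u01]_y (v y * \int[u01]_t (k t y * c t)).
Proof.
move=> bk sv mc cM; have [M M0 kM] := kernel_boundW bk; have [mv _] := sv.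
have iv := sqint_integrable sv.
pose h (p : Rm * Rm) : R := (k p.1 p.2 * v p.2) * c p.1.
have mh : measurable_fun setT h.
  apply: measurable_funM; last exact: (measurableT_comp mc).
  by apply: measurable_funM; [case: bk|exact: (measurableT_comp mv)].
have ih : (u01 \x u01)%E.-integrable setT (EFin \o h).
  apply: (integrable_leM (c := M * Mc) mh _ (integrable_snd iv)) => p.
  rewrite /h !normrM mulrAC ler_wpM2r//; exact: ler_pM.
transitivity (\int[u01]_t \int[u01]_y h (t, y)).
  apply: eq_Rintegral => t _; rewrite /h/= RintegralZr//.
  exact: integrable_kernel1.
rewrite -(Rintegral12 ih) (Rintegral21 ih).
apply: eq_Rintegral => y _; rewrite -RintegralZl//.
  by apply: eq_Rintegral => t _; rewrite /h/=; ring.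
apply: sqint_integrable; apply: (@sqint_bM _ _ _ _ _ _ M).
- exact: measurable_kernel2.
- by move=> t; exact: kM.
- exact: (sqint_bounded _ mc cM).
Qed.

End kernel_adjoint.

(** * Kernel operators acting in one variable of the cube *)

Section cube_kernel.
Context {R : realType} {d : nat}.
Local Notation space := 'rV[R]_d.
Local Notation cube := (@cube R d).
Local Notation u01 := (@u01 R).
Local Notation Rm := (measurableTypeR R).
Implicit Types (k : R -> R -> R) (f g : space -> R) (s : 'I_d).

Definition kop k s f : space -> R :=
  fun x => kop1 k (fun y => f (set_coord s y x)) (x 0 s).

Lemma kopE k s f x :
  kop k s f x = kop1 k (fun y => f (set_coord s y x)) (x 0 s).
Proof. by []. Qed.

Lemma kop_slice k s f x t :
  kop k s f (set_coord s t x) = kop1 k (fun y => f (set_coord s y x)) t.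
Proof.
rewrite /kop set_coord_same; congr kop1.
by apply/funext => y; rewrite set_coordK.
Qed.

Lemma measurable_kop k s f : bounded_kernel k -> measurable_fun setT f ->
  measurable_fun setT (kop k s f).
Proof.
move=> [mk _] mf; apply: (@measurable_Rintegral_param _ _ _ _ _ u01
  (fun p : space * Rm => k (p.1 0 s) p.2 * f (set_coord s p.2 p.1))).
apply: measurable_funM; last first.
  by apply: (measurableT_comp mf); exact: measurable_set_coord2.
apply: (measurableT_comp mk (g := fun p : space * Rm => (p.1 0 s : Rm, p.2))).
apply: measurable_fun_pair => //=.
apply: (measurableT_comp (f := fun y : space => y 0 s)) => //.
exact: measurable_coord.
Qed.

Lemma sqI_kop k s f M : bounded_kernel k -> (forall t y, `|k t y| <= M) ->
  sqint cube f -> (sqI cube (kop k s f) <= (M ^+ 2)%:E * sqI cube f)%E.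
Proof.
move=> bk kM sf; apply: (@sqint_cube_slice _ _ s) => //.
- exact: sqr_ge0.
- by apply: measurable_kop => //; case: sf.
apply: filterS (ae_sqint_slice s sf) => x sfx.
apply: le_trans (sqI_kop1 bk kM sfx).
rewrite le_eqVlt; apply/orP; left; apply/eqP; apply: eq_sqI.
exact: kop_slice.
Qed.

Lemma sqint_kop k s f : bounded_kernel k -> sqint cube f -> sqint cube (kop k s f).
Proof.
move=> bk sf; have [M M0 kM] := kernel_boundW bk; split.
  by apply: measurable_kop => //; case: sf.
apply: le_lt_trans (sqI_kop s bk kM sf) _.
by rewrite lte_mul_pinfty// ?lee_fin ?sqr_ge0//; case: sf.
Qed.

Lemma ae_eq_kop k s f g : {ae cube, forall x, f x = g x} ->
  {ae cube, forall x, kop k s f x = kop k s g x}.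
Proof.
move=> fg; apply: filterS (ae_slice s fg) => x fgx.
exact: eq_kop1.
Qed.

Lemma ae_kopB k s f g : bounded_kernel k -> sqint cube f -> sqint cube g ->
  {ae cube, forall x, kop k s (fun x => f x - g x) x = kop k s f x - kop k s g x}.
Proof.
move=> bk sf sg.
apply: filterS2 (ae_sqint_slice s sf) (ae_sqint_slice s sg) => x sfx sgx.
exact: kop1B.
Qed.

(** Commuting two directions requires integrability on almost every plane section. Two applications
    of Fubini make the section square-integrable, and the square has finite mass. *)
Lemma ae_integrable_slice2 s s' f : sqint cube f ->
  {ae cube, forall x, (u01 \x u01)%E.-integrable setT
    (EFin \o (fun p : Rm * Rm => f (set_coord s' p.2 (set_coord s p.1 x))))}.
Proof.
move=> [mf]; rewrite (sqI_slice s' mf) (cube_fubini s); last 2 first.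
- exact: measurable_sqI_slice.
- by move=> x; exact: sqI_ge0.
pose J x := (\int[u01]_y sqI u01 (fun y' => f (set_coord s' y' (set_coord s y x))))%E.
move=> Jo; have J0 x : (0 <= J x)%E by apply: integral_ge0 => y _; exact: sqI_ge0.
have mJ : measurable_fun setT J.
  apply: (measurable_fun_fubini_tonelli_F (m2 := u01)
    (fun p : space * Rm => sqI u01 (fun y' => f (set_coord s' y' (set_coord s p.2 p.1))))).
    apply: (measurableT_comp (measurable_sqI_slice s' mf)).
    exact: measurable_set_coord2.
  by move=> p; exact: sqI_ge0.
have : cube.-integrable setT J.
  apply/integrableP; split => //.
  by under eq_integral do rewrite gee0_abs//.
move=> /(integrable_ae measurableT); apply: filterS => x /= /(_ Logic.I) Jx.
pose h (p : Rm * Rm) : R := f (set_coord s' p.2 (set_coord s p.1 x)).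
have mh : measurable_fun setT h.
  apply: (measurableT_comp mf (g := fun p : Rm * Rm => set_coord s' p.2 (set_coord s p.1 x))).
  apply: (measurableT_comp (measurable_set_coord2 s')
    (g := fun p : Rm * Rm => (set_coord s p.1 x, p.2))).
  apply: measurable_fun_pair => //=.
  by apply: (measurableT_comp (measurable_set_coord s x)).
have sh : sqint (u01 \x u01)%E h.
  split => //; move: Jx; rewrite ge0_fin_numE//; apply: le_lt_trans.
  rewrite le_eqVlt; apply/orP; left; apply/eqP.
  apply: (fubini_tonelli1 (m1 := u01) (m2 := u01) (fun p => (h p ^+ 2)%:E)).
    by apply/measurable_EFinP/measurable_funX.
  by move=> p; rewrite lee_fin sqr_ge0.
have s1 : sqint (u01 \x u01)%E (cst 1).
  split => //; rewrite /sqI/= integral_cst//.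
  rewrite lte_mul_pinfty// ?lee_fin ?sqr_ge0//.
  have E : (u01 \x u01)%E setT = (u01 setT * u01 setT)%E.
    by rewrite -product_measure1E// setXTT.
  have {E} : ((u01 \x u01)%E setT < +oo)%E.
    by rewrite E [X in (X * X)%E]u01T mule1 ltry.
  exact.
have := sqintM sh s1; congr (integrable _ _ _).
by apply/funext => p /=; rewrite mulr1.
Qed.

Lemma ae_kopC k k' s s' f : s != s' -> bounded_kernel k -> bounded_kernel k' ->
  sqint cube f ->
  {ae cube, forall x, kop k s (kop k' s' f) x = kop k' s' (kop k s f) x}.
Proof.
move=> ss' bk bk' sf; apply: filterS (ae_integrable_slice2 s s' sf) => x ix.
transitivity (kop1 k (fun y => kop1 k'
    (fun y' => f (set_coord s' y' (set_coord s y x))) (x 0 s')) (x 0 s)).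
  apply: (congr1 (fun v => kop1 k v (x 0 s))); apply/funext => y.
  by rewrite kopE set_coord_neq// eq_sym.
apply: (etrans (kop1C _ _ bk bk' ix)).
apply: (congr1 (fun v => kop1 k' v (x 0 s'))); apply/funext => y'.
rewrite kopE set_coord_neq//.
apply: (congr1 (fun v => kop1 k v (x 0 s))); apply/funext => y.
by rewrite set_coordC// eq_sym.
Qed.

(** [G] stands for the factors of a tensor product that do not involve $x_s$; on each line it is a
    constant, and the one-variable adjoint applies. *)
Lemma kop_adjoint k s f (c : R -> R) (G : space -> R) (Mc MG : R) :
  bounded_kernel k -> sqint cube f ->
  measurable_fun setT (c : Rm -> R) -> (forall t, `|c t| <= Mc) ->
  measurable_fun setT G -> (forall x, `|G x| <= MG) ->
  (forall t x, G (set_coord s t x) = G x) ->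
  \int[cube]_x (kop k s f x * (c (x 0 s) * G x)) =
  \int[cube]_x (f x * ((\int[u01]_t (k t (x 0 s) * c t)) * G x)).
Proof.
move=> bk sf mc cM mG GM Gs.
have [M M0 kM] := kernel_boundW bk.
have sb (b : R -> R) Mb : measurable_fun setT (b : Rm -> R) ->
    (forall t, `|b t| <= Mb) -> sqint cube (fun x => b (x 0 s) * G x).
  move=> mb bM; apply: (@sqint_bM _ _ _ _ _ _ Mb).
  - by apply: (measurableT_comp mb); exact: measurable_coord.
  - by move=> x; exact: bM.
  - exact: (sqint_bounded _ mG GM).
pose c' y := kop1 (fun t y => k y t) c y.
have c'E y : \int[u01]_t (k t y * c t) = c' y by [].
have sc := sqint_bounded u01 mc cM.
have bkT := bounded_kernelT bk.
have mc' : measurable_fun setT (c' : Rm -> R) by exact: measurable_kop1.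
have [Mc' c'M] : exists Mc', forall t, `|c' t| <= Mc'.
  have := kop1_bound bkT (fun t y => kM y t) sc; set C := M ^+ 2 * _ => kC.
  have C0 : 0 <= C by apply: le_trans (kC 0); exact: sqr_ge0.
  by exists (Num.sqrt C) => t; rewrite -sqrtr_sqr ler_sqrt.
rewrite (cube_Rfubini s (sqintM (sqint_kop s bk sf) (sb _ _ mc cM))).
rewrite [RHS](cube_Rfubini s (sqintM sf (sb _ _ mc' c'M))).
rewrite /Rintegral; congr fine; apply: ae_eq_integralW => //.
apply: filterS (ae_sqint_slice s sf) => x sfx _; congr EFin.
rewrite -!/(Rintegral _ _ _).
transitivity (\int[u01]_y (kop1 k (fun y => f (set_coord s y x)) y * c y * G x)).
  by apply: eq_Rintegral => y _; rewrite kop_slice set_coord_same Gs mulrA.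
rewrite RintegralZr//; last first.
  by apply: sqintM => //; exact: sqint_kop1.
rewrite (kop1_adjoint bk sfx mc cM) -RintegralZr//; last first.
  by apply: sqintM => //; exact: (sqint_bounded u01 mc' c'M).
by apply: eq_Rintegral => y _; rewrite set_coord_same Gs mulrA.
Qed.

End cube_kernel.

(** * Borel representatives of the elements of L^2 *)

Section L2_sqint.
Context {disp : measure_display} {T : measurableType disp} {R : realType}.
Variables (mu : {measure set T -> \bar R}) (D : set T) (mD : measurable D).
Local Notation muD := (mrestr mu mD).
Implicit Type f g : T -> R.

Lemma sqr_poweR_half (x : \bar R) : (0 <= x)%E -> ((x `^ 2^-1) ^+ 2 = x)%E.
Proof.
case: x => [x|_|//].
  rewrite lee_fin => x0; rewrite poweR_EFin -EFin_expe; congr EFin.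
  by rewrite -powR_mulrn ?powR_ge0// -powRrM mulVf// powRr1.
by rewrite poweRyr ?invr_eq0// expeS expe1 mulyy.
Qed.

Let sqI_patch g : measurable_fun setT g -> sqI muD g = sqI mu (g \_ D).
Proof.
move=> mg; rewrite /sqI integral_mrestr integral_mkcond.
apply: eq_integral => x _; rewrite !patchE; case: ifPn => // _.
by rewrite expr0n.
Qed.

Let measurable_patch g : measurable_fun setT g -> measurable_fun setT (g \_ D).
Proof.
move=> mg; apply/(measurable_restrictT g mD); exact: measurable_funTS.
Qed.

Let sqint_Lfun g : sqint mu g -> g \in Lfun mu 2%:E.
Proof.
move=> [mg go]; rewrite inE; apply/andP; split; rewrite inE//=.
rewrite /finite_norm unlock /Lnorm; apply: poweR_lty.
apply: le_lt_trans go; rewrite le_eqVlt; apply/orP; left; apply/eqP.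
apply: eq_integral => x _ /=; congr EFin.
by rewrite powR_mulrn// real_normK// num_real.
Qed.

Let Lfun_sqint g : g \in Lfun mu 2%:E -> sqint mu g.
Proof.
move=> Lg; have iS := Lfun2_integrable_sqr Lg; split.
  by move: Lg; rewrite inE => /andP[]; rewrite inE.
exact: (integrable_lty measurableT iS).
Qed.

Lemma L2_sqint f : L2 mu D f ->
  exists2 g, sqint muD g & {ae muD, forall x, f x = g x}.
Proof.
move=> [g Lg fg]; exists g; last by apply/ae_mrestr.
have [mg go] := Lfun_sqint Lg; split => //.
rewrite sqI_patch//; apply: le_lt_trans go; apply: le_sqI => //.
  exact: measurable_patch.
by apply: aeW => x; rewrite patchE; case: ifP; rewrite // normr0.
Qed.

Lemma sqint_L2 f g : sqint muD g -> {ae muD, forall x, f x = g x} -> L2 mu D f.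
Proof.
move=> [mg go] /ae_mrestr fg; exists (g \_ D).
  apply: sqint_Lfun; split; first exact: measurable_patch.
  by rewrite -sqI_patch.
apply: filterS fg => x fg Dx; rewrite patchE mem_set//; exact: fg.
Qed.

Lemma L2norm_sqr f : L2 mu D f -> (L2norm mu D f ^+ 2 = sqI muD f)%E.
Proof.
move=> Lf; rewrite /L2norm asboolT// unlock /Lnorm sqr_poweR_half; last first.
  by apply: integral_ge0 => x _; exact: poweR_ge0.
rewrite /sqI integral_mrestr [RHS]integral_mkcond.
apply: eq_integral => x _ /=; rewrite !patchE; case: ifPn => _ /=.
  by rewrite powR_mulrn// real_normK// num_real.
by rewrite normr0 powR0// expr0n.
Qed.

End L2_sqint.

(** * Piecewise polynomial projections *)

Section cells.
Context {R : realType}.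
Local Notation u01 := (@u01 R).
Local Notation leb := (@lebesgue_measure R).
Local Notation Rm := (measurableTypeR R).
Implicit Types (a b t y : R) (f g : R -> R) (p : {poly R}).

(** Half-open intervals, so that the cells partition $[0,1)$ and [chi] is exactly a difference of
    two values of [primk]. *)
Definition chi a b y : R := ((a <= y) && (y < b))%:R.

(* The kernel of the primitive vanishing at [0]. *)
Definition primk t y : R := (y < t)%R%:R.

Lemma chi_ge0 a b y : 0 <= chi a b y.
Proof. by rewrite /chi ler0n. Qed.

Lemma chi_norm a b y : `|chi a b y| <= 1.
Proof. by rewrite /chi; case: (_ && _); rewrite ?normr1// normr0. Qed.

Lemma chi_idem a b y : chi a b y * chi a b y = chi a b y.
Proof. by rewrite /chi; case: (_ && _); rewrite ?mulr1// mulr0. Qed.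

Lemma measurable_chi a b : measurable_fun setT (chi a b : Rm -> R).
Proof.
rewrite (_ : chi a b = \1_(`[a, b[%classic)).
  by apply: measurable_indic; exact: measurable_itv.
apply/funext => y; rewrite indicE /chi; congr (_%:R).
by rewrite mem_setE in_itv.
Qed.

Lemma bounded_primk : bounded_kernel primk.
Proof.
split; last by exists 1 => t y; rewrite /primk; case: (_ < _); rewrite ?normr1// normr0.
rewrite (_ : (fun _ => _) = \1_[set p : Rm * Rm | p.2 < p.1]).
  apply: measurable_indic.
  have := @measurable_fun_ltr _ (Rm * Rm)%type R setT snd fst measurable_snd measurable_fst.
  move=> /(_ measurableT [set true]); rewrite setTI; apply; exact: I.
apply/funext => p; rewrite indicE /primk; congr ((nat_of_bool _)%:R).
by apply/idP/idP => [h|]; rewrite inE.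
Qed.

Lemma primk_chi a b y : a <= b -> primk b y - primk a y = chi a b y.
Proof.
move=> ab; rewrite /primk /chi leNgt.
have [ya|ya] := ltP y a; first by rewrite (lt_le_trans ya ab) subrr.
by case: (_ < _); rewrite subr0.
Qed.

Lemma sqint_chi a b f : sqint u01 f -> sqint u01 (fun y => chi a b y * f y).
Proof.
move=> sf; apply: (sqint_bM (M := 1)) => //; first exact: measurable_chi.
by move=> y; exact: chi_norm.
Qed.

Lemma kop1_primkB a b f : a <= b -> sqint u01 f ->
  kop1 primk f b - kop1 primk f a = \int[u01]_y (chi a b y * f y).
Proof.
move=> ab sf; rewrite /kop1 -RintegralB//; [|exact: (integrable_kernel1 _ bounded_primk sf)..].
by apply: eq_Rintegral => y _; rewrite -mulrBl primk_chi.
Qed.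

(** Endpoints are null, so [D] may contain either of them or not; this covers the open, closed and
    half-open intervals of the various definitions at once. *)
Lemma Rintegral_chi a b f (D : set R) : 0 <= a -> b <= 1 -> measurable D ->
  `]a, b[%classic `<=` D -> D `<=` `[a, b]%classic ->
  \int[u01]_y (chi a b y * f y) = \int[leb]_(y in D) f y.
Proof.
move=> a0 b1 mD abD Dab; rewrite /Rintegral; congr fine.
rewrite integral_u01 [LHS]integral_mkcond [RHS]integral_mkcond.
apply: ae_eq_integralW => //.
exists [set a; b]; split.
- by apply: measurableU; exact: measurable_set1.
- apply/eqP; rewrite -measure_le0; apply: le_trans (measureU2 _ _ _) _ => //.
  by rewrite [X in (X + _)%E]lebesgue_measure_set1 [X in (_ + X)%E]lebesgue_measure_set1 adde0.
move=> y /= nE; apply: contrapT => /not_orP[ya yb]; apply: nE => _.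
rewrite !patchE /chi.
have [yD|yD] := boolP (y \in D).
  move: yD; rewrite inE => /Dab /=; rewrite in_itv/= => /andP[ay yb'].
  rewrite ay lt_neqAle yb' andbT.
  have /eqP -> : y <> b by [].
  rewrite mul1r; case: ifPn => //; rewrite notin_setE/= in_itv/=; move=> /negP.
  rewrite negb_and -!leNgt => /orP[y0|y1]; exfalso.
    by apply: ya; apply/eqP; rewrite eq_le ay (le_trans y0 a0).
  by apply: yb; apply/eqP; rewrite eq_le yb' (le_trans b1 y1).
case: ifPn => // _; case: andP => [[ay yb']|_]; last by rewrite mul0r.
exfalso; move: yD; rewrite notin_setE; apply; apply: abD => /=.
by rewrite in_itv/= yb' andbT lt_neqAle ay andbT eq_sym; apply/eqP.
Qed.

Lemma Rintegral_chi_cc a b f : 0 <= a -> b <= 1 ->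
  \int[u01]_y (chi a b y * f y) = \int[leb]_(y in `[a, b]) f y.
Proof. by move=> a0 b1; apply: Rintegral_chi => //; exact: subset_itv_oo_cc. Qed.

Lemma measurable_horner p : measurable_fun setT (fun y : Rm => p.[y]).
Proof. by apply: continuous_measurable_fun => y; exact: continuous_horner. Qed.

Lemma sqint_horner p : sqint u01 (fun y => p.[y]).
Proof.
pose M := \sum_(i < size p) `|p`_i|.
apply: (sqint_le _ (sqint_cst u01 M)); first exact: measurable_horner.
apply/ae_u01; apply: aeW => y /=; rewrite in_itv/= => /andP[y0 y1].
rewrite [leRHS]ger0_norm ?sumr_ge0// horner_coef.
apply: le_trans (ler_norm_sum _ _ _) _; apply: ler_sum => i _.
rewrite normrM normrX ler_piMr//.
by rewrite exprn_ile1// ger0_norm ?ltW.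
Qed.

Lemma Rintegral_chi_deriv a b p : 0 <= a -> a <= b -> b <= 1 ->
  \int[u01]_y (chi a b y * p^`().[y]) = p.[b] - p.[a].
Proof.
move=> a0; rewrite le_eqVlt => /predU1P[->|ab] b1.
  rewrite subrr /Rintegral integral0_eq// => y _.
  by rewrite /chi leNgt andNb mul0r.
rewrite Rintegral_chi_cc// /Rintegral.
rewrite (@continuous_FTC2 _ _ (fun x => p.[x]) _ _ ab)//.
- by apply: continuous_subspaceT => y; exact: continuous_horner.
- split.
  + by move=> y _; exact: derivable_horner.
  + by apply: cvg_at_right_filter; exact: continuous_horner.
  + by apply: cvg_at_left_filter; exact: continuous_horner.
- by move=> y _; rewrite derivE.
Qed.

Lemma Rintegral_chi1 a b : 0 <= a -> a <= b -> b <= 1 ->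
  \int[u01]_y (chi a b y) = b - a.
Proof.
move=> a0 ab b1; have := Rintegral_chi_deriv 'X a0 ab b1.
rewrite !hornerX => <-; apply: eq_Rintegral => y _.
by rewrite derivX hornerE mulr1.
Qed.

Lemma antiderivative_poly p : exists2 P, P^`() = p & (size P <= (size p).+1)%N.
Proof.
exists (\poly_(i < (size p).+1) (p`_i.-1 / i%:R)); last exact: size_poly.
apply/polyP => i; rewrite coef_deriv coef_poly ltnS.
case: ltnP => [ip|ip]; last by rewrite mul0rn nth_default.
by rewrite -[LHS]mulr_natr -mulrA mulVf ?mulr1// pnatr_eq0.
Qed.

(** A nonzero polynomial has finitely many roots, so [chi] itself would vanish almost everywhere,
    against its integral $b-a$. *)
Lemma poly_ae0 a b p : 0 <= a -> a < b -> b <= 1 ->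
  {ae u01, forall y, chi a b y * p.[y] = 0} -> p = 0.
Proof.
move=> a0 ab b1 h0; apply/eqP; apply: contraT => pn0; exfalso.
have : {ae u01, forall y, chi a b y = 0}.
  have froots : {ae u01, forall y, ~ root p y}.
    have cr : countable [set y | root p y].
      apply: finite_set_countable; apply: contrapT => /infiniteP/pcard_leP/unsquash g.
      have := @max_poly_roots _ p [seq g i | i <- iota 0 (size p)] pn0.
      rewrite size_map size_iota ltnn => H; apply: notF; apply: H.
        by apply/allP => _ /mapP[i _ ->]; exact: (@funS _ _ _ _ g).
      by rewrite map_inj_uniq ?iota_uniq// => i j; apply: inj; rewrite inE.
    apply/ae_u01; exists [set y | root p y]; split.
    - exact: countable_measurable.
    - exact: countable_lebesgue_measure0.
    - by move=> y /= H; apply: contrapT => H'; apply: H => _.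
  move: h0 froots; apply: filterS2 => y /eqP; rewrite mulf_eq0 => /orP[/eqP//|].
  by move=> /[!rootE] ->.
move=> c0; have := Rintegral_chi1 a0 (ltW ab) b1.
rewrite /Rintegral (@ae_eq_integralW _ _ _ _ _ _ (cst 0%E))//; last first.
  by apply: filterS c0 => y -> _.
rewrite integral0 /= => /esym/eqP; rewrite subr_eq0 => /eqP ba.
by rewrite ba ltxx in ab.
Qed.

End cells.

(** * Orthogonal projection onto polynomials on one cell *)

Section cell_projection.
Context {R : realType}.
Local Notation u01 := (@u01 R).
Implicit Types (a b y : R) (f g q : R -> R) (p w : {poly R}).

Definition cint a b f : R := \int[u01]_y (chi a b y * f y).

Local Notation intg f := (u01.-integrable setT (EFin \o f)).

Lemma intg_chi a b f : intg f -> intg (fun y => chi a b y * f y).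
Proof.
move=> intf; apply: (integrable_leM (c := 1) _ _ intf).
  apply: measurable_funM; first exact: measurable_chi.
  by case/integrableP : intf => /measurable_EFinP.
by move=> y; rewrite normrM ler_wpM2r// chi_norm.
Qed.

Lemma cintD a b f g : intg f -> intg g ->
  cint a b (fun y => f y + g y) = cint a b f + cint a b g.
Proof.
move=> intf intg; rewrite /cint -RintegralD//; [|exact: intg_chi..].
by apply: eq_Rintegral => y _; rewrite mulrDr.
Qed.

Lemma cintB a b f g : intg f -> intg g ->
  cint a b (fun y => f y - g y) = cint a b f - cint a b g.
Proof.
move=> intf intg; rewrite /cint -RintegralB//; [|exact: intg_chi..].
by apply: eq_Rintegral => y _; rewrite mulrBr.
Qed.

Lemma cintZ a b c f : intg f -> cint a b (fun y => c * f y) = c * cint a b f.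
Proof.
move=> intf; rewrite /cint -RintegralZl//; last exact: intg_chi.
by apply: eq_Rintegral => y _; rewrite mulrCA.
Qed.

Lemma eq_cint a b f g : (forall y, a <= y < b -> f y = g y) ->
  cint a b f = cint a b g.
Proof.
move=> fg; apply: eq_Rintegral => y _; rewrite /chi.
by case: (boolP (a <= y < b)) => [/fg ->//|_]; rewrite !mul0r.
Qed.

Lemma ae_eq_cint a b f g : {ae u01, forall y, f y = g y} ->
  cint a b f = cint a b g.
Proof.
move=> fg; rewrite /cint /Rintegral; congr fine; apply: ae_eq_integralW => //.
by apply: filterS fg => y -> _.
Qed.

Lemma cint_ge0 a b f : (forall y, 0 <= f y) -> 0 <= cint a b f.
Proof. by move=> f0; apply: Rintegral_ge0 => y _; rewrite mulr_ge0// chi_ge0. Qed.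

Lemma le_cint a b f g : intg f -> intg g ->
  (forall y, a <= y < b -> f y <= g y) -> cint a b f <= cint a b g.
Proof.
move=> intf intg fg; apply: le_Rintegral => //; [exact: intg_chi..|].
move=> y _; rewrite /chi; case: (boolP (a <= y < b)) => [/fg h|_].
  by rewrite !mul1r.
by rewrite !mul0r.
Qed.

Lemma cint_sum a b I (s : seq I) (F : I -> R -> R) :
  (forall i, intg (F i)) ->
  cint a b (fun y => \sum_(i <- s) F i y) = \sum_(i <- s) cint a b (F i).
Proof.
move=> iF; have key r : intg (fun y => \sum_(i <- r) F i y) /\
    cint a b (fun y => \sum_(i <- r) F i y) = \sum_(i <- r) cint a b (F i).
  elim: r => [|i r [IH1 IH2]].
    rewrite big_nil; split.
      under eq_fun do rewrite big_nil.
      exact: (sqint_integrable (sqint0 _)).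
    by rewrite /cint /Rintegral integral0_eq// => y _; rewrite big_nil mulr0.
  have E : (fun y => \sum_(j <- i :: r) F j y) =
      (fun y => F i y + \sum_(j <- r) F j y).
    by apply/funext => y; rewrite big_cons.
  rewrite E big_cons; split; last by rewrite cintD// IH2.
  by have := integrableD measurableT (iF i) IH1.
by have [] := key s.
Qed.

Definition ip a b p w : R := cint a b (fun y => p.[y] * w.[y]).

Lemma intg_hornerM p w : intg (fun y => p.[y] * w.[y]).
Proof. by apply: sqintM; exact: sqint_horner. Qed.

Lemma ipC a b p w : ip a b p w = ip a b w p.
Proof. by apply: eq_cint => y _; rewrite mulrC. Qed.

Lemma ipDl a b p p' w : ip a b (p + p') w = ip a b p w + ip a b p' w.
Proof.
rewrite /ip -cintD; [|exact: intg_hornerM..].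
by apply: eq_cint => y _; rewrite hornerD mulrDl.
Qed.

Lemma ipZl a b c p w : ip a b (c *: p) w = c * ip a b p w.
Proof.
rewrite /ip -cintZ; last exact: intg_hornerM.
by apply: eq_cint => y _; rewrite hornerZ mulrA.
Qed.

Lemma ip0l a b w : ip a b 0 w = 0.
Proof. by rewrite -(scale0r 0) ipZl mul0r. Qed.

Lemma ipBl a b p p' w : ip a b (p - p') w = ip a b p w - ip a b p' w.
Proof. by rewrite -scaleN1r ipDl ipZl mulN1r. Qed.

Lemma ip_suml a b I (s : seq I) (F : I -> {poly R}) w :
  ip a b (\sum_(i <- s) F i) w = \sum_(i <- s) ip a b (F i) w.
Proof.
elim: s => [|i s IH]; first by rewrite !big_nil ip0l.
by rewrite !big_cons ipDl IH.
Qed.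

Lemma ip_eq0 a b p : 0 <= a -> a < b -> b <= 1 -> ip a b p p = 0 -> p = 0.
Proof.
move=> a0 ab b1 ip0; apply: (poly_ae0 a0 ab b1).
have ii := intg_chi a b (intg_hornerM p p).
have : (\int[u01]_y `|(chi a b y * (p.[y] * p.[y]))%:E| = 0)%E.
  have /= F := integrable_fin_num measurableT ii.
  transitivity (\int[u01]_y (chi a b y * (p.[y] * p.[y]))%:E)%E.
    apply: eq_integral => y _ /=; rewrite ger0_norm// mulr_ge0 ?chi_ge0//.
    by rewrite -expr2 sqr_ge0.
  by rewrite -[LHS](fineK F); congr EFin.
have /integrableP[mi _] := ii.
move=> /(ae_eq_integral_abs u01 measurableT mi); apply: filterS => y /(_ Logic.I) /= [].
by move/eqP; rewrite mulf_eq0 mulf_eq0 orbb -mulf_eq0 => /eqP.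
Qed.

Lemma ip_gt0 a b p : 0 <= a -> a < b -> b <= 1 -> p != 0 -> 0 < ip a b p p.
Proof.
move=> a0 ab b1 pn0; rewrite lt_def; apply/andP; split.
  by apply: contra pn0 => /eqP /(ip_eq0 a0 ab b1) ->.
by apply: cint_ge0 => y; rewrite -expr2 sqr_ge0.
Qed.

(** The expansion formula of an orthonormal basis (a Parseval frame). It turns the projection into a
    kernel operator with kernel $\sum_e e(t)e(y)$. *)
Definition reproducing n a b (es : seq {poly R}) :=
  (forall e, e \in es -> (size e <= n)%N) /\
  (forall w, (size w <= n)%N -> w = \sum_(e <- es) ip a b w e *: e).

(** Gram-Schmidt: [u] is the monomial of degree [n] minus its projection onto lower degrees, and its
    normalisation joins the family. *)
Lemma exists_reproducing n a b : 0 <= a -> a < b -> b <= 1 ->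
  exists es, reproducing n a b es.
Proof.
move=> a0 ab b1; elim: n => [|n [es [esn esP]]].
  exists [::]; split => // w; rewrite leqn0 size_poly_eq0 => /eqP ->.
  by rewrite big_nil.
pose u := 'X^n - \sum_(e <- es) ip a b 'X^n e *: e.
have su : (size (\sum_(e <- es) ip a b 'X^n e *: e)%R <= n)%N.
  apply: (leq_trans (size_sum _ _ _)); apply/bigmax_leqP_seq => e ees _.
  by apply: (leq_trans (size_scale_leq _ _)); exact: esn.
have un : u`_n = 1 by rewrite coefB coefXn eqxx (nth_default _ su) subr0.
have size_u : (size u <= n.+1)%N.
  rewrite (leq_trans (size_polyD _ _))// size_polyN size_polyXn geq_max leqnn/=.
  exact: leq_trans su _.
have un0 : u != 0.
  apply/negP => /eqP u0; move: un; rewrite u0 coef0 => /esym/eqP.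
  by rewrite oner_eq0.
have uo w : (size w <= n)%N -> ip a b w u = 0.
  move=> sw; rewrite ipC ipBl {1}(esP w sw) ipC ip_suml ip_suml.
  rewrite -sumrB big1// => e _.
  by rewrite !ipZl [ip a b e 'X^n]ipC [ip a b e w]ipC mulrC subrr.
have N0 := ip_gt0 a0 ab b1 un0; set N := ip a b u u in N0.
exists ((Num.sqrt N)^-1 *: u :: es); split => [e|w sw].
  rewrite inE => /predU1P[->|/esn]; last exact: leqW.
  exact: leq_trans (size_scale_leq _ _) size_u.
(* [u] has coefficient 1 in degree [n], so this subtraction lowers the degree and the induction
   hypothesis applies. *)
have sw' : (size (w - w`_n *: u)%R <= n)%N.
  apply/leq_sizeP => j; rewrite leq_eqVlt => /predU1P[<-|nj].
    by rewrite coefB coefZ un mulr1 subrr.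
  rewrite coefB coefZ (nth_default _ (leq_trans sw nj)).
  by rewrite (nth_default _ (leq_trans size_u nj)) mulr0 subrr.
have wE : w = (w - w`_n *: u) + w`_n *: u by rewrite subrK.
rewrite big_cons [in LHS]wE addrC; congr (_ + _).
  rewrite ipC ipZl ipC {2}wE ipDl (uo _ sw') add0r ipZl -/N scalerA.
  congr (_ *: u); have N00 : Num.sqrt N != 0 by rewrite sqrtr_eq0 -ltNge.
  rewrite -[X in _ * (_ * X)]sqr_sqrtr ?ltW//; field.
  by [].
rewrite [in LHS](esP _ sw'); apply: eq_big_seq => e ees.
have -> // : ip a b w e = ip a b (w - w`_n *: u) e.
by rewrite {1}wE ipDl ipZl [ip a b u e]ipC (uo _ (esn _ ees)) mulr0 addr0.
Qed.

Definition cell_basis n a b : seq {poly R} := xget [::] (reproducing n a b).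

Definition cell_proj n a b q : {poly R} :=
  \sum_(e <- cell_basis n a b) cint a b (fun y => e.[y] * q y) *: e.

Section one_cell.
Variables (n : nat) (a b : R) (a0 : 0 <= a) (ab : a < b) (b1 : b <= 1).

Lemma cell_basisP : reproducing n a b (cell_basis n a b).
Proof. by apply: xgetPex; exact: exists_reproducing. Qed.

Lemma size_cell_proj q : (size (cell_proj n a b q) <= n)%N.
Proof.
have [esn _] := cell_basisP.
apply: (leq_trans (size_sum _ _ _)); apply/bigmax_leqP_seq => e ees _.
by apply: (leq_trans (size_scale_leq _ _)); exact: esn.
Qed.

Lemma cell_proj_orth q w : sqint u01 q -> (size w <= n)%N ->
  cint a b (fun y => (q y - (cell_proj n a b q).[y]) * w.[y]) = 0.
Proof.
move=> sq sw; have [_ esP] := cell_basisP.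
have iq p : intg (fun y => p.[y] * q y).
  by apply: sqintM => //; exact: sqint_horner.
transitivity (cint a b (fun y => w.[y] * q y - (cell_proj n a b q).[y] * w.[y])).
  by apply: eq_cint => y _; rewrite mulrBl [q y * _]mulrC.
rewrite cintB//; last exact: intg_hornerM.
rewrite -/(ip a b (cell_proj n a b q) w) ip_suml.
transitivity (cint a b (fun y => \sum_(e <- cell_basis n a b) (ip a b w e * (e.[y] * q y))) -
  \sum_(i <- cell_basis n a b) ip a b (cint a b (fun y => i.[y] * q y) *: i) w).
  congr (_ - _); apply: eq_cint => y _; rewrite {1}(esP w sw) horner_sum mulr_suml.
  by apply: eq_bigr => e _; rewrite hornerZ mulrA.
rewrite cint_sum; last first.
  by move=> e; exact: (integrableZl measurableT (ip a b w e) (iq e)).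
apply/eqP; rewrite subr_eq0; apply/eqP; apply: eq_bigr => e _.
by rewrite cintZ// ipZl mulrC [ip a b e w]ipC.
Qed.

(** Pythagoras: the cross term vanishes because $P-p$ has degree below [n]. *)
Lemma cell_proj_best q p : sqint u01 q -> (size p <= n)%N ->
  cint a b (fun y => (q y - (cell_proj n a b q).[y]) ^+ 2) <=
  cint a b (fun y => (q y - p.[y]) ^+ 2).
Proof.
move=> sq sp; set P := cell_proj n a b q.
have sP := size_cell_proj q; rewrite -/P in sP.
have sqP : sqint u01 (fun y => q y - P.[y]) by apply: sqintB => //; exact: sqint_horner.
have -> : cint a b (fun y => (q y - p.[y]) ^+ 2) =
    cint a b (fun y => (q y - P.[y]) ^+ 2 + ((2 * ((q y - P.[y]) * (P - p).[y])) +
      (P - p).[y] * (P - p).[y])).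
  by apply: eq_cint => y _; rewrite hornerD hornerN; ring.
have iP : intg (fun y => (q y - P.[y]) * (P - p).[y]).
  by apply: sqintM => //; exact: sqint_horner.
have i2P := integrableZl measurableT 2 iP.
have iPP := intg_hornerM (P - p) (P - p).
rewrite cintD; last 2 first.
- exact: sqint_sqr.
- exact: (integrableD measurableT i2P iPP).
rewrite cintD// cintZ// cell_proj_orth//; last first.
  by rewrite (leq_trans (size_polyD _ _))// size_polyN geq_max sP sp.
rewrite mulr0 add0r lerDl; apply: cint_ge0 => y.
by rewrite -expr2 sqr_ge0.
Qed.

End one_cell.

End cell_projection.

(** * Error estimates on cells and on the interval *)

Section one_dimensional_estimates.
Context {R : realType}.
Local Notation u01 := (@u01 R).
Local Notation Rm := (measurableTypeR R).
Local Notation intg f := (u01.-integrable setT (EFin \o f)).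
Local Notation J := (kop1 (@primk R)).
Implicit Types (a b t y : R) (f g q : R -> R) (p w : {poly R}) (m k i : nat).

(** By Cauchy-Schwarz, $|Jf(t)-Jf(a)|^2\le(t-a)\int_a^b f^2$ on the cell; integrating over $t$ gives
    the second factor $b-a$. *)
Lemma prim_cell a b f : 0 <= a -> a <= b -> b <= 1 -> sqint u01 f ->
  cint a b (fun t => (J f t - J f a) ^+ 2) <=
  (b - a) ^+ 2 * cint a b (fun y => f y ^+ 2).
Proof.
move=> a0 ab b1 sf; set C := cint a b (fun y => f y ^+ 2).
have C0 : 0 <= C by apply: cint_ge0 => y; exact: sqr_ge0.
have sJ := sqint_kop1 bounded_primk sf.
have key t : a <= t < b -> (J f t - J f a) ^+ 2 <= (b - a) * C.
  move=> /andP[at_ tb]; rewrite kop1_primkB//.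
  have -> : \int[u01]_y (chi a t y * f y) =
      \int[u01]_y (chi a t y * (chi a b y * f y)).
    apply: eq_Rintegral => y _; rewrite mulrA /chi.
    case: (boolP (a <= y)) => //= ay; last by rewrite !mul0r.
    by case: ltP => [yt|]; rewrite ?mul0r// (lt_trans yt tb) !mul1r.
  have s1 : sqint u01 (chi a t).
    apply: (sqint_bounded _ (M := 1)); first exact: measurable_chi.
    by move=> y; exact: chi_norm.
  apply: le_trans (cauchy_schwarz_int s1 (sqint_chi a b sf)) _.
  have -> : \int[u01]_y (chi a t y ^+ 2) = t - a.
    rewrite -(@Rintegral_chi1 _ a t)// ?(le_trans (ltW tb))//.
    by apply: eq_Rintegral => y _; rewrite expr2 chi_idem.
  have -> : \int[u01]_y ((chi a b y * f y) ^+ 2) = C.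
    by apply: eq_Rintegral => y _; rewrite exprMn [chi a b y ^+ 2]expr2 chi_idem.
  by apply: ler_wpM2r => //; rewrite lerB// ltW.
apply: (@le_trans _ _ (cint a b (fun=> (b - a) * C))).
  apply: le_cint => //.
  - exact: (sqint_sqr (sqintB sJ (sqint_cst u01 (J f a)))).
  - exact: (sqint_integrable (sqint_cst _ _)).
rewrite /cint RintegralZr//; last first.
  apply: sqint_integrable; apply: (sqint_bounded _ (M := 1)); first exact: measurable_chi.
  by move=> y; exact: chi_norm.
by rewrite Rintegral_chi1// expr2 mulrA.
Qed.

(* [v 0] has weak derivatives [v 1, ..., v r]. *)
Definition derivs r (v : nat -> R -> R) : Prop :=
  (forall j, (j <= r)%N -> sqint u01 (v j)) /\
  (forall j, (j < r)%N -> exists c, {ae u01, forall t, v j t = c + J (v j.+1) t}).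

Lemma derivsS r v : derivs r.+1 v -> derivs r (fun j => v j.+1).
Proof. by move=> [sv dv]; split => j jr; [exact: sv|exact: dv]. Qed.

(** Induction on the order: approximate the derivative, integrate its polynomial and gain one more
    factor $b-a$ from [prim_cell]. The constant of integration makes the error of the continuous
    representative vanish at $a$. *)
Lemma taylor_cell r v a b : 0 <= a -> a < b -> b <= 1 -> derivs r v ->
  exists2 p : {poly R}, (size p <= r)%N &
    cint a b (fun y => (v 0 y - p.[y]) ^+ 2) <=
    ((b - a) ^+ r) ^+ 2 * cint a b (fun y => v r y ^+ 2).
Proof.
move=> a0 ab b1; elim: r v => [|r IH] v dv.
  exists 0; first by rewrite size_poly0.
  rewrite expr0 expr1n mul1r; apply: le_cint.
  - apply/sqint_sqr/sqintB; first by apply dv.1.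
    exact: sqint_horner.
  - by apply/sqint_sqr; apply dv.1.
  - by move=> y _; rewrite horner0 subr0.
have [p1 sp1 p1P] := IH _ (derivsS dv).
have [c vE] := dv.2 0 isT.
have [P dP sP] := antiderivative_poly p1.
have s1 : sqint u01 (v 1) by apply dv.1.
have s1p : sqint u01 (fun y => v 1 y - p1.[y]) by apply: sqintB => //; exact: sqint_horner.
exists (P + (c + J (v 1) a - P.[a])%:P).
  rewrite (leq_trans (size_polyD _ _))// geq_max (leq_trans sP)//=.
  by rewrite (leq_trans (size_polyC_leq1 _)).
have -> : cint a b (fun y => (v 0 y - (P + (c + J (v 1) a - P.[a])%:P).[y]) ^+ 2) =
  cint a b (fun y => (J (fun y => v 1 y - p1.[y]) y - J (fun y => v 1 y - p1.[y]) a) ^+ 2).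
  transitivity (cint a b (fun y => (c + J (v 1) y - (P + (c + J (v 1) a - P.[a])%:P).[y]) ^+ 2)).
    by apply: ae_eq_cint; apply: filterS vE => y ->.
  apply: eq_cint => y /andP[ay yb]; congr (_ ^+ 2).
  have E : J (fun y => p1.[y]) y - J (fun y => p1.[y]) a = P.[y] - P.[a].
    rewrite (kop1_primkB ay (sqint_horner p1)) -dP Rintegral_chi_deriv//.
    exact: le_trans (ltW yb) b1.
  rewrite !(kop1B _ bounded_primk s1 (sqint_horner p1)) hornerD hornerC.
  move: E; set A := J (fun y => p1.[y]) y; set B := J (fun y => p1.[y]) a.
  set A' := J (v 1) y; set B' := J (v 1) a => E; lra.
apply: le_trans (prim_cell a0 (ltW ab) b1 s1p) _.
have -> : ((b - a) ^+ r.+1) ^+ 2 = (b - a) ^+ 2 * ((b - a) ^+ r) ^+ 2.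
  by rewrite [_ ^+ r.+1]exprS exprMn.
by rewrite -mulrA ler_wpM2l ?sqr_ge0.
Qed.

Lemma node_ge0 m i : 0 <= (node m i : R).
Proof. by rewrite /node divr_ge0. Qed.

Lemma node_le1 m i : (i <= 2 ^ m)%N -> (node m i : R) <= 1.
Proof. by move=> im; rewrite /node ler_pdivrMr ?exprn_gt0// mul1r -natrX ler_nat. Qed.

Lemma nodeB m i : (node m i.+1 : R) - node m i = 2 ^- m.
Proof. by rewrite /node -mulrBl -natrB// subSnn mul1r. Qed.

Lemma node_lt m i : (node m i : R) < node m i.+1.
Proof. by rewrite -subr_gt0 nodeB invr_gt0 exprn_gt0. Qed.

Lemma node0 m : (node m 0 : R) = 0.
Proof. by rewrite /node mul0r. Qed.

Lemma node_last m : (node m (2 ^ m) : R) = 1.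
Proof. by rewrite /node natrX divff// expf_neq0. Qed.

Lemma node_le m i j : (i <= j)%N -> (node m i : R) <= node m j.
Proof. by move=> ij; rewrite /node ler_pM2r ?ler_nat// invr_gt0 exprn_gt0. Qed.

Definition cell_chi m i : R -> R := chi (node m i) (node m i.+1).

Lemma cell_chiE m i j t : node m i <= t < node m i.+1 ->
  cell_chi m j t = (j == i)%:R.
Proof.
move=> /andP[it ti]; rewrite /cell_chi /chi; congr ((nat_of_bool _)%:R).
case: ltngtP => [ji|ij|->]; last by rewrite it ti.
  by rewrite [X in _ && X]ltNge (le_trans (node_le m ji) it) andbF.
by rewrite leNgt (lt_le_trans ti (node_le m ij)).
Qed.

Lemma sum_cell_chi m t : 0 <= t < 1 -> \sum_(i < 2 ^ m) cell_chi m i t = 1.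
Proof.
move=> /andP[t0 t1].
rewrite -(big_mkord xpredT (fun i => cell_chi m i t)).
rewrite (eq_bigr (fun i => primk (node m i.+1) t - primk (node m i) t)); last first.
  by move=> i _; rewrite primk_chi// ltW// node_lt.
rewrite telescope_sumr// node_last node0 /primk t1.
by rewrite ltNge t0 subr0.
Qed.

Lemma cell_cover m t : 0 <= t < 1 ->
  exists2 i, (i < 2 ^ m)%N & node m i <= t < node m i.+1.
Proof.
move=> t01; apply: contrapT => nE; have := sum_cell_chi m t01.
rewrite big1 => [/esym/eqP|i _]; first by rewrite oner_eq0.
rewrite /cell_chi /chi; case: (boolP (_ <= _ < _)) => // h.
by exfalso; apply: nE; exists i.
Qed.

Lemma Rintegral_cells m f : intg f ->
  \int[u01]_y f y = \sum_(i < 2 ^ m) cint (node m i) (node m i.+1) f.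
Proof.
move=> intf; rewrite -(big_mkord xpredT (fun i => cint (node m i) (node m i.+1) f)).
transitivity (cint 0 1 f).
  rewrite /cint /Rintegral; congr fine; apply: ae_eq_integralW => //.
  apply/ae_u01; apply: aeW => y /=; rewrite in_itv/= => /andP[y0 y1] _.
  by rewrite /chi (ltW y0) y1 mul1r.
have H n : (n <= 2 ^ m)%N -> cint (node m 0) (node m n) f =
    \sum_(0 <= i < n) cint (node m i) (node m i.+1) f.
  elim: n => [|n IH] nm.
    rewrite big_nil /cint /Rintegral integral0_eq// => y _.
    by rewrite /chi leNgt andNb mul0r.
  rewrite big_nat_recr//= -IH ?(ltnW nm)// /cint -RintegralD//; [|exact: intg_chi..].
  apply: eq_Rintegral => y _; rewrite -mulrDl; congr (_ * _).
  rewrite -(primk_chi _ (node_le m (leq0n n))) -(primk_chi _ (node_le m (leqnSn n))).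
  rewrite -(primk_chi _ (node_le m (leq0n n.+1))).
  by ring.
by have := H _ (leqnn _); rewrite node0 node_last.
Qed.

(* The kernel of the L^2 projection onto Q_m^k. *)
Definition projk k m t y : R := \sum_(i < 2 ^ m)
  \sum_(e <- cell_basis k.+1 (node m i) (node m i.+1))
    (cell_chi m i t * e.[t]) * (cell_chi m i y * e.[y]).

Let bounded_chi_horner m i p : (i < 2 ^ m)%N ->
  exists M, forall t, `|cell_chi m i t * p.[t]| <= M.
Proof.
move=> im; pose M := \sum_(j < size p) `|p`_j|; exists M => t.
rewrite /cell_chi /chi; case: (boolP (_ <= _ < _)) => [/andP[it ti]|_]; last first.
  by rewrite mul0r normr0 sumr_ge0.
have t0 : 0 <= t by apply: le_trans (node_ge0 m i) it.
have t1 : t <= 1 by apply: le_trans (ltW ti) _; exact: node_le1.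
rewrite mul1r horner_coef.
apply: le_trans (ler_norm_sum _ _ _) _; apply: ler_sum => j _.
rewrite normrM normrX ler_piMr//.
by rewrite exprn_ile1// ger0_norm.
Qed.

Let bounded_kernel0 : bounded_kernel (fun _ _ : R => 0).
Proof. by split => //; exists 0 => *; rewrite normr0. Qed.

Let bounded_kernelD (k1 k2 : R -> R -> R) : bounded_kernel k1 -> bounded_kernel k2 ->
  bounded_kernel (fun t y => k1 t y + k2 t y).
Proof.
move=> [m1 [M1 b1]] [m2 [M2 b2]]; split; first exact: measurable_funD.
by exists (M1 + M2) => t y; rewrite (le_trans (ler_normD _ _))// lerD.
Qed.

Let bounded_kernel_sum I (s : seq I) (P : I -> R -> R -> R) :
  (forall i0 : I, bounded_kernel (P i0)) ->
  bounded_kernel (fun t y => \sum_(i0 <- s) P i0 t y).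
Proof.
move=> bP; elim: s => [|i0 s IH].
  rewrite (_ : (fun _ => _) = (fun _ _ => 0)); first exact: bounded_kernel0.
  by apply/funext => t; apply/funext => y; rewrite big_nil.
rewrite (_ : (fun _ => _) = (fun t y => P i0 t y + \sum_(j <- s) P j t y)).
  exact: bounded_kernelD.
by apply/funext => t; apply/funext => y; rewrite big_cons.
Qed.

Lemma bounded_projk k m : bounded_kernel (projk k m).
Proof.
apply: (@bounded_kernel_sum _ _ (fun (i : 'I_(2 ^ m)) t y =>
  \sum_(e <- cell_basis k.+1 (node m i) (node m i.+1))
    (cell_chi m i t * e.[t]) * (cell_chi m i y * e.[y]))) => i.
apply: (@bounded_kernel_sum _ _ (fun (e : {poly R}) t y =>
    (cell_chi m i t * e.[t]) * (cell_chi m i y * e.[y]))) => e.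
have [M bM] := bounded_chi_horner e (ltn_ord i).
have mc : measurable_fun setT (fun t : Rm => cell_chi m i t * e.[t]).
  by apply: measurable_funM; [exact: measurable_chi|exact: measurable_horner].
split.
  apply: measurable_funM.
    exact: (measurableT_comp mc measurable_fst).
  exact: (measurableT_comp mc measurable_snd).
exists (M * M) => t y; rewrite normrM.
by apply: ler_pM.
Qed.

Lemma kop1_projk k m i q t : sqint u01 q -> (i < 2 ^ m)%N ->
  node m i <= t < node m i.+1 ->
  kop1 (projk k m) q t = (cell_proj k.+1 (node m i) (node m i.+1) q).[t].
Proof.
move=> sq im it; pose i' := Ordinal im.
have iq p : intg (fun y => p.[y] * q y).
  by apply: sqintM => //; exact: sqint_horner.
transitivity (cint (node m i) (node m i.+1) (fun y =>
    \sum_(e <- cell_basis k.+1 (node m i) (node m i.+1)) e.[t] * (e.[y] * q y))).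
  apply: eq_Rintegral => y _; rewrite /projk (bigD1 i')//= [X in _ + X]big1; last first.
    move=> j ji; apply: big1 => e _.
    rewrite (cell_chiE j it); suff -> : (j == i :> nat) = false by rewrite !mul0r.
    by apply: contra_neqF ji => /eqP ji; apply: val_inj.
  rewrite addr0 mulr_sumr mulr_suml; apply: eq_bigr => e _.
  by rewrite (cell_chiE i it) eqxx mul1r; rewrite /cell_chi; ring.
rewrite cint_sum; last first.
  by move=> e; exact: (integrableZl measurableT (e.[t]) (iq e)).
rewrite horner_sum; apply: eq_bigr => e _.
by rewrite cintZ// hornerZ mulrC.
Qed.

Lemma proj_orth_cell k m i q w : sqint u01 q -> (i < 2 ^ m)%N -> (size w <= k.+1)%N ->
  cint (node m i) (node m i.+1) (fun y => (q y - kop1 (projk k m) q y) * w.[y]) = 0.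
Proof.
move=> sq im sw; rewrite -[RHS](@cell_proj_orth _ k.+1 (node m i) (node m i.+1) _ _ _ q w)//.
- by apply: eq_cint => y iy; rewrite (kop1_projk k sq im iy).
- exact: node_ge0.
- exact: node_lt.
- exact: node_le1.
Qed.

Lemma proj_cell_est k m i v : derivs k.+1 v -> (i < 2 ^ m)%N ->
  cint (node m i) (node m i.+1) (fun y => (v 0 y - kop1 (projk k m) (v 0) y) ^+ 2) <=
  ((2 ^- m) ^+ k.+1) ^+ 2 * cint (node m i) (node m i.+1) (fun y => v k.+1 y ^+ 2).
Proof.
move=> dv im.
have n0 := node_ge0 m i; have nl := node_lt m i.
have n1 : (node m i.+1 : R) <= 1 by exact: node_le1.
have s0 : sqint u01 (v 0) by apply dv.1.
have [p sp] := taylor_cell n0 nl n1 dv; rewrite nodeB; apply: le_trans.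
apply: le_trans (cell_proj_best n0 nl n1 s0 sp).
rewrite le_eqVlt; apply/orP; left; apply/eqP; apply: eq_cint => y iy.
by rewrite (kop1_projk k s0 im iy).
Qed.

Lemma proj_est k m v : derivs k.+1 v ->
  \int[u01]_y ((v 0 y - kop1 (projk k m) (v 0) y) ^+ 2) <=
  ((2 ^- m) ^+ k.+1) ^+ 2 * \int[u01]_y (v k.+1 y ^+ 2).
Proof.
move=> dv; have s0 : sqint u01 (v 0) by apply dv.1.
rewrite (@Rintegral_cells m); last first.
  by apply/sqint_sqr/sqintB => //; apply: sqint_kop1 => //; exact: bounded_projk.
rewrite (@Rintegral_cells m (fun y => v k.+1 y ^+ 2)); last by apply: sqint_sqr; apply dv.1.
rewrite mulr_sumr; apply: ler_sum => i _; exact: proj_cell_est.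
Qed.

(** The projection preserves the mean on each cell, so the primitive of its error takes the same
    value at consecutive nodes. *)
Lemma prim_proj_node k m i g : sqint u01 g -> (i <= 2 ^ m)%N ->
  J (fun y => g y - kop1 (projk k m) g y) (node m i) = 0.
Proof.
move=> sg; have se : sqint u01 (fun y => g y - kop1 (projk k m) g y).
  by apply: sqintB => //; apply: sqint_kop1 => //; exact: bounded_projk.
elim: i => [|i IH] im.
  rewrite node0 /kop1 /Rintegral.
  rewrite (@ae_eq_integralW _ _ _ _ _ _ (cst 0%E))//; first by rewrite integral0.
  apply/ae_u01; apply: aeW => y /=; rewrite in_itv/= => /andP[y0 _] _.
  by rewrite /primk ltNge (ltW y0) mul0r.
have := kop1_primkB (ltW (node_lt m i)) se.
rewrite IH ?(ltnW im)// subr0 => ->.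
rewrite -[RHS](proj_orth_cell (k := k) (w := 1) sg im); last by rewrite size_poly1.
by apply: eq_cint => y _; rewrite hornerC mulr1.
Qed.

(** On each cell the primitive starts from zero, so [prim_cell] yields one factor $2^{-m}$ and the
    projection estimate for the derivative the other $k+1$. *)
Lemma prim_proj_est k m v : derivs k.+2 v ->
  \int[u01]_y (J (fun y => v 1 y - kop1 (projk k m) (v 1) y) y ^+ 2) <=
  ((2 ^- m) ^+ k.+2) ^+ 2 * \int[u01]_y (v k.+2 y ^+ 2).
Proof.
move=> dv; have s1 : sqint u01 (v 1) by apply dv.1.
have se : sqint u01 (fun y => v 1 y - kop1 (projk k m) (v 1) y).
  by apply: sqintB => //; apply: sqint_kop1 => //; exact: bounded_projk.
rewrite (@Rintegral_cells m); last first.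
  by apply/sqint_sqr/sqint_kop1 => //; exact: bounded_primk.
rewrite (@Rintegral_cells m (fun y => v k.+2 y ^+ 2)); last by apply: sqint_sqr; apply dv.1.
rewrite mulr_sumr; apply: ler_sum => i _.
have n1 : (node m i.+1 : R) <= 1 by exact: node_le1.
have := prim_cell (node_ge0 m i) (ltW (node_lt m i)) n1 se.
rewrite (prim_proj_node k s1 (ltnW (ltn_ord i))) nodeB.
have -> : cint (node m i) (node m i.+1) (fun t =>
   (J (fun y => v 1 y - kop1 (projk k m) (v 1) y) t - 0) ^+ 2) =
  cint (node m i) (node m i.+1) (fun t =>
   (J (fun y => v 1 y - kop1 (projk k m) (v 1) y) t) ^+ 2).
  by apply: eq_cint => y _; rewrite subr0.
move/le_trans; apply.
have -> : ((2 ^- m : R) ^+ k.+2) ^+ 2 = (2 ^- m) ^+ 2 * ((2 ^- m) ^+ k.+1) ^+ 2.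
  by rewrite [_ ^+ k.+2]exprS exprMn.
rewrite -[leRHS]mulrA.
apply: ler_wpM2l; first exact: sqr_ge0.
exact: (proj_cell_est (derivsS dv)).
Qed.

End one_dimensional_estimates.

(** * The one-dimensional interpolants as kernel operators *)

Section spline_projections.
Context {R : realType}.
Local Notation u01 := (@u01 R).
Local Notation leb := (@lebesgue_measure R).
Local Notation intg f := (u01.-integrable setT (EFin \o f)).
Implicit Types (a b t y : R) (f g q : R -> R) (p w : {poly R}) (m k i : nat).

Lemma Rintegral_u01 f : \int[u01]_x f x = \int[leb]_(x in `]0, 1[) f x.
Proof. by rewrite /Rintegral integral_u01. Qed.

Lemma eq_ae_Rintegral f g : {ae u01, forall y, f y = g y} ->
  \int[u01]_y f y = \int[u01]_y g y.
Proof.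
move=> fg; rewrite /Rintegral; congr fine; apply: ae_eq_integralW => //.
by apply: filterS fg => y -> _.
Qed.

Lemma ae_u01_countable (A : set R) : countable A -> {ae u01, forall y, ~ A y}.
Proof.
move=> cA; apply/ae_u01; exists A; split.
- exact: countable_measurable.
- exact: countable_lebesgue_measure0.
- by move=> y /= H; apply: contrapT => H'; apply: H => _.
Qed.

Lemma ae_u01_in : {ae u01, forall y, 0 < y < 1}.
Proof. by apply/ae_u01; apply: aeW => y /=; rewrite in_itv. Qed.

Lemma ae_open_cell m : {ae u01, forall y,
  exists2 i, (i < 2 ^ m)%N & node m i < y < node m i.+1}.
Proof.
have cn : countable (range (@node R m)) by apply: card_image_le.
apply: filterS2 ae_u01_in (ae_u01_countable cn) => y /andP[y0 y1] ny.
have [|i im /andP[iy yi]] := @cell_cover _ m y; first by rewrite (ltW y0).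
exists i => //; rewrite yi andbT lt_neqAle iy andbT.
by apply/eqP => E; apply: ny; exists i.
Qed.

(** The kernel operator is an admissible choice. On the given cell another choice differs from it by
    a polynomial, which extended by zero is itself an admissible test. Only open cells are covered
    because the values at the nodes are free. *)
Lemma Pi1E k m q q' i t : sqint u01 q' -> {ae u01, forall y, q y = q' y} ->
  (i < 2 ^ m)%N -> node m i < t < node m i.+1 ->
  Pi1 k m q t = kop1 (projk k m) q' t.
Proof.
move=> sq' qq' im it.
pose p0 := kop1 (projk k m) q'.
have sp0 : sqint u01 p0 by apply: sqint_kop1 => //; exact: bounded_projk.
set S := [set p : R -> R | [/\ L2 leb `]0, 1[ q, splineQ k m p &
    forall w : R -> R, splineQ k m w ->
      \int[leb]_(x in `]0, 1[) ((p x - q x) * w x) = 0]].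
have Sp0 : S p0.
  split.
  - exact: (sqint_L2 sq' qq').
  - move=> j jm; exists (cell_proj k.+1 (node m j) (node m j.+1) q').
      by apply: size_cell_proj; [exact: node_ge0|exact: node_lt|exact: node_le1].
    move=> x; rewrite in_itv/= => /andP[jx xj].
    by rewrite /p0 (kop1_projk k sq' jm)// (ltW jx).
  - move=> w sw; rewrite -Rintegral_u01.
    (* A test spline is arbitrary at the nodes and outside the interval. Gluing its polynomials with
       [cell_chi] gives a Borel function equal to it almost everywhere in $(0,1)$. *)
    have /choice[W WP] : forall j, exists w' : {poly R}, (j < 2 ^ m)%N ->
        (size w' <= k.+1)%N /\ {in `]node m j, node m j.+1[, forall x, w x = w'.[x]}.
      move=> j; have [/sw[w' ? ?]|] := ltnP j (2 ^ m); first by exists w'.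
      by exists 0.
    pose w' y := \sum_(j < 2 ^ m) cell_chi m j y * (W j).[y].
    have sw' : sqint u01 w'.
      by apply: sqint_sum => j _; apply: sqint_chi; exact: sqint_horner.
    have w'E j y : (j < 2 ^ m)%N -> node m j <= y < node m j.+1 -> w' y = (W j).[y].
      move=> jm jy; rewrite /w' (bigD1 (Ordinal jm))//= (cell_chiE j jy) eqxx mul1r.
      rewrite big1 ?addr0// => i' ij; rewrite (cell_chiE i' jy).
      suff -> : (i' == j :> nat) = false by rewrite mul0r.
      by apply: contra_neqF ij => /eqP ij; apply: val_inj.
    transitivity (\int[u01]_y ((p0 y - q' y) * w' y)).
      apply: eq_ae_Rintegral; apply: filterS2 qq' (ae_open_cell m) => y ->.
      move=> [j jm /andP[jy yj]]; rewrite (w'E j)// ?(ltW jy)//.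
      by rewrite (WP j jm).2// in_itv/= jy.
    rewrite (@Rintegral_cells _ m); last by apply: sqintM => //; exact: sqintB.
    apply: big1 => j _; have jm := ltn_ord j.
    rewrite -[RHS]oppr0 -(proj_orth_cell (m := m) sq' jm (WP j jm).1).
    rewrite -[RHS]mulN1r -cintZ; last first.
      apply: sqintM; last exact: sqint_horner.
      exact: sqintB.
    apply: eq_cint => y jy; rewrite (w'E j)//.
    by rewrite mulN1r -mulNr opprB.
have : S (Pi1 k m q) by rewrite /Pi1; apply: xgetPex; exists p0.
move: (Pi1 k m q) => p [_ sp po].
have [W sW pW] := sp i im.
set a : R := node m i in it pW; set b : R := node m i.+1 in it pW.
have a0 : 0 <= a by exact: node_ge0.
have ab : a < b by exact: node_lt.
have b1 : b <= 1 by exact: node_le1.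
pose P := cell_proj k.+1 a b q'.
pose D := W - P.
have sP : (size P <= k.+1)%N by exact: size_cell_proj.
have sD : (size D <= k.+1)%N.
  by rewrite (leq_trans (size_polyD _ _))// size_polyN geq_max sW sP.
pose w x : R := if a < x < b then D.[x] else 0.
have spw : splineQ k m w.
  move=> j jm; have [->|ji] := eqVneq j i.
    by exists D => // x; rewrite in_itv/= => h; rewrite /w h.
  exists 0; first by rewrite size_poly0.
  move=> x; rewrite in_itv/= => /andP[jx xj]; rewrite /w horner0.
  have jx' : node m j <= x < node m j.+1 by rewrite (ltW jx).
  case: ifPn => // /andP[ax xb]; exfalso.
  have := cell_chiE i jx'; rewrite /cell_chi /chi (ltW ax) xb eq_sym (negbTE ji).
  by move/eqP; rewrite oner_eq0.
have := po w spw; rewrite -Rintegral_u01.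
have nea : {ae u01, forall y, ~ [set a] y} by apply: ae_u01_countable; exact: countable1.
rewrite (_ : \int[u01]_x _ = cint a b (fun y => (W.[y] - q' y) * D.[y])); last first.
  apply: eq_ae_Rintegral; apply: filterS2 qq' nea => y -> /eqP ya.
  rewrite /w /chi; case: (ltP a y) => ay /=; last first.
    by rewrite mulr0 leNgt lt_neqAle ay ya/= mul0r.
  rewrite (ltW ay)/=; case: ltP => yb; last by rewrite mulr0 mul0r.
  by rewrite mul1r pW// in_itv/= ay.
have iD : intg (fun y => (q' y - P.[y]) * D.[y]).
  apply: sqintM; last exact: sqint_horner.
  by apply: sqintB => //; exact: sqint_horner.
have i1 : intg (fun y => (W.[y] - q' y) * D.[y]).
  apply: sqintM; last exact: sqint_horner.
  by apply: sqintB => //; exact: sqint_horner.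
move=> E1; have E2 := cell_proj_orth a0 ab b1 sq' sD.
(* The two orthogonality relations, tested with [D], add up to $\int_a^b(W-P)^2=0$. *)
have : ip a b D D = 0.
  rewrite -[RHS]addr0 -{1}E1 -E2 -cintD//.
  by apply: eq_cint => y _; rewrite -mulrDl hornerD hornerN addrA subrK.
move/(ip_eq0 a0 ab b1)/eqP; rewrite subr_eq0 => /eqP WP.
have /andP[at_ tb] := it.
rewrite pW ?in_itv/= ?at_// WP (kop1_projk k sq' im)//.
by rewrite (ltW at_).
Qed.

End spline_projections.

(** * Primitives: continuity, integration by parts, moments *)

Section primitives.
Context {R : realType}.
Local Notation u01 := (@u01 R).
Local Notation leb := (@lebesgue_measure R).
Local Notation Rm := (measurableTypeR R).
Local Notation intg f := (u01.-integrable setT (EFin \o f)).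
Local Notation J := (kop1 (@primk R)).
Implicit Types (a b t y : R) (f g v : R -> R) (w : {poly R}) (m k i : nat).

Lemma kop1_primk0 g : J g 0 = 0.
Proof.
rewrite -[RHS](Rintegral_u01_cst (0 : R)); apply: eq_ae_Rintegral.
apply: filterS ae_u01_in => y /andP[y0 _].
by rewrite /primk ltNge (ltW y0) mul0r.
Qed.

Lemma kop1_primkE g y : 0 <= y -> sqint u01 g -> J g y = cint 0 y g.
Proof. by move=> y0 sg; rewrite /cint -kop1_primkB// kop1_primk0 subr0. Qed.

Lemma continuous_prim g : sqint u01 g -> {within `[0, 1], continuous (J g)}.
Proof.
move=> sg; have [mg _] := sg.
pose g0 := g \_ `]0, 1[.
have mg0 : measurable_fun setT (g0 : Rm -> R).
  by apply/(measurable_restrictT _ (measurable_itv _)); exact: measurable_funTS.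
have gE : {ae u01, forall y, g y = g0 y}.
  by apply: filterS ae_u01_in => y y01; rewrite /g0 patchE mem_set//= in_itv.
have sg0 : sqint u01 g0.
  by apply: sqint_ae mg0 _ sg; apply: filterS gE => y ->.
have ig0 : leb.-integrable `[0, 1] (EFin \o g0).
  apply: (integrableS measurableT) => //.
  have /integrableP[_ g0o] := sqint_integrable sg0.
  apply/integrableP; split; first exact/measurable_EFinP.
  apply: le_lt_trans g0o; rewrite integral_u01 [leRHS]integral_mkcond.
  rewrite le_eqVlt; apply/orP; left; apply/eqP; apply: eq_integral => y _ /=.
  by rewrite /g0 !patchE; case: ifPn => //=; rewrite normr0.
have := parameterized_integral_continuous ler01 ig0.
apply: subspace_eq_continuous => y; rewrite inE/= in_itv/= => /andP[y0 y1].
have E : J g y = \int[leb]_(t in `[0, y]) g0 t.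
  by rewrite (eq_kop1 primk y gE) kop1_primkE// /cint Rintegral_chi_cc.
exact: esym E.
Qed.

(** The adjoint of [J] integrates from $y$ to $1$; strict and weak inequality differ only at
    $t=y$. *)
Lemma Rintegral_primk_swap h y : intg h ->
  \int[u01]_t (primk t y * h t) = \int[u01]_t h t - J h y.
Proof.
move=> ih; have ij : intg (fun t => primk y t * h t).
  apply: (integrable_leM (c := 1) _ _ ih).
    apply: measurable_funM; first exact: (measurable_kernel1 y bounded_primk).
    by case/integrableP : ih => /measurable_EFinP.
  by move=> t; rewrite normrM ler_wpM2r// /primk; case: (_ < _); rewrite ?normr1 ?normr0.
rewrite -RintegralB//; apply: eq_ae_Rintegral.
have ny : {ae u01, forall t, ~ [set y] t} by apply: ae_u01_countable; exact: countable1.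
apply: filterS ny => t /eqP ty.
rewrite /primk; case: ltgtP ty => //= _ _; by rewrite ?mul1r ?mul0r ?subr0 ?subrr.
Qed.

Lemma Rintegral_chi_FTC (F : R -> R) a b : (forall x, derivable F x 1) ->
  continuous (derive1 F) -> 0 <= a -> a <= b -> b <= 1 ->
  \int[u01]_y (chi a b y * derive1 F y) = F b - F a.
Proof.
move=> dF cF a0; rewrite le_eqVlt => /predU1P[->|ab] b1.
  rewrite subrr /Rintegral integral0_eq// => y _.
  by rewrite /chi leNgt andNb mul0r.
have cFx x : {for x, continuous F}.
  by apply: differentiable_continuous; exact/derivable1_diffP.
rewrite Rintegral_chi_cc// /Rintegral.
have dLR : derivable_oo_LRcontinuous F a b.
  split; first by move=> y _.
    by apply: cvg_at_right_filter; exact: cFx.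
  by apply: cvg_at_left_filter; exact: cFx.
have cFW : {within `[a, b], continuous (derive1 F)} by exact: continuous_subspaceT.
have F'F : {in `]a, b[, F^`()%classic =1 derive1 F} by [].
by rewrite (continuous_FTC2 ab cFW dLR F'F).
Qed.

Lemma bounded_chi_cont f : continuous f ->
  exists M, forall t, `|chi 0 1 t * f t| <= M.
Proof.
move=> cf.
have cn : {within `[0 : R, 1], continuous (fun t => `|f t|)}.
  apply: continuous_subspaceT => t; apply: continuous_comp; first exact: cf.
  exact: norm_continuous.
have [c _ cM] := EVT_max ler01 cn.
exists `|f c| => t; rewrite /chi; case: (boolP (0 <= t < 1)) => [/andP[t0 t1]|_].
  by rewrite mul1r; apply: cM; rewrite in_itv/= t0 ltW.
by rewrite mul0r normr0.
Qed.

(** Integration by parts through the adjoint of [J]. It provides the membership in [H1] that the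
    definition of [Pi0] demands. *)
Lemma weak_derive1_prim v g c : sqint u01 g ->
  {ae u01, forall t, v t = c + J g t} -> weak_derive1 v g.
Proof.
move=> sg vE phi [dphi [K [cK K01] phi0]].
have phi_out x : ~ (0 < x < 1) -> phi x = 0.
  by move=> nx; apply: phi0 => /K01 /=; rewrite in_itv.
have p0 : phi 0 = 0 by apply: phi_out; rewrite ltxx.
have p1 : phi 1 = 0 by apply: phi_out; rewrite ltxx andbF.
have d0 x : derivable phi x 1 := dphi 0%N x.
have cd : continuous (derive1 phi).
  move=> x; apply: differentiable_continuous; apply/derivable1_diffP.
  exact: (dphi 1%N x).
have md : measurable_fun setT (derive1 phi : Rm -> R) by exact: continuous_measurable_fun.
have [M hM] := bounded_chi_cont cd.
(* The cut-off gives a function bounded on the whole line, as the adjoint formula requires. *)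
pose h t := chi 0 1 t * derive1 phi t.
have mh : measurable_fun setT (h : Rm -> R).
  by apply: measurable_funM => //; exact: measurable_chi.
have sh : sqint u01 h by exact: (sqint_bounded _ mh hM).
have ih := sqint_integrable sh.
have hd : {ae u01, forall t, derive1 phi t = h t}.
  apply: filterS ae_u01_in => t /andP[t0 t1].
  by rewrite /h /chi (ltW t0) t1 mul1r.
rewrite -!Rintegral_u01.
transitivity (\int[u01]_t (c * h t + J g t * h t)).
  apply: eq_ae_Rintegral; apply: filterS2 vE hd => t -> ->.
  by rewrite mulrDl.
have sJ := sqint_kop1 bounded_primk sg.
rewrite RintegralD//; last 2 first.
- exact: (integrableZl measurableT c ih).
- exact: sqintM.
have h0 : \int[u01]_t h t = 0.
  by rewrite Rintegral_chi_FTC// p0 p1 subrr.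
rewrite RintegralZl// h0 mulr0 add0r (kop1_adjoint bounded_primk sg mh hM).
rewrite -[RHS]mulN1r -RintegralZl//; last first.
  have cphi : continuous phi.
    by move=> x; apply: differentiable_continuous; exact/derivable1_diffP.
  have [M' phiM] := bounded_chi_cont cphi.
  have mphi : measurable_fun setT (fun t : Rm => chi 0 1 t * phi t).
    apply: measurable_funM; first exact: measurable_chi.
    exact: continuous_measurable_fun.
  have := sqintM sg (sqint_bounded u01 mphi phiM).
  congr (integrable _ _ _); apply/funext => t /=; congr (_ * _)%:E.
  have [t01|/negP nt] := boolP (0 < t < 1).
    by case/andP : t01 => t0 t1; rewrite /chi (ltW t0) t1 mul1r.
  by rewrite phi_out// mulr0.
apply: eq_ae_Rintegral; apply: filterS ae_u01_in => y /andP[y0 y1].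
rewrite Rintegral_primk_swap// h0 sub0r kop1_primkE ?(ltW y0)//.
have -> : cint 0 y h = \int[u01]_t (chi 0 y t * derive1 phi t).
  apply: eq_cint => t /andP[t0 ty].
  by rewrite /h /chi t0 (lt_trans ty y1) mul1r.
by rewrite Rintegral_chi_FTC ?(ltW y0) ?(ltW y1)// p0 subr0 mulrN mulN1r.
Qed.

(** The adjoint of [J] turns [w], restricted to cell [i], into a function that is a polynomial of
    degree at most [k] on every cell, and the projection error is orthogonal to those. *)
Lemma prim_moment k m i g w : sqint u01 g -> (i < 2 ^ m)%N -> (size w <= k)%N ->
  cint (node m i) (node m i.+1)
    (fun t => J (fun y => g y - kop1 (projk k m) g y) t * w.[t]) = 0.
Proof.
move=> sg im sw; pose e y := g y - kop1 (projk k m) g y; rewrite -/e.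
have se : sqint u01 e.
  by apply: sqintB => //; apply: sqint_kop1 => //; exact: bounded_projk.
have [W dW sW] := antiderivative_poly w.
set a : R := node m i; set b : R := node m i.+1.
have a0 : 0 <= a by exact: node_ge0.
have ab : a < b by exact: node_lt.
have b1 : b <= 1 by exact: node_le1.
pose h t := chi a b t * w.[t].
have sh : sqint u01 h by apply: sqint_chi; exact: sqint_horner.
have ih := sqint_integrable sh.
have [mh _] := sh.
have [M hM] : exists M, forall t, `|h t| <= M.
  have cw : continuous (fun t => w.[t]) by move=> t; exact: continuous_horner.
  have [M wM] := bounded_chi_cont cw; exists M => t.
  apply: le_trans (wM t); rewrite /h /chi !normrM ler_wpM2r//.
  case: (boolP (a <= t < b)) => [/andP[at_ tb]|_]; last by rewrite normr0.
  by rewrite (le_trans a0 at_) (lt_le_trans tb b1).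
have hint : \int[u01]_t h t = W.[b] - W.[a].
  by rewrite /h -dW Rintegral_chi_deriv// ltW.
have JhE y : 0 <= y -> y <= 1 ->
    J h y = if y <= a then 0 else W.[Num.min b y] - W.[a].
  move=> y0 y1; rewrite kop1_primkE// /cint.
  case: leP => ya.
    rewrite -[RHS](Rintegral_u01_cst (0 : R)); apply: eq_Rintegral => t _.
    rewrite /h mulrA /chi; case: (ltP t y) => ty; last by rewrite andbF !mul0r.
    by rewrite [a <= t]leNgt (lt_le_trans ty ya) mulr0 mul0r.
  rewrite -Rintegral_chi_deriv//; last 2 first.
  - by rewrite le_min (ltW ab) (ltW ya).
  - by rewrite ge_min b1.
  apply: eq_Rintegral => t _; rewrite /h mulrA dW; congr (_ * _).
  rewrite /chi lt_min; case: (leP a t) => at_; last by rewrite mulr0.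
  by rewrite (le_trans a0 at_)/=; do 2 case: (_ < _); rewrite ?mul1r ?mul0r.
transitivity (\int[u01]_t (J e t * h t)).
  by apply: eq_Rintegral => t _; rewrite /h mulrCA.
rewrite (kop1_adjoint bounded_primk se mh hM).
have inner y : \int[u01]_t (primk t y * h t) = \int[u01]_t h t - J h y.
  exact: Rintegral_primk_swap.
under eq_Rintegral do rewrite inner.
rewrite (@Rintegral_cells _ m); last first.
  exact: (sqintM se (sqintB (sqint_cst u01 _) (sqint_kop1 bounded_primk sh))).
apply: big1 => j _; have jm := ltn_ord j.
(* $\int_y^1 h$ is the constant $W(b)-W(a)$ before cell [i], equals $W(b)-W(y)$ inside it and is
   zero after it. *)
have [P sP PE] : exists2 P : {poly R}, (size P <= k.+1)%N &
    forall y, node m j <= y < node m j.+1 -> \int[u01]_t h t - J h y = P.[y].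
  have jb (y : R) : node m j <= y < node m j.+1 -> 0 <= y /\ y <= 1.
    move=> /andP[jy yj]; split; first exact: le_trans (node_ge0 m j) jy.
    by apply: le_trans (ltW yj) _; exact: node_le1.
  have [ji|ij|ji] := ltngtP j i.
  - exists (W.[b] - W.[a])%:P.
      exact: leq_trans (size_polyC_leq1 _) _.
    move=> y jy; have [y0 y1] := jb y jy; rewrite JhE// hint hornerC.
    case/andP : jy => _ yj; rewrite (le_trans (ltW yj)) ?subr0//.
    exact: node_le.
  - exists 0; first by rewrite size_poly0.
    move=> y jy; have [y0 y1] := jb y jy; rewrite JhE// hint horner0.
    case/andP : jy => jy _.
    have by_ : b <= y by apply: le_trans jy; exact: node_le.
    by rewrite leNgt (lt_le_trans ab by_)/= (min_idPl by_) subrr.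
  - exists (W.[b]%:P - W).
      rewrite (leq_trans (size_polyD _ _))// size_polyN geq_max.
      rewrite (leq_trans (size_polyC_leq1 _))//.
      exact: leq_trans sW _.
    move=> y; rewrite ji => jy; have [] := jb y; first by rewrite ji.
    move=> y0 y1; rewrite JhE// hint hornerD hornerN hornerC.
    case/andP : jy; rewrite -/a -/b => ay yb.
    rewrite (min_idPr (ltW yb)); case: ifPn => [ya|_]; last by ring.
    have -> : y = a by apply/eqP; rewrite eq_le ya ay.
    by rewrite subr0.
rewrite -[RHS](proj_orth_cell (k := k) (w := P) sg jm sP).
by apply: eq_cint => y jy; rewrite PE.
Qed.

End primitives.

(** * Identification of the continuous interpolant *)

Section continuous_interpolation.
Context {R : realType}.
Local Notation u01 := (@u01 R).
Local Notation leb := (@lebesgue_measure R).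
Local Notation intg f := (u01.-integrable setT (EFin \o f)).
Local Notation J := (kop1 (@primk R)).
Implicit Types (a b t y : R) (f g q v : R -> R) (p w : {poly R}) (m k i : nat).

(** Around a point of disagreement the functions would differ on an interval of positive length.
    This makes the continuous representative in the definition of [Pi0] unique. *)
Lemma continuous_ae_eq f g : {within `[0, 1], continuous f} ->
  {within `[0, 1], continuous g} -> {ae u01, forall y, f y = g y} ->
  forall t, 0 <= t <= 1 -> f t = g t.
Proof.
move=> cf cg fg t t01; apply: contrapT => /eqP; rewrite -subr_eq0 => nfg.
have cD : {within `[0, 1], continuous (fun y => f y - g y)}.
  by move=> y; apply: cvgB; [exact: cf|exact: cg].
have tin : `[0, 1]%classic t by rewrite /= in_itv.
have := (subspace_continuousP _ _).1 cD t tin.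
move=> /cvgrPdist_lt /(_ `|f t - g t|).
rewrite normr_gt0 => /(_ nfg); rewrite near_withinE => -[e /= e0 He].
pose l := Num.max 0 (t - e / 2); pose r := Num.min 1 (t + e / 2).
have /andP[t0 t1] := t01.
have lr : l < r.
  rewrite /l /r gt_max !lt_min ltr01/=; apply/andP; split; first by lra.
  apply/andP; split; lra.
have l0 : 0 <= l by rewrite /l le_max lexx.
have r1 : r <= 1 by rewrite /r ge_min lexx.
have c0 : {ae u01, forall y, chi l r y = 0}.
  apply: filterS2 fg ae_u01_in => y fgy /andP[y0 y1].
  rewrite /chi; case: (boolP (l <= y < r)) => // /andP[ly yr]; exfalso; move: ly yr.
  rewrite /l /r ge_max lt_min => /andP[_ ly] /andP[_ yr].
  have : `|f t - g t - (f y - g y)| < `|f t - g t|.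
    apply: (He y); last by rewrite /= in_itv/= (ltW y0) ltW.
    by rewrite /ball/= ltr_norml; apply/andP; split; lra.
  by rewrite fgy subrr subr0 ltxx.
have := Rintegral_chi1 l0 (ltW lr) r1.
rewrite (eq_ae_Rintegral c0) Rintegral_u01_cst => /esym/eqP; rewrite subr_eq0 => /eqP rl.
by rewrite rl ltxx in lr.
Qed.

(** The right-hand side is $c+J(P_m g)$, a continuous spline of degree $k+1$; its nodal values and
    moments come from [prim_proj_node] and [prim_moment]. Uniqueness is shown cell by cell for the
    difference [D] of two interpolating polynomials. *)
Lemma Pi0E k m v g c t : sqint u01 g -> {ae u01, forall y, v y = c + J g y} ->
  0 <= t <= 1 ->
  Pi0 k m v t = c + J g t - J (fun y => g y - kop1 (projk k m) g y) t.
Proof.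
move=> sg vE t01.
pose e y := g y - kop1 (projk k m) g y.
have skg : sqint u01 (kop1 (projk k m) g) by apply: sqint_kop1 => //; exact: bounded_projk.
have se : sqint u01 e by exact: sqintB.
pose vc y := c + J g y.
pose p0 y := vc y - J e y.
have p0E y : p0 y = c + J (kop1 (projk k m) g) y.
  by rewrite /p0 /vc /e (kop1B _ bounded_primk sg skg); ring.
have sJg := sqint_kop1 bounded_primk sg.
have svc : sqint u01 vc by apply: sqintD => //; exact: sqint_cst.
have cvc : {within `[0, 1], continuous vc}.
  move=> y; apply: cvgD; first exact: cvg_cst.
  exact: (continuous_prim sg).
have cell_poly i : (i < 2 ^ m)%N -> exists2 w : {poly R}, (size w <= k.+2)%N &
    {in `[node m i, node m i.+1], forall x, p0 x = w.[x]}.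
  move=> im; set a : R := node m i; set b : R := node m i.+1.
  have a0 : 0 <= a by exact: node_ge0.
  have ab : a < b by exact: node_lt.
  have b1 : b <= 1 by exact: node_le1.
  have sP : (size (cell_proj k.+1 a b g) <= k.+1)%N by exact: size_cell_proj.
  have [W dW sW] := antiderivative_poly (cell_proj k.+1 a b g).
  exists (W + (p0 a - W.[a])%:P).
    rewrite (leq_trans (size_polyD _ _))// geq_max.
    rewrite (leq_trans (size_polyC_leq1 _))// andbT.
    exact: leq_trans sW _.
  move=> x; rewrite in_itv/= => /andP[ax xb].
  have -> : p0 x = p0 a + (J (kop1 (projk k m) g) x - J (kop1 (projk k m) g) a).
    by rewrite !p0E; ring.
  rewrite (kop1_primkB ax skg) hornerD hornerC.
  rewrite (_ : \int[u01]_y _ = \int[u01]_y (chi a x y * W^`().[y])); last first.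
    apply: eq_cint => y /andP[ay yx]; rewrite dW.
    by rewrite (kop1_projk k sg im)// -/a -/b ay (lt_le_trans yx xb).
  rewrite Rintegral_chi_deriv//; last exact: le_trans xb b1.
  by ring.
have p0_node i : (i <= 2 ^ m)%N -> p0 (node m i) = vc (node m i).
  by move=> im; rewrite /p0 /e prim_proj_node// subr0.
set S := [set p : R -> R | H1 v /\
    exists vc : R -> R, [/\ {within `[0 : R, 1], continuous vc},
      v = vc %[ae leb in `]0, 1[%classic], splineS k m p & interpolates k m vc p]].
have Sp0 : S p0.
  split.
    split; first exact: (sqint_L2 svc vE).
    exists g; last exact: weak_derive1_prim sg vE.
    by apply: (sqint_L2 sg); apply: aeW.
  exists vc; split => //.
  - by apply/ae_u01.
  - split => //.
    move=> y; apply: cvgB; first exact: cvc.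
    exact: (continuous_prim se).
  - move=> i im; split; [by rewrite p0_node// ltnW|by rewrite p0_node|].
    move=> w sw; rewrite -(@Rintegral_chi_cc _ _ _ (fun x => (p0 x - vc x) * w.[x])); last 2 first.
    + exact: node_ge0.
    + exact: node_le1.
    rewrite -[RHS]oppr0 -(prim_moment sg im sw) -[RHS]mulN1r -cintZ; last first.
      by apply: sqintM; [exact: sqint_kop1 bounded_primk se|exact: sqint_horner].
    by apply: eq_cint => y _; rewrite /p0 -/e; ring.
have : S (Pi0 k m v) by rewrite /Pi0; apply: xgetPex; exists p0.
move: (Pi0 k m v) => p [_ [vc' [cvc' vvc' [_ sp] pI]]].
have vcE y : 0 <= y <= 1 -> vc' y = vc y.
  apply: continuous_ae_eq => //.
  have vv' : {ae u01, forall y, v y = vc' y} by apply/ae_u01.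
  by apply: filterS2 vE vv' => z e1 e2; rewrite -e2.
have [i im it] : exists2 i, (i < 2 ^ m)%N & node m i <= t <= node m i.+1.
  have /andP[t0] := t01; rewrite le_eqVlt => /predU1P[->|t1]; last first.
    have [|i im /andP[it ti]] := @cell_cover _ m t; first by rewrite t0.
    by exists i => //; rewrite it ltW.
  (* The point 1 lies in no half-open cell and is assigned to the last one. *)
  exists (2 ^ m).-1; first by rewrite ltn_predL expn_gt0.
  by rewrite prednK ?expn_gt0// node_last lexx node_le1// leq_pred.
have [w sw pw] := sp i im; have [w0 sw0 pw0] := cell_poly i im.
have [pa pb pm] := pI i im.
have p0a := p0_node i (ltnW im); have p0b := p0_node i.+1 im.
set a : R := node m i in it pw pw0 pa pb pm p0a p0b.
set b : R := node m i.+1 in it pw pw0 pa pb pm p0a p0b.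
have a0 : 0 <= a by exact: node_ge0.
have ab : a < b by exact: node_lt.
have b1 : b <= 1 by exact: node_le1.
have ain : a \in `[a, b] by rewrite in_itv/= lexx ltW.
have bin : b \in `[a, b] by rewrite in_itv/= lexx ltW.
pose D := w - w0.
have Da : D.[a] = 0.
  rewrite hornerD hornerN -pw// -pw0// pa p0a vcE ?subrr//.
  by rewrite a0 (le_trans (ltW ab)).
have Db : D.[b] = 0.
  rewrite hornerD hornerN -pw// -pw0// pb p0b vcE ?subrr//.
  by rewrite b1 (le_trans a0 (ltW ab)).
have sD : (size D <= k.+2)%N.
  by rewrite (leq_trans (size_polyD _ _))// size_polyN geq_max sw sw0.
have Dorth (q : {poly R}) : (size q <= k)%N -> ip a b D q = 0.
  move=> sq; have := pm q sq; rewrite -Rintegral_chi_cc//.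
  have -> : \int[u01]_y (chi a b y * ((p y - vc' y) * q.[y])) =
      cint a b (fun y => w.[y] * q.[y] - vc y * q.[y]).
    apply: eq_cint => y /andP[ay yb]; rewrite pw ?in_itv/= ?ay ?ltW//.
    by rewrite vcE ?mulrBl// (le_trans a0 ay) (le_trans (ltW yb) b1).
  have ivc : intg (fun y => vc y * q.[y]) by apply: sqintM => //; exact: sqint_horner.
  rewrite cintB//; last exact: intg_hornerM.
  move=> E.
  have E0 : cint a b (fun y => w0.[y] * q.[y]) - cint a b (fun y => vc y * q.[y]) = 0.
    rewrite -cintB//; last exact: intg_hornerM.
    rewrite -[RHS]oppr0 -(prim_moment sg im sq) -[RHS]mulN1r -cintZ; last first.
      by apply: sqintM; [exact: sqint_kop1 bounded_primk se|exact: sqint_horner].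
    apply: eq_cint => y /andP[ay yb]; rewrite -pw0 ?in_itv/= ?ay ?ltW//.
    by rewrite /p0 -/e; ring.
  rewrite /D ipBl /ip.
  by move: E E0 => /eqP; rewrite subr_eq0 => /eqP ->; move=> /eqP; rewrite subr_eq0 => /eqP ->; rewrite subrr.
(* As [D] vanishes at both ends, $\int(D')^2=-\int DD''$, and $D''$ has degree at most $k-1$, to
   which [D] is orthogonal. *)
have dD0 : D^`() = 0.
  apply: (ip_eq0 a0 ab b1).
  have : \int[u01]_y (chi a b y * (D * D^`())^`().[y]) = 0.
    by rewrite Rintegral_chi_deriv ?(ltW ab)// !hornerM Da Db !mul0r subrr.
  rewrite derivM.
  have -> : \int[u01]_y (chi a b y * (D^`() * D^`() + D * D^`()^`()).[y]) =
      cint a b (fun y => D^`().[y] * D^`().[y] + D.[y] * D^`()^`().[y]).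
    by apply: eq_cint => y _; rewrite hornerD !hornerM.
  rewrite cintD; [|exact: intg_hornerM..].
  rewrite -/(ip a b _ _) -/(ip a b D _) Dorth ?addr0//.
  apply/leq_sizeP => j kj; rewrite !coef_deriv nth_default ?mul0rn//.
  by apply: leq_trans sD _; rewrite !ltnS.
have D0 : D = 0.
  have /size1_polyC DE : (size D <= 1)%N.
    apply/leq_sizeP => -[//|j] _; have := congr1 (fun q : {poly R} => q`_j) dD0.
    rewrite coef_deriv coef0 => /eqP; by rewrite mulrn_eq0 => /eqP.
  by move: Da; rewrite DE hornerC => ->.
move: it => /andP[at_ tb].
rewrite pw ?in_itv/= ?at_//.
have -> : w = w0 by apply/eqP; rewrite -subr_eq0 -/D D0.
by rewrite -pw0 ?in_itv/= ?at_.
Qed.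

End continuous_interpolation.

(** * Tensor test functions *)

Section density.
Local Open Scope ereal_scope.
Context {disp} {T : measurableType disp} {R : realType}.
Variables (mu : {measure set T -> \bar R}) (f : T -> \bar R).
Hypotheses (mf : measurable_fun setT f) (f0 : forall x, 0 <= f x).

Definition density_measure (A : set T) : \bar R := \int[mu]_(x in A) f x.

Let density0 : density_measure set0 = 0.
Proof. by rewrite /density_measure integral_set0. Qed.

Let density_ge0 A : 0 <= density_measure A.
Proof. by apply: integral_ge0. Qed.

Let density_sigma_additive : semi_sigma_additive density_measure.
Proof.
move=> F mF tF mUF; rewrite /density_measure ge0_integral_bigcup//; last first.
  exact: measurable_funTS.
by apply: is_cvg_nneseries => n _ _; exact: integral_ge0.
Qed.

HB.instance Definition _ := isMeasure.Build _ _ _ density_measure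
  density0 density_ge0 density_sigma_additive.

End density.

Section null_on_boxes.
Context {R : realType} {d : nat}.
Local Notation space := 'rV[R]_d.
Local Notation cube := (@cube R d).

(** The positive and negative parts of [h] are densities of two finite measures that agree on ray
    boxes, hence on all measurable sets, so the parts coincide almost everywhere. *)
Lemma null_on_ray_boxes (h : space -> R) : cube.-integrable setT (EFin \o h) ->
  (forall a, \int[cube]_(x in ray_box a) h x = 0) ->
  {ae cube, forall x, h x = 0}.
Proof.
move=> ih h0; have /integrableP[mhE _] := ih.
have mp : measurable_fun setT ((EFin \o h)^\+)%E by exact: measurable_funepos.
have mn : measurable_fun setT ((EFin \o h)^\-)%E by exact: measurable_funeneg.
have p0 x : (0 <= (EFin \o h)^\+ x)%E by exact: funepos_ge0.
have n0 x : (0 <= (EFin \o h)^\- x)%E by exact: funeneg_ge0.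
have ip := integrable_funepos measurableT ih.
have in_ := integrable_funeneg measurableT ih.
have E A : measurable A ->
    density_measure cube ((EFin \o h)^\+)%E A = density_measure cube ((EFin \o h)^\-)%E A.
  move: A; apply: (@rV_measure_unique R d);
    try solve [exact: mp|exact: p0|exact: mn|exact: n0].
    exact: (integrable_lty measurableT ip).
  move=> a; have mb := measurable_ray_box a.
  have ipa := integrableS measurableT mb (@subsetT _ _) ip.
  have ina := integrableS measurableT mb (@subsetT _ _) in_.
  have := h0 a; rewrite /Rintegral integralE fineB; last 2 first.
  - exact: (integrable_fin_num mb ipa).
  - exact: (integrable_fin_num mb ina).
  move=> /eqP; rewrite subr_eq0 => /eqP fE.
  rewrite -[LHS](fineK (integrable_fin_num mb ipa)) -[RHS](fineK (integrable_fin_num mb ina)).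
  by congr EFin.
have := integral_ae_eq measurableT ip mn.
move=> /(_ _)/= H; have {}H := H (fun A _ mA => E A mA).
apply: filterS H => x /(_ Logic.I); rewrite funeposE funenegE /=.
case: (leP 0 (h x)) => hx.
  by rewrite max_l ?lee_fin// max_r ?lee_fin ?oppr_le0// => -[].
rewrite max_r ?lee_fin ?(ltW hx)// max_l ?lee_fin ?oppr_ge0 ?(ltW hx)//.
by move=> [] /esym/eqP; rewrite oppr_eq0 => /eqP.
Qed.

End null_on_boxes.

(** * Smooth bumps on the line *)

Section smooth_functions.
Context {R : realType}.
Implicit Types (f g h : R -> R) (p : {poly R}) (x t : R).

(* Smoothness as an impredicative coinduction: [f] belongs to some class of
   differentiable functions which is stable under derivation. *)
Definition smooth f : Prop := exists S : set (R -> R), S f /\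
  forall h, S h -> (forall x, derivable h x 1) /\ S (derive1 h).

Lemma smooth_derivable f : smooth f -> forall x, derivable f x 1.
Proof. by move=> [S [Sf H]]; exact: (H f Sf).1. Qed.

Lemma smooth_derive1 f : smooth f -> smooth (derive1 f).
Proof. by move=> [S [Sf H]]; exists S; split => //; exact: (H f Sf).2. Qed.

Lemma smooth_derive1n f n : smooth f -> smooth (derive1n n f).
Proof. by move=> sf; elim: n => [//|n IH]; exact: smooth_derive1. Qed.

Lemma smooth_continuous f : smooth f -> continuous f.
Proof.
move=> sf x; apply: differentiable_continuous; apply/derivable1_diffP.
exact: smooth_derivable.
Qed.

Lemma derive1_is_derive f x (a : R) : is_derive x 1 f a -> derive1 f x = a.
Proof. by move=> [_ <-]; rewrite derive1E. Qed.

Lemma is_derive_derive1 f x : derivable f x 1 -> is_derive x 1 f (derive1 f x).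
Proof. by move=> df; apply: DeriveDef => //; rewrite derive1E. Qed.

(* The derivative of a product is a sum of products, hence the span. *)
Inductive product_span : (R -> R) -> Prop :=
| Product_span f g : smooth f -> smooth g -> product_span (fun x => f x * g x)
| Sum_span F G : product_span F -> product_span G -> product_span (fun x => F x + G x).

Lemma smoothM f g : smooth f -> smooth g -> smooth (fun x => f x * g x).
Proof.
move=> sf sg; exists product_span; split; first exact: Product_span.
move=> h; elim=> {f g sf sg} [f g sf sg|F G _ [dF sF] _ [dG sG]].
  have D x : is_derive x 1 (fun x => f x * g x) (derive1 f x * g x + f x * derive1 g x).
    have df := is_derive_derive1 (@smooth_derivable _ sf x).
    have dg := is_derive_derive1 (@smooth_derivable _ sg x).
    have -> : derive1 f x * g x + f x * derive1 g x =
        f x *: derive1 g x + g x *: derive1 f x by rewrite /GRing.scale/=; ring.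
    exact: is_deriveM df dg.
  split; first by move=> x; have [] := D x.
  rewrite (_ : derive1 _ = (fun x => derive1 f x * g x + f x * derive1 g x)).
    by apply: Sum_span; apply: Product_span => //; exact: smooth_derive1.
  by apply/funext => x; exact: derive1_is_derive.
have D x : is_derive x 1 (fun x => F x + G x) (derive1 F x + derive1 G x).
  exact: is_deriveD (is_derive_derive1 (dF x)) (is_derive_derive1 (dG x)).
split; first by move=> x; have [] := D x.
rewrite (_ : derive1 _ = (fun x => derive1 F x + derive1 G x)); first exact: Sum_span.
by apply/funext => x; exact: derive1_is_derive.
Qed.

Lemma smooth_affine f (a b : R) : smooth f -> smooth (fun x => f (a * x + b)).
Proof.
move=> sf; exists [set F | exists g c, smooth g /\ F = fun x => c * g (a * x + b)].
split; first by exists f, 1; split => //; apply/funext => x; rewrite mul1r.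
move=> _ [g [c [sg ->]]].
have D x : is_derive x 1 (fun x => c * g (a * x + b)) ((c * a) * derive1 g (a * x + b)).
  have d1 : is_derive x 1 (fun x : R => a * x + b) a.
    have {2}-> : a = a *: 1 + 0 by rewrite addr0 /GRing.scale/= mulr1.
    exact: is_deriveD (is_deriveZ a (is_derive_id x 1)) (is_derive_cst b x 1).
  have dg := is_derive_derive1 (@smooth_derivable _ sg (a * x + b)).
  rewrite (_ : c * a * derive1 g (a * x + b) = c *: (derive1 g (a * x + b) * a)).
    pose F := g \o (fun x => a * x + b).
    have dF : is_derive x 1 F (derive1 g (a * x + b) * a) by exact: is_derive1_comp.
    exact: (is_deriveZ c dF).
  by rewrite /GRing.scale/=; ring.
split; first by move=> x; have [] := D x.
exists (derive1 g), (c * a); split; first exact: smooth_derive1.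
by apply/funext => x; exact: derive1_is_derive.
Qed.

Lemma smoothB f g (c : R) : smooth f -> smooth g -> smooth (fun x => f x - c * g x).
Proof.
move=> sf sg.
exists [set F | exists f g, [/\ smooth f, smooth g & F = fun x => f x - c * g x]].
split; first by exists f, g.
move=> _ [u [v [su sv ->]]].
have D x : is_derive x 1 (fun x => u x - c * v x) (derive1 u x - c * derive1 v x).
  have du := is_derive_derive1 (@smooth_derivable _ su x).
  have dv := is_derive_derive1 (@smooth_derivable _ sv x).
  exact: is_deriveB du (is_deriveZ c dv).
split; first by move=> x; have [] := D x.
exists (derive1 u), (derive1 v); split; [exact: smooth_derive1..|].
by apply/funext => x; exact: derive1_is_derive.
Qed.

Lemma smooth_primitive f : (forall x, derivable f x 1) -> smooth (derive1 f) ->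
  smooth f.
Proof.
move=> df [S [Sf H]]; exists (S `|` [set f]); split; first by right.
move=> h [Sh|->]; last by split => //; left.
by have [? ?] := H h Sh; split => //; left.
Qed.

(** Letting the polynomial vary gives a class stable under derivation, which is what [smooth] asks
    for; $p=1$ is the classical flat function. *)
Definition flat p (t : R) : R := if 0 < t then p.[t^-1] * expR (- t^-1) else 0.

(** From $e^s\ge s^{n+1}/(n+1)!$ at $s=1/t$, with one power of $s$ to spare; it yields continuity at
    the origin. *)
Let flat_bound p : exists2 C, 0 <= C & forall t, t <= 1 -> `|flat p t| <= C * `|t|.
Proof.
pose A := \sum_(i < size p) `|p`_i|; pose n := size p.
have A0 : 0 <= A by apply: sumr_ge0.
exists (A * n.+1`!%:R) => [|t t1]; first by rewrite mulr_ge0.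
rewrite /flat; case: ifPn => [t0|_]; last by rewrite normr0 mulr_ge0 ?mulr_ge0.
set s := t^-1; have s1 : 1 <= s by rewrite invf_ge1.
have s0 : 0 < s by rewrite invr_gt0.
have pn : `|p.[s]| <= A * s ^+ n.
  rewrite horner_coef; apply: le_trans (ler_norm_sum _ _ _) _.
  rewrite mulr_suml; apply: ler_sum => i _; rewrite normrM ler_wpM2l//.
  rewrite ger0_norm ?exprn_ge0// ?(ltW s0)//.
  by apply: ler_weXn2l => //; exact: ltnW.
have es : s ^+ n.+1 / n.+1`!%:R <= expR s.
  by apply: le_trans (expR_ge1Dxn n (ltW s0)); rewrite lerDr.
have f0 : (0 : R) < n.+1`!%:R by rewrite ltr0n fact_gt0.
rewrite normrM (ger0_norm (expR_ge0 _)) expRN (gtr0_norm t0) ler_pdivrMr ?expR_gt0//.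
apply: le_trans pn _.
have es' : s ^+ n.+1 <= expR s * n.+1`!%:R by rewrite -ler_pdivrMr.
have -> : s ^+ n = s ^+ n.+1 * t.
  by rewrite exprS mulrAC mulVf ?mul1r// gt_eqF.
rewrite -!mulrA ler_wpM2l//; apply: le_trans (ler_wpM2r (ltW t0) es') _.
by rewrite le_eqVlt; apply/orP; left; apply/eqP; ring.
Qed.

Let flat_continuous0 p : {for 0, continuous (flat p)}.
Proof.
have [C C0 HC] := flat_bound p.
apply/cvgrPdist_le => e e0; near=> t.
have -> : flat p 0 = 0 by rewrite /flat ltxx.
have t1 : `|t| < 1 by near: t; exists 1 => //= u /=; rewrite sub0r normrN.
have te : `|t| < e / (C + 1).
  near: t; exists (e / (C + 1)); first by rewrite /= divr_gt0// ltr_wpDl.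
  by move=> u /=; rewrite sub0r normrN.
rewrite sub0r normrN; apply: le_trans (HC t _) _.
  by apply: ltW; exact: le_lt_trans (ler_norm _) t1.
move: te; rewrite ltr_pdivlMr ?ltr_wpDl// => te.
by apply: ltW; apply: le_lt_trans te; rewrite mulrC mulrDr mulr1 lerDl.
Unshelve. all: by end_near. Qed.

Let flat_derive p t : is_derive t 1 (flat p) (flat ('X^2 * (p - p^`())) t).
Proof.
have [t0|t0|->] := ltgtP t 0.
- apply: (@near_eq_is_derive _ _ _ (cst 0)).
    near=> u; rewrite /flat; case: ifPn => // u0; exfalso.
    have : u < 0 by near: u; exact: lt_nbhsl.
    by rewrite ltNge (ltW u0).
  rewrite /flat ltNge (ltW t0)/=; exact: is_derive_cst.
- pose F u : R := p.[u^-1] * expR (- u^-1).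
  apply: (@near_eq_is_derive _ _ _ F).
    near=> u; rewrite /flat ifT//; near: u; exact: lt_nbhsr.
  have tn0 : t != 0 by rewrite gt_eqF.
  have dV : is_derive t 1 (fun u : R => u^-1) (- t ^- 2 *: 1).
    exact: (@is_deriveV _ id t 1 1 tn0 (is_derive_id t 1)).
  have dNV : is_derive t 1 (fun u : R => - u^-1) (- (- t ^- 2 *: 1)).
    exact: is_deriveN dV.
  have d1 := is_derive1_comp (is_derive_poly p t^-1) dV.
  have d2 : is_derive t 1 (expR \o (fun u : R => - u^-1))
      (expR (- t^-1) * (- (- t ^- 2 *: 1))).
    exact: (@is_derive1_comp _ expR (fun u : R => - u^-1)).
  have -> : flat ('X^2 * (p - p^`())) t =
     p.[t^-1] *: (expR (- t^-1) * (- (- t ^- 2 *: 1))) +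
     expR (- t^-1) *: (p^`().[t^-1] * (- t ^- 2 *: 1)).
    rewrite /flat t0 !hornerE /GRing.scale/= exprVn; ring.
  exact: is_deriveM d1 d2.
(* The slope function at the origin is [flat ('X * p)], because $p(1/t)=t\cdot(1/t)\,p(1/t)$. *)
- apply/is_derive1_caratheodory; exists (flat ('X * p)); split.
  + move=> z; rewrite /flat ltxx !subr0; case: ifPn => z0; last by rewrite mul0r.
    by rewrite hornerM hornerX; field; rewrite gt_eqF.
  + exact: flat_continuous0.
  + by rewrite /flat ltxx.
Unshelve. all: by end_near. Qed.

Lemma smooth_flat p : smooth (flat p).
Proof.
exists (range flat); split; first by exists p.
move=> _ [q _ <-]; split; first by move=> x; have [] := flat_derive q x.
exists ('X^2 * (q - q^`())) => //; apply/funext => x.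
by rewrite (derive1_is_derive (flat_derive q x)).
Qed.

Lemma flat1_ge0 t : 0 <= flat 1 t.
Proof. by rewrite /flat; case: ifP => // _; rewrite hornerC mul1r expR_ge0. Qed.

Lemma flat1_le1 t : flat 1 t <= 1.
Proof.
rewrite /flat; case: ifPn => // t0; rewrite hornerC mul1r expR_le1.
by rewrite oppr_le0 invr_ge0 ltW.
Qed.

Lemma flat1_eq0 t : t <= 0 -> flat 1 t = 0.
Proof. by move=> t0; rewrite /flat ltNge t0. Qed.

(** Approximates the indicator of $(a,1)$: the first factor switches on at $a+1/(n+1)$, the second
    switches off at $1-1/(n+1)$, which keeps the support compact in $(0,1)$ when $a\ge0$. *)
Definition ray_bump (a : R) (n : nat) t : R :=
  flat 1 (n.+1%:R * (t - a) - 1) * flat 1 (n.+1%:R * (1 - t) - 1).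

Lemma smooth_ray_bump a n : smooth (ray_bump a n).
Proof.
apply: smoothM.
  rewrite (_ : (fun t => _) = (fun t => flat 1 (n.+1%:R * t + (- n.+1%:R * a - 1)))).
    exact/smooth_affine/smooth_flat.
  by apply/funext => t; congr flat; ring.
rewrite (_ : (fun t => _) = (fun t => flat 1 (- n.+1%:R * t + (n.+1%:R - 1)))).
  exact/smooth_affine/smooth_flat.
by apply/funext => t; congr flat; ring.
Qed.

Lemma ray_bump_ge0 a n t : 0 <= ray_bump a n t.
Proof. by rewrite mulr_ge0 ?flat1_ge0. Qed.

Lemma ray_bump_le1 a n t : ray_bump a n t <= 1.
Proof. by rewrite mulr_ile1 ?flat1_ge0 ?flat1_le1. Qed.

Lemma ray_bump_out a n t : 0 <= a ->
  ~~ (n.+1%:R^-1 <= t <= 1 - n.+1%:R^-1) -> ray_bump a n t = 0.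
Proof.
move=> a0; have n0 : (0 : R) < n.+1%:R by rewrite ltr0n.
rewrite negb_and -!ltNge /ray_bump => /orP[tn|tn].
  rewrite flat1_eq0 ?mul0r// subr_le0 -ler_pdivlMl// mulr1.
  by rewrite lerBlDr (le_trans (ltW tn))// lerDl.
rewrite [X in _ * X]flat1_eq0 ?mulr0// subr_le0 -ler_pdivlMl// mulr1.
by rewrite lerBlDr -lerBlDl ltW.
Qed.

Lemma ray_bump_cvg a t : 0 < t < 1 -> ray_bump a n t @[n --> \oo] --> ((a < t)%R%:R : R).
Proof.
move=> /andP[t0 t1].
have key c : 0 < c -> flat 1 (n.+1%:R * c - 1) @[n --> \oo] --> (1 : R).
  (* From $e^{-1/x}\ge1-1/x$ with $x=(n+1)c-1\ge(n+1)c/2$, valid once $(n+1)c\ge2$. *)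
  move=> c0; apply: (@squeeze_cvgr _ _ _ _ (fun n => 1 - 2 / c * n.+1%:R^-1) (fun=> 1)).
  - near=> n; rewrite flat1_le1 andbT.
    have nc : 2 <= n.+1%:R * c.
      rewrite -ler_pdivrMr//; apply: (@le_trans _ _ n%:R); last by rewrite ler_nat.
      by near: n; exact: nbhs_infty_ger.
    rewrite /flat ifT; last by rewrite subr_gt0; apply: lt_le_trans nc; rewrite ltr1n.
    rewrite hornerC mul1r; apply: le_trans (expR_ge1Dx _).
    have N0 : 0 < n.+1%:R * c by rewrite mulr_gt0.
    have -> : 2 / c * n.+1%:R^-1 = ((n.+1%:R * c) / 2)^-1.
      by field; rewrite gt_eqF//= pnatr_eq0.
    rewrite lerD2l lerN2 lef_pV2 ?posrE//.
    + by move: nc; set X := n.+1%:R * c => nc; lra.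
    + by rewrite subr_gt0; apply: lt_le_trans nc; rewrite ltr1n.
    + by rewrite divr_gt0.
  - rewrite -[X in _ --> X]subr0 -[X in _ - X](mulr0 (2 / c)).
    by apply: cvgB; [exact: cvg_cst|apply: cvgM; [exact: cvg_cst|exact: cvg_harmonic]].
  - exact: cvg_cst.
case: (ltP a t) => at_.
  rewrite /ray_bump -[X in _ --> X](mulr1 1); apply: cvgM; apply: key; rewrite subr_gt0//.
rewrite (_ : (fun n => _) = (fun=> 0)); first exact: cvg_cst.
apply/funext => n; rewrite /ray_bump flat1_eq0 ?mul0r// subr_le0.
by rewrite (@le_trans _ _ 0)// mulr_ge0_le0// subr_le0.
Unshelve. all: by end_near. Qed.

End smooth_functions.

(** * Products of one-variable test functions *)

Section tensor_test_functions.
Context {R : realType} {d : nat}.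
Local Notation space := 'rV[R]_d.
Local Notation cube := (@cube R d).
Local Notation Rm := (measurableTypeR R).
Implicit Types (phi : 'I_d -> R -> R) (x : space) (i : 'I_d).

Definition tensor phi : space -> R := fun x => \prod_i phi i (x 0 i).

Lemma tensor_set_coord phi i t x :
  tensor phi (set_coord i t x) = phi i t * \prod_(j | j != i) phi j (x 0 j).
Proof.
rewrite /tensor (bigD1 i)//= set_coord_same; congr (_ * _).
by apply: eq_bigr => j ji; rewrite set_coord_neq.
Qed.

Lemma tensorE phi i x : tensor phi x = phi i (x 0 i) * \prod_(j | j != i) phi j (x 0 j).
Proof. by rewrite /tensor (bigD1 i). Qed.

Lemma tensor_derive phi i x : derivable (phi i) (x 0 i) 1 ->
  is_derive x (delta_mx 0 i) (tensor phi)
    (tensor (fun j => if j == i then derive1 (phi j) else phi j) x).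
Proof.
move=> dphi; set c := \prod_(j | j != i) phi j (x 0 j).
have -> : tensor (fun j => if j == i then derive1 (phi j) else phi j) x =
    c * derive1 (phi i) (x 0 i).
  rewrite (tensorE _ i) eqxx mulrC; congr (_ * _).
  by apply: eq_bigr => j /negbTE ->.
have G : (fun h : R => h^-1 *: ((phi i \o shift (x 0 i)) (h *: 1) - phi i (x 0 i))) @ 0^'
    --> derive1 (phi i) (x 0 i).
  by rewrite derive1E; exact: dphi.
have E : (fun h : R => h^-1 *: ((tensor phi \o shift x) (h *: delta_mx 0 i) - tensor phi x)) =
    (fun h : R => c * (h^-1 *: ((phi i \o shift (x 0 i)) (h *: 1) - phi i (x 0 i)))).
  apply/funext => h /=.
  have -> : h *: delta_mx 0 i + x = set_coord i (h *: 1 + x 0 i) x.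
    apply/rowP => j; rewrite !mxE eqxx /=; case: eqP => [->|_].
      by rewrite /GRing.scale.
    by rewrite mulr0 add0r.
  rewrite tensor_set_coord (tensorE _ i) -/c /GRing.scale/=; ring.
have H : (fun h : R => h^-1 *: ((tensor phi \o shift x) (h *: delta_mx 0 i) - tensor phi x)) @ 0^'
    --> c * derive1 (phi i) (x 0 i).
  by rewrite E; apply: cvgM => //; exact: cvg_cst.
apply: DeriveDef; first by apply/cvg_ex; eexists; exact: H.
exact: cvg_lim H.
Qed.

Lemma partials_tensor phi (s : seq 'I_d) : (forall i, smooth (phi i)) ->
  partials s (tensor phi) = tensor (fun j => derive1n (count_mem j s) (phi j)).
Proof.
move=> sphi; elim: s => [//|i s IH]; rewrite /= IH.
apply/funext => x; rewrite /partial.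
have := @tensor_derive (fun j => derive1n (count_mem j s) (phi j)) i x.
move=> /(_ (@smooth_derivable _ _ (smooth_derive1n _ (sphi i)) _)) [_ ->].
by apply: eq_bigr => j _; rewrite [i == j]eq_sym; case: eqP => [->|]; rewrite ?add1n ?add0n.
Qed.

Lemma multi_partial_tensor phi (q : 'I_d -> nat) : (forall i, smooth (phi i)) ->
  multi_partial q (tensor phi) = tensor (fun j => derive1n (q j) (phi j)).
Proof.
move=> sphi; rewrite /multi_partial partials_tensor//.
congr tensor; apply/funext => j; congr derive1n.
rewrite count_flatten -map_comp sumnE big_map big_enum/=.
rewrite (bigD1 j)//= count_nseq /= eqxx mul1n big1 ?addn0// => i ij.
by rewrite count_nseq/= (negbTE ij).
Qed.

Lemma tensor_continuous phi : (forall i, continuous (phi i)) -> continuous (tensor phi).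
Proof.
move=> cphi; rewrite /tensor.
have key (s : seq 'I_d) : continuous (fun x : space => \prod_(i <- s) phi i (x 0 i)).
  elim: s => [|i s IH].
    rewrite (_ : (fun x : space => _) = cst 1); first exact: cst_continuous.
    by apply/funext => x; rewrite big_nil.
  rewrite (_ : (fun x : space => _) =
      (fun x => phi i (x 0 i) * \prod_(j <- s) phi j (x 0 j))); last first.
    by apply/funext => x; rewrite big_cons.
  move=> x.
  have cc : {for x, continuous (phi i \o (fun y : space => y 0 i))}.
    by apply: continuous_comp; [exact: coord_continuous|exact: cphi].
  have := cvgM cc (IH x); exact.
exact: key.
Qed.

Definition test1 (f : R -> R) : Prop := smooth f /\
  exists a b, [/\ 0 < a, b < 1 & forall t, ~~ (a <= t <= b) -> f t = 0].

Lemma test_fun_tensor phi : (forall i, test1 (phi i)) -> test_fun (tensor phi).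
Proof.
move=> tphi; have sphi i := (tphi i).1.
split.
  move=> s; rewrite partials_tensor//; split.
    by apply: tensor_continuous => i; apply: smooth_continuous; exact: smooth_derive1n.
  move=> i x; suff : is_derive x (delta_mx 0 i)
    (tensor (fun j : 'I_d => derive1n (count_mem j s) (phi j)))
    (tensor (fun j => if j == i then derive1 (derive1n (count_mem j s) (phi j))
              else derive1n (count_mem j s) (phi j)) x) by case.
  by apply: tensor_derive; apply: smooth_derivable; exact: smooth_derive1n.
have /choice[a /choice[b ab]] := fun i => (tphi i).2.
exists [set x : space | forall i, `[a i, b i]%classic (x 0 i)]; first split.
- by apply: (@rV_compact _ _ (fun i => `[a i, b i]%classic)) => i; exact: segment_compact.
- move=> x /= xab i; have [a0 b1 _] := ab i; have := xab i; rewrite in_itv/=.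
  by move=> /andP[/(lt_le_trans a0) -> /le_lt_trans ->].
- move=> x /= /existsNP[i]; rewrite in_itv/= => /negP nx.
  by have [_ _ ab0] := ab i; rewrite (tensorE _ i) ab0// mul0r.
Qed.

Lemma test1_ray_bump a n : 0 <= a -> test1 (ray_bump a n : R -> R).
Proof.
move=> a0; split; first exact: smooth_ray_bump.
exists n.+1%:R^-1, (1 - n.+1%:R^-1); split.
- by rewrite invr_gt0.
- by rewrite ltrBlDr ltrDl invr_gt0.
- by move=> t; exact: ray_bump_out.
Qed.

Lemma bounded_test1 (f : R -> R) : test1 f -> exists M, forall t, `|f t| <= M.
Proof.
move=> [sf [a [b [a0 b1 fab]]]].
have [M fM] := bounded_chi_cont (smooth_continuous sf).
have M0 : 0 <= M by apply: le_trans (fM 0); rewrite normr_ge0.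
exists M => t; have [/andP[at_ tb]|/fab ->] := boolP (a <= t <= b); last by rewrite normr0.
have := fM t; rewrite /chi (le_trans (ltW a0) at_) (le_lt_trans tb b1).
by rewrite mul1r.
Qed.

Lemma measurable_smooth (f : R -> R) : smooth f -> measurable_fun setT (f : Rm -> R).
Proof. by move=> sf; apply: continuous_measurable_fun; exact: smooth_continuous. Qed.

Lemma measurable_tensor phi : (forall i, measurable_fun setT (phi i : Rm -> R)) ->
  measurable_fun setT (tensor phi).
Proof.
move=> mphi; apply: measurable_prod => i _.
apply: (measurableT_comp (mphi i)); exact: measurable_coord.
Qed.

Lemma bounded_tensor phi : (forall i, exists M, forall t, `|phi i t| <= M) ->
  exists M, forall x, `|tensor phi x| <= M.
Proof.
move=> /choice[M HM]; exists (\prod_i M i) => x.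
by rewrite /tensor normr_prod; apply: ler_prod => i _; rewrite normr_ge0 HM.
Qed.

(** Tensor bumps converge boundedly on the cube to indicators of ray boxes, so by dominated
    convergence [h] integrates to zero over each ray box. *)
Lemma tensor_fundamental (h : space -> R) : sqint cube h ->
  (forall phi, (forall i, test1 (phi i)) -> \int[cube]_x (h x * tensor phi x) = 0) ->
  {ae cube, forall x, h x = 0}.
Proof.
move=> sh h0; have ih := sqint_integrable sh; have [mh _] := sh.
apply: null_on_ray_boxes => // a.
(* The bumps must be supported in the cube; raising [a i] to zero does not change the part of the
   ray box inside it. *)
pose a' i : R := Num.max 0 (a i).
pose beta n i := ray_bump (a' i) n.
have a'0 i : 0 <= a' i by rewrite /a' le_max lexx.
have tb n i : test1 (beta n i) by exact: test1_ray_bump.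
pose chiB x : R := \prod_i (a i < x 0 i)%R%:R.
have mT n : measurable_fun setT (tensor (beta n)).
  by apply: measurable_tensor => i; apply: measurable_smooth; have [] := tb n i.
have T01 n x : `|tensor (beta n) x| <= 1.
  rewrite ger0_norm ?prodr_ge0//; last by move=> i _; exact: ray_bump_ge0.
  by apply: prodr_ile1 => i _; rewrite ray_bump_ge0 ray_bump_le1.
have mC : measurable_fun setT chiB.
  apply: measurable_prod => i _.
  apply: (measurableT_comp (f := fun t : Rm => (a i < t)%R%:R : R)); last exact: measurable_coord.
  rewrite (_ : (fun t : Rm => _) = \1_(`]a i, +oo[%classic)).
    by apply: measurable_indic; exact: measurable_itv.
  by apply/funext => t; rewrite indicE; congr ((nat_of_bool _)%:R); rewrite mem_setE in_itv/= andbT.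
have cv : {ae cube, forall x, (h x * tensor (beta n) x) @[n --> \oo] --> h x * chiB x}.
  apply/ae_cube; apply: aeW => x Ox.
  have tc : tensor (beta n) x @[n --> \oo] --> chiB x.
    rewrite /tensor /chiB.
    have ci i : beta n i (x 0 i) @[n --> \oo] --> ((a i < x 0 i)%R%:R : R).
      have -> : (a i < x 0 i) = (a' i < x 0 i).
        by rewrite /a' gt_max (andP (Ox i)).1.
      exact: ray_bump_cvg (Ox i).
    have key (s : seq 'I_d) : \prod_(i <- s) beta n i (x 0 i) @[n --> \oo] -->
        \prod_(i <- s) ((a i < x 0 i)%R%:R : R).
      elim: s => [|i s IH].
        rewrite big_nil (_ : (fun n => _) = cst 1); first exact: cvg_cst.
        by apply/funext => n; rewrite big_nil.
      rewrite big_cons (_ : (fun n => _) =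
        (fun n => beta n i (x 0 i) * \prod_(j <- s) beta n j (x 0 j))).
        by have := cvgM (ci i) IH; exact.
      by apply/funext => n; rewrite big_cons.
    exact: key.
  exact: (cvgM (cvg_cst (h x)) tc).
have [] := @dominated_convergence _ _ _ cube setT measurableT
  (fun n x => (h x * tensor (beta n) x)%:E) (fun x => (h x * chiB x)%:E)
  (fun x => `|h x|%:E).
- by move=> n; apply/measurable_EFinP; apply: measurable_funM.
- by apply/measurable_EFinP; apply: measurable_funM.
- by apply: filterS cv => x cx _; apply/fine_cvgP; split => //; exact: nearW.
- by have := integrable_norm ih.
- apply: aeW => x n _ /=; rewrite lee_fin normrM ler_piMr//.
move=> iC _ cI.
have -> : \int[cube]_(x in ray_box a) h x = \int[cube]_x (h x * chiB x).
  rewrite Rintegral_mkcond; apply: eq_Rintegral => x _; rewrite patchE /chiB.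
  case: ifPn => [|]; rewrite ?inE ?notin_setE => xa.
    by rewrite big1 ?mulr1// => i _; rewrite xa.
  have /existsNP[i /negP nx] := xa.
  by rewrite (bigD1 i)//= (negbTE nx) mul0r mulr0.
rewrite /Rintegral (_ : (\int[cube]_x (h x * chiB x)%:E)%E = 0%E)//.
have <- := cvg_lim _ cI => //.
rewrite (_ : (fun n => _) = (fun=> 0%E)); first exact: lim_cst.
apply/funext => n /=.
have iT : cube.-integrable setT (EFin \o (fun x => h x * tensor (beta n) x)).
  by apply: sqintM => //; exact: (sqint_bounded _ (mT n) (T01 n)).
by rewrite -[LHS](fineK (integrable_fin_num measurableT iT)); congr EFin; exact: h0.
Qed.

End tensor_test_functions.

(** * Weak derivatives on lines *)

Section weak_derivative_on_slices.
Context {R : realType} {d : nat}.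
Local Notation space := 'rV[R]_d.
Local Notation cube := (@cube R d).
Local Notation u01 := (@u01 R).
Local Notation leb := (@lebesgue_measure R).
Local Notation Rm := (measurableTypeR R).
Local Notation J := (kop1 (@primk R)).
Implicit Types (phi : 'I_d -> R -> R) (x : space) (s i : 'I_d) (f g w : space -> R).

Definition avgk (t y : R) : R := 1.

Lemma bounded_avgk : bounded_kernel avgk.
Proof. by split => //; exists 1 => *; rewrite normr1. Qed.

(* [f - J_s g] is a.e. equal to its own average in [x_s], i.e. [f] is a primitive
   of [g] on almost every line in the direction [s]. *)
Definition is_prim s f g : Prop := {ae cube, forall x,
  f x - kop (@primk R) s g x = kop avgk s (fun z => f z - kop (@primk R) s g z) x}.

Definition update phi s (F : R -> R) : 'I_d -> R -> R :=
  fun j => if j == s then F else phi j.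

Lemma tensor_update phi s F x :
  tensor (update phi s F) x = F (x 0 s) * \prod_(j | j != s) phi j (x 0 j).
Proof.
rewrite (tensorE _ s) /update eqxx; congr (_ * _).
by apply: eq_bigr => j /negbTE ->.
Qed.

(** Integrating from $-\infty$ gives zero to the left of the support, and mean zero gives zero to
    the right of it. *)
Lemma exists_test1_primitive (rho : R -> R) : test1 rho -> \int[u01]_t rho t = 0 ->
  exists F, [/\ test1 F, derive1 F = rho & forall t, 0 < t < 1 -> F t = J rho t].
Proof.
move=> tr r0; have [sr [a [b [a0 b1 rout]]]] := tr.
have [M rM] := bounded_test1 tr.
have mr := measurable_smooth sr.
have su := sqint_bounded u01 mr rM.
have rE : rho = rho \_ `]0, 1[.
  apply/funext => t; rewrite patchE; case: ifPn => //; rewrite notin_setE/= in_itv/=.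
  move=> /negP nt; apply: rout; apply: contra nt => /andP[at_ tb].
  by rewrite (lt_le_trans a0 at_) (le_lt_trans tb b1).
have ir : leb.-integrable setT (EFin \o rho).
  have /integrableP[_ ro] := sqint_integrable su.
  apply/integrableP; split; first exact/measurable_EFinP.
  apply: le_lt_trans ro; rewrite integral_u01 [leRHS]integral_mkcond.
  rewrite le_eqVlt; apply/orP; left; apply/eqP; apply: eq_integral => y _ /=.
  by rewrite [in LHS]rE !patchE; case: ifPn => //=; rewrite normr0.
pose F t := \int[leb]_(y in `]-oo, t]) rho y.
have dF t : derivable F t 1 /\ derive1 F t = rho t.
  have tu : t < t + 1 by rewrite ltrDl.
  have iru : leb.-integrable `]-oo, (t + 1)] (EFin \o rho).
    by apply: (integrableS measurableT).
  exact: (continuous_FTC1 tu iru (ltNyr t) (@smooth_continuous _ _ sr t)).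
have dFE : derive1 F = rho by apply/funext => t; exact: (dF t).2.
have FJ t : 0 <= t -> t <= 1 -> F t = J rho t.
  move=> t0 t1; rewrite kop1_primkE// /cint (@Rintegral_chi _ 0 t _ `]0, t])//; last 2 first.
  - by move=> y /=; rewrite !in_itv/= => /andP[-> /ltW].
  - by move=> y /=; rewrite !in_itv/= => /andP[/ltW -> ->].
  rewrite /F Rintegral_mkcond [RHS]Rintegral_mkcond; apply: eq_Rintegral => y _.
  rewrite !patchE; case: ifPn; rewrite ?inE ?notin_setE/= in_itv/= => yt.
    case: ifPn => //; rewrite notin_setE/= in_itv/= yt andbT => /negP y0.
    apply: rout; apply: contra y0 => /andP[ay _]; exact: lt_le_trans a0 ay.
  by rewrite ifN// notin_setE/= in_itv/= => /andP[_ /yt].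
exists F; split => //; last by move=> t /andP[t0 t1]; apply: FJ; exact: ltW.
split.
  by apply: smooth_primitive; [move=> t; exact: (dF t).1|rewrite dFE].
exists a, b; split => // t; rewrite negb_and -!ltNge => /orP[ta|bt].
  rewrite /F Rintegral_mkcond (_ : _ \_ _ = cst 0).
    by rewrite /Rintegral integral0.
  apply/funext => y; rewrite patchE; case: ifPn => //; rewrite inE/= in_itv/= => yt.
  by apply: rout; rewrite negb_and -!ltNge (le_lt_trans yt ta).
rewrite -[RHS]r0 [RHS]Rintegral_u01 /F [LHS]Rintegral_mkcond [RHS]Rintegral_mkcond.
apply: eq_Rintegral => y _.
rewrite !patchE; case: ifPn; rewrite ?inE ?notin_setE/= in_itv/=.
  move=> yt; case: ifPn => //; rewrite notin_setE/= in_itv/= => /negP ny.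
  apply: rout; apply: contra ny => /andP[ay yb].
  by rewrite (lt_le_trans a0 ay) (le_lt_trans yb b1).
move=> /negP; rewrite -ltNge => ty; case: ifPn => // _; apply/esym/rout.
by rewrite negb_and -!ltNge (lt_trans bt ty) orbT.
Qed.

(** A nonnegative bump with zero integral would vanish almost everywhere, but this one is positive
    on $(1/3,2/3)$. *)
Lemma exists_test1_mass : exists2 eta : R -> R, test1 eta & \int[u01]_t eta t != 0.
Proof.
exists (ray_bump 0 2); first exact: test1_ray_bump.
apply/negP => /eqP h0.
have t1 : test1 (ray_bump 0 2 : R -> R) by exact: test1_ray_bump.
have m1 := measurable_smooth t1.1.
have [M hM] := bounded_test1 t1.
have i1 := sqint_integrable (sqint_bounded u01 m1 hM).
have a0 : (0 : R) <= 2 / 5 by rewrite divr_ge0.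
have ab : (2 / 5 : R) < 3 / 5 by lra.
have b1 : (3 / 5 : R) <= 1 by lra.
have : {ae u01, forall y, chi (2 / 5) (3 / 5) y = 0}.
  have : (\int[u01]_y `|(ray_bump 0 2 y)%:E| = 0)%E.
    have /= F := integrable_fin_num measurableT i1.
    transitivity (\int[u01]_y (ray_bump 0 2 y)%:E)%E.
      by apply: eq_integral => y _ /=; rewrite ger0_norm// ray_bump_ge0.
    by rewrite -[LHS](fineK F); congr EFin.
  have /integrableP[mi _] := i1.
  move=> /(ae_eq_integral_abs u01 measurableT mi); apply: filterS => y /(_ Logic.I) /= [].
  rewrite /chi; case: (boolP (2 / 5 <= y < 3 / 5)) => // /andP[ay yb].
  rewrite /ray_bump /flat !ifT; [|lra..] => /eqP; rewrite !hornerC !mul1r.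
  by rewrite mulf_eq0 !expR_eq0.
move=> c0; have := Rintegral_chi1 a0 (ltW ab) b1.
rewrite (eq_ae_Rintegral c0) Rintegral_u01_cst; lra.
Qed.

(** The du Bois-Reymond lemma, with the other variables as parameters carried by the factor [G] of
    the tensor. *)
Lemma weak_is_prim s f g : sqint cube f -> sqint cube g ->
  (forall phi, (forall i, test1 (phi i)) ->
    \int[cube]_x (f x * tensor (update phi s (derive1 (phi s))) x) =
    - \int[cube]_x (g x * tensor phi x)) ->
  is_prim s f g.
Proof.
move=> sf sg wk; have bp := @bounded_primk R.
have sJg := sqint_kop s bp sg.
(* [w] is independent of [x_s]: it integrates to zero against every tensor
   whose factor in [x_s] has mean zero, hence equals its [e0]-average. *)
pose w x := f x - kop (@primk R) s g x.
have sw : sqint cube w by exact: sqintB.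
have [e0 te0 c0] := exists_test1_mass; set c := \int[u01]_t e0 t in c0.
have me0 := measurable_smooth te0.1; have [M0 e0M] := bounded_test1 te0.
have ie0 := sqint_integrable (sqint_bounded u01 me0 e0M).
pose K (t y : R) := e0 y / c.
have bK : bounded_kernel K.
  split.
    apply: measurable_funM => //; exact: (measurableT_comp me0 measurable_snd).
  by exists (M0 * `|c^-1|) => t y; rewrite /K normrM ler_wpM2r.
have sKw := sqint_kop s bK sw.
have wK : {ae cube, forall x, w x = kop K s w x}.
  suff : {ae cube, forall x, w x - kop K s w x = 0}.
    by apply: filterS => x /eqP; rewrite subr_eq0 => /eqP.
  apply: tensor_fundamental; first exact: sqintB.
  move=> phi tphi.
  pose G x : R := \prod_(j | j != s) phi j (x 0 j).
  have Gs t x : G (set_coord s t x) = G x.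
    by apply: eq_bigr => j js; rewrite set_coord_neq.
  have GE : G = tensor (update phi s (fun=> 1)).
    by apply/funext => x; rewrite tensor_update mul1r.
  have mG : measurable_fun setT G.
    rewrite GE; apply: measurable_tensor => i; rewrite /update; case: ifP => // _.
    exact: measurable_smooth (tphi i).1.
  have [MG GM] : exists MG, forall x, `|G x| <= MG.
    rewrite GE; apply: bounded_tensor => i; rewrite /update.
    case: ifP => _; first by exists 1 => t; rewrite normr1.
    exact: bounded_test1 (tphi i).
  pose eta := phi s; have te : test1 eta := tphi s.
  have me := measurable_smooth te.1; have [Me eM] := bounded_test1 te.
  have ie := sqint_integrable (sqint_bounded u01 me eM).
  pose q := (\int[u01]_t eta t) / c.
  (* Removing the right multiple of [e0] leaves mean zero, so [rho] is the derivative of a test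
     function and the hypothesis applies to it. *)
  pose rho t := eta t - q * e0 t.
  have trho : test1 rho.
    split; first exact: smoothB te.1 te0.1.
    have [_ [a [b [a0 b1 eout]]]] := te; have [_ [a' [b' [a'0 b'1 e0out]]]] := te0.
    exists (Num.min a a'), (Num.max b b'); split.
    - by rewrite lt_min a0.
    - by rewrite gt_max b1.
    move=> t; rewrite ge_min le_max => /negP nt.
    rewrite /rho eout ?e0out ?mulr0 ?subr0//; apply/negP => /andP[h1 h2]; apply: nt;
      by rewrite h1 h2 ?orbT.
  have mr := measurable_smooth trho.1; have [Mr rM] := bounded_test1 trho.
  have ir := sqint_integrable (sqint_bounded u01 mr rM).
  have r0 : \int[u01]_t rho t = 0.
    rewrite RintegralB//; last exact: (integrableZl measurableT q ie0).
    by rewrite RintegralZl// /q divfK// subrr.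
  have [F [tF dF FJ]] := exists_test1_primitive trho r0.
  have mF := measurable_smooth tF.1; have [MF FM] := bounded_test1 tF.
  have sprod (h : R -> R) Mh : measurable_fun setT (h : Rm -> R) ->
      (forall t, `|h t| <= Mh) -> sqint cube (fun x => h (x 0 s) * G x).
    move=> mh hM; apply: (@sqint_bM _ _ _ _ _ _ Mh).
    - by apply: (measurableT_comp mh); exact: measurable_coord.
    - by move=> x; exact: hM.
    - exact: (sqint_bounded _ mG GM).
  have fr : \int[cube]_x (f x * (rho (x 0 s) * G x)) =
      - \int[cube]_x (g x * (F (x 0 s) * G x)).
    have tup i : test1 (update phi s F i) by rewrite /update; case: ifP.
    have := wk _ tup; rewrite /update eqxx dF -/(update phi s F).
    under eq_Rintegral do rewrite tensor_update.
    under [X in - X]eq_Rintegral do rewrite tensor_update.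
    move=> H; rewrite -H; apply: eq_Rintegral => x _; congr (_ * (_ * _)).
    by apply: eq_bigr => j /negbTE js; rewrite /update js.
  have gr : \int[cube]_x (kop (@primk R) s g x * (rho (x 0 s) * G x)) =
      - \int[cube]_x (g x * (F (x 0 s) * G x)).
    rewrite (kop_adjoint bp sg mr rM mG GM Gs) -mulN1r -RintegralZl//; last first.
      by apply: sqintM => //; exact: (sprod _ MF).
    have E : {ae cube, forall x,
        g x * ((\int[u01]_t (primk t (x 0 s) * rho t)) * G x) =
        -1 * (g x * (F (x 0 s) * G x))}.
      apply/ae_cube; apply: aeW => x Ox.
      rewrite Rintegral_primk_swap// r0 sub0r -(FJ _ (Ox s)); ring.
    rewrite /Rintegral; congr fine; apply: ae_eq_integralW => //.
    by apply: filterS E => x h _; congr EFin; exact: h.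
  have wr : \int[cube]_x (w x * (rho (x 0 s) * G x)) = 0.
    rewrite -[RHS](subrr (\int[cube]_x (f x * (rho (x 0 s) * G x)))).
    rewrite [X in _ - X]fr -gr -RintegralB//; last 2 first.
    - exact: (sqintM sf (sprod _ Mr mr rM)).
    - exact: (sqintM sJg (sprod _ Mr mr rM)).
    by apply: eq_Rintegral => x _; rewrite /w mulrBl.
  have E1 : \int[cube]_x (w x * (eta (x 0 s) * G x)) =
      q * \int[cube]_x (w x * (e0 (x 0 s) * G x)).
    rewrite -RintegralZl//; last exact: (sqintM sw (sprod _ M0 me0 e0M)).
    apply/eqP; rewrite -subr_eq0 -RintegralB//; last 2 first.
    - exact: (sqintM sw (sprod _ Me me eM)).
    - exact: (integrableZl measurableT q (sqintM sw (sprod _ M0 me0 e0M))).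
    apply/eqP; rewrite -[RHS]wr; apply: eq_Rintegral => x _; rewrite /rho; ring.
  have E2 : \int[cube]_x (kop K s w x * (eta (x 0 s) * G x)) =
      q * \int[cube]_x (w x * (e0 (x 0 s) * G x)).
    rewrite (kop_adjoint bK sw me eM mG GM Gs) -RintegralZl//; last first.
      exact: (sqintM sw (sprod _ M0 me0 e0M)).
    apply: eq_Rintegral => x _.
    by rewrite /K RintegralZl// /q; ring.
  transitivity (\int[cube]_x (w x * (eta (x 0 s) * G x) - kop K s w x * (eta (x 0 s) * G x))).
    by apply: eq_Rintegral => x _; rewrite mulrBl (tensorE _ s).
  rewrite RintegralB//; last 2 first.
  - exact: (sqintM sw (sprod _ Me me eM)).
  - exact: (sqintM sKw (sprod _ Me me eM)).
  by rewrite E1 E2 subrr.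
(* The kernel [K] does not depend on its first argument, so [kop K s w] is constant along $x_s$ and
   equals its plain average. *)
rewrite /is_prim -/w.
have := ae_eq_kop avgk s wK; apply: filterS2 wK => x wKx.
rewrite -/(w x) => ->; rewrite wKx kopE.
rewrite -[LHS](Rintegral_u01_cst (kop K s w x)); apply: eq_Rintegral => y _.
by rewrite mul1r kop_slice kopE.
Qed.

End weak_derivative_on_slices.

(** * Increments in one direction *)

Section derivative_families.
Context {R : realType} {d : nat}.
Local Notation space := 'rV[R]_d.
Local Notation cube := (@cube R d).
Local Notation u01 := (@u01 R).
Local Notation J := (kop1 (@primk R)).
Implicit Types (x : space) (s i : 'I_d) (f g w : space -> R) (q r : 'I_d -> nat).

Lemma ae_coord s (Q : set R) : {ae u01, forall t, Q t} ->
  {ae cube, forall x, Q (x 0 s)}.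
Proof.
move=> [N [mN N0 QN]].
pose A i : set R := if i == s then N else setT.
have mA i : measurable (A i) by rewrite /A; case: ifP.
exists [set x : space | forall i, A i (x 0 i)]; split.
- exact: (@measurable_box R d A mA).
- rewrite [LHS](cube_box mA) (bigD1 s)//= /A eqxx.
  by rewrite [X in (X * _)%E]N0 mul0e.
- move=> x /= nQ i; rewrite /A; case: eqP => [->|//].
  by apply: QN => /= H; apply: nQ.
Qed.

Lemma is_prim_slice s f g : sqint cube f -> sqint cube g -> is_prim s f g ->
  {ae cube, forall x, exists c, [/\
    {ae u01, forall t, f (set_coord s t x) = c + J (fun y => g (set_coord s y x)) t},
    f x = c + J (fun y => g (set_coord s y x)) (x 0 s),
    sqint u01 (fun y => f (set_coord s y x)) &
    sqint u01 (fun y => g (set_coord s y x))]}.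
Proof.
move=> sf sg fg; apply: filterS2 (filterI fg (ae_slice s fg))
  (filterI (ae_sqint_slice s sf) (ae_sqint_slice s sg)) => x [ex exs] [sfx sgx].
exists (kop (@avgk R) s (fun z => f z - kop (@primk R) s g z) x); split => //.
- apply: filterS exs => t; rewrite !kop_slice kopE => /eqP.
  by rewrite subr_eq => /eqP ->.
- by rewrite -ex kopE subrK.
Qed.

(** Being a primitive in $x_{s'}$ is an identity between kernel operators in that variable, and
    these commute with [kop k s]. This is how derivatives in the remaining directions survive. *)
Lemma is_prim_kop k s s' f g : s != s' -> bounded_kernel k ->
  sqint cube f -> sqint cube g -> is_prim s' f g ->
  is_prim s' (kop k s f) (kop k s g).
Proof.
move=> ss' bk sf sg fg; rewrite /is_prim.
have bp := @bounded_primk R; have ba := @bounded_avgk R.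
have sJ := sqint_kop s' bp sg.
have sw := sqintB sf sJ.
have h1 := ae_kopC ss' bk bp sg.
have h2 := ae_kopB s bk sf sJ.
have h3 := ae_eq_kop k s fg.
have h4 := ae_kopC ss' bk ba sw.
have h5 : {ae cube, forall x,
   kop k s (fun z => f z - kop (@primk R) s' g z) x =
   kop k s f x - kop (@primk R) s' (kop k s g) x}.
  by apply: filterS2 h1 h2 => x e1 ->; rewrite e1.
have h6 := ae_eq_kop (@avgk R) s' h5.
apply: filterS2 (filterI h3 h4) (filterI h5 h6) => x [e3 e4] [e5 e6].
exact: (etrans (esym e5) (etrans e3 (etrans e4 e6))).
Qed.

Lemma is_primB s f g f' g' : sqint cube f -> sqint cube g -> sqint cube f' ->
  sqint cube g' -> is_prim s f f' -> is_prim s g g' ->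
  is_prim s (fun x => f x - g x) (fun x => f' x - g' x).
Proof.
move=> sf sg sf' sg' ff' gg'; rewrite /is_prim.
have bp := @bounded_primk R; have ba := @bounded_avgk R.
have sJf := sqint_kop s bp sf'; have sJg := sqint_kop s bp sg'.
have h1 := ae_kopB s bp sf' sg'.
have h2 : {ae cube, forall x,
   f x - g x - kop (@primk R) s (fun x => f' x - g' x) x =
   (f x - kop (@primk R) s f' x) - (g x - kop (@primk R) s g' x)}.
  by apply: filterS h1 => x ->; ring.
have h3 := ae_eq_kop (@avgk R) s h2.
have h4 := ae_kopB s ba (sqintB sf sJf) (sqintB sg sJg).
apply: filterS2 (filterI h2 (filterI h3 h4)) (filterI ff' gg') => x [e2 [e3 e4]] [e5 e6].
rewrite e2 e5 e6.
exact: (esym (etrans e3 e4)).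
Qed.

Definition upd q s n : 'I_d -> nat := fun j => if j == s then n else q j.

Lemma upd_same q s n : upd q s n s = n.
Proof. by rewrite /upd eqxx. Qed.

Lemma upd_neq q s n i : i != s -> upd q s n i = q i.
Proof. by rewrite /upd => /negbTE ->. Qed.

Lemma updK q s n n' : upd (upd q s n) s n' = upd q s n'.
Proof. by apply/funext => i; rewrite /upd; case: eqP. Qed.

Lemma updC q s s' n n' : s != s' -> upd (upd q s n) s' n' = upd (upd q s' n') s n.
Proof.
move=> ss'; apply/funext => i; rewrite /upd.
by case: (i =P s') => [->|//]; rewrite eq_sym (negbTE ss').
Qed.

Lemma upd_id q s : upd q s (q s) = q.
Proof. by apply/funext => i; rewrite /upd; case: eqP => [->|]. Qed.

Definition family := ('I_d -> nat) -> space -> R.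

(* [F q] stands for the weak derivative of order [q] of [F 0]. *)
Definition good r (F : family) : Prop :=
  (forall q, (forall i, q i <= r i)%N -> sqint cube (F q)) /\
  (forall q s, (forall i, q i <= r i)%N -> (q s < r s)%N ->
     is_prim s (F q) (F (upd q s (q s).+1))).

Section one_direction.
Variables (b : bool) (k : nat) (s : 'I_d).
Implicit Type F : family.

Definition rate : nat := if b then k.+1 else k.+2.

(* [Id - Pi_m], of type 1 if [b] and of type 0 otherwise; the latter is expressed
   through the first derivative. *)
Definition err_op m F q : space -> R :=
  if b then fun x => F q x - kop (projk k m) s (F q) x
  else kop (@primk R) s (fun x => F (upd q s 1) x - kop (projk k m) s (F (upd q s 1)) x).

(* [level m] is [Id - Pi_(m-1)], with [Pi_(-1) = 0]. *)
Definition level m F q : space -> R := if m is m'.+1 then err_op m' F q else F q.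

(* Replacing the last increment by the whole remainder makes the telescoping sum exact. *)
Definition incr N m F : family := fun q x =>
  if (m < N)%N then level m F q x - level m.+1 F q x else level m F q x.

Lemma sum_incr N F q x : \sum_(m < N.+1) incr N m F q x = F q x.
Proof.
rewrite big_ord_recr/= {2}/incr ltnn.
rewrite (eq_bigr (fun m : 'I_N => level m F q x - level m.+1 F q x)); last first.
  by move=> m _; rewrite /incr ltn_ord.
have -> : \sum_(m < N) (level m F q x - level m.+1 F q x) = F q x - level N F q x.
  rewrite -(big_mkord xpredT (fun m => level m F q x - level m.+1 F q x)).
  elim: N => [|N IH]; first by rewrite big_nil subrr.
  by rewrite big_nat_recr//= IH addrA subrK.
by rewrite subrK.
Qed.

Variables (r : 'I_d -> nat) (rs : r s = rate).

Let upd_le q n : (forall i, q i <= upd r s 0 i)%N -> (n <= r s)%N ->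
  forall i, (upd q s n i <= r i)%N.
Proof.
move=> qr nr i; rewrite /upd; case: eqP => [->//|/eqP si].
by have := qr i; rewrite upd_neq.
Qed.

Let qs0 q : (forall i, q i <= upd r s 0 i)%N -> q s = 0%N.
Proof. by move=> /(_ s); rewrite upd_same leqn0 => /eqP. Qed.

Let q_le q : (forall i, q i <= upd r s 0 i)%N -> forall i, (q i <= r i)%N.
Proof. by move=> qr; rewrite -(upd_id q s) (qs0 qr); exact: upd_le. Qed.

Let rs1 : (1 <= r s)%N.
Proof. by rewrite rs /rate; case: b. Qed.

Let bpj m := @bounded_projk R k m.
Let bp := @bounded_primk R.

Lemma sqint_err_op F m q : good r F -> (forall i, q i <= upd r s 0 i)%N ->
  sqint cube (err_op m F q).
Proof.
move=> [sF _] qr; rewrite /err_op.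
have s0 := sF q (q_le qr); have s1 := sF (upd q s 1) (upd_le qr rs1).
case: b; first exact: (sqintB s0 (sqint_kop s (bpj m) s0)).
exact: (sqint_kop s bp (sqintB s1 (sqint_kop s (bpj m) s1))).
Qed.

Lemma sqint_level F m q : good r F -> (forall i, q i <= upd r s 0 i)%N ->
  sqint cube (level m F q).
Proof.
move=> gF qr; case: m => [|m] /=; last exact: sqint_err_op.
by apply gF.1; exact: q_le.
Qed.

Lemma is_prim_err_op F m q s' : good r F -> (forall i, q i <= upd r s 0 i)%N ->
  s != s' -> (q s' < r s')%N ->
  is_prim s' (err_op m F q) (err_op m F (upd q s' (q s').+1)).
Proof.
move=> gF qr ss' qs'; have [sF pF] := gF.
have qr' i : (upd q s' (q s').+1 i <= upd r s 0 i)%N.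
  rewrite {1}/upd; case: eqP => [->|_]; last exact: qr.
  by rewrite upd_neq// eq_sym.
have s0 := sF q (q_le qr); have s1 := sF (upd q s 1) (upd_le qr rs1).
have s0' := sF _ (q_le qr'); have s1' := sF (upd _ s 1) (upd_le qr' rs1).
have p0 := pF q s' (q_le qr) qs'.
have p1 := pF (upd q s 1) s' (upd_le qr rs1).
rewrite /err_op; case: b.
  exact: (is_primB s0 (sqint_kop s (bpj m) s0) s0' (sqint_kop s (bpj m) s0') p0
    (is_prim_kop ss' (bpj m) s0 s0' p0)).
have s's : s' != s by rewrite eq_sym.
rewrite (upd_neq _ _ s's) (updC _ _ _ ss') in p1.
have {}p1 := p1 qs'.
have sk := sqint_kop s (bpj m) s1; have sk' := sqint_kop s (bpj m) s1'.
exact: (is_prim_kop ss' bp (sqintB s1 sk) (sqintB s1' sk')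
  (is_primB s1 sk s1' sk' p1 (is_prim_kop ss' (bpj m) s1 s1' p1))).
Qed.

Lemma is_prim_level F m q s' : good r F -> (forall i, q i <= upd r s 0 i)%N ->
  s != s' -> (q s' < r s')%N ->
  is_prim s' (level m F q) (level m F (upd q s' (q s').+1)).
Proof.
move=> gF qr ss' qs'; case: m => [|m] /=; last exact: is_prim_err_op.
by apply gF.2 => //; exact: q_le.
Qed.

(** Only orders with $q_s=0$ remain controlled, the derivatives in $x_s$ being spent on the rate;
    those in the other variables pass through the kernel operators. *)
Lemma good_incr N m F : good r F -> good (upd r s 0) (incr N m F).
Proof.
move=> gF; split=> [q qr|q s' qr].
  rewrite /incr; case: ltnP => _; last exact: sqint_level.
  exact: (sqintB (sqint_level m gF qr) (sqint_level m.+1 gF qr)).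
have [->|s's] := eqVneq s' s; first by rewrite upd_same.
rewrite upd_neq// => qs'.
have qr' i : (upd q s' (q s').+1 i <= upd r s 0 i)%N.
  rewrite {1}/upd; case: eqP => [->|_]; last exact: qr.
  by rewrite upd_neq.
have ss' : s != s' by rewrite eq_sym.
have p m' := is_prim_level m' gF qr ss' qs'.
rewrite /incr; case: ltnP => _; last exact: p.
exact: (is_primB (sqint_level m gF qr) (sqint_level m.+1 gF qr)
  (sqint_level m gF qr') (sqint_level m.+1 gF qr') (p m) (p m.+1)).
Qed.

(** On almost every line the family becomes a chain of iterated primitives, the input of the
    one-dimensional estimates. Countably many exceptional null sets are united. *)
Lemma ae_derivs F q : good r F -> (forall i, q i <= upd r s 0 i)%N ->
  {ae cube, forall x, derivs (r s) (fun j y => F (upd q s j) (set_coord s y x))}.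
Proof.
move=> [sF pF] qr.
have h1 : {ae cube, forall x, forall j, (j <= r s)%N ->
    sqint u01 (fun y => F (upd q s j) (set_coord s y x))}.
  apply: (@ae_foralln _ _ _ cube) => j.
  have [jr|jr] := leqP j (r s); last by apply: aeW.
  by apply: filterS (ae_sqint_slice s (sF _ (upd_le qr jr))) => x h _.
have h2 : {ae cube, forall x, forall j, (j < r s)%N ->
    exists c, {ae u01, forall t, F (upd q s j) (set_coord s t x) =
       c + J (fun y => F (upd q s j.+1) (set_coord s y x)) t}}.
  apply: (@ae_foralln _ _ _ cube) => j.
  have [jr|jr] := ltnP j (r s); last by apply: aeW.
  have sj := sF _ (upd_le qr (ltnW jr)); have sj1 := sF _ (upd_le qr jr).
  have := pF (upd q s j) s (upd_le qr (ltnW jr)).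
  rewrite upd_same updK => /(_ jr) /(is_prim_slice sj sj1).
  by apply: filterS => x [c [h _ _ _]] _; exists c.
by apply: filterS2 h1 h2 => x a1 a2; split.
Qed.

(** The one-dimensional estimate on almost every line, integrated over the cube; [B] enters through
    the derivative of order [r s] in $x_s$. *)
Lemma sqI_err_op F m q (B : R) : good r F -> (forall i, q i <= upd r s 0 i)%N ->
  (forall q, (forall i, q i <= r i)%N -> sqI cube (F q) <= (B ^+ 2)%:E)%E ->
  (sqI cube (err_op m F q) <= (((2 ^- m) ^+ rate * B) ^+ 2)%:E)%E.
Proof.
move=> gF qr FB; have sE := sqint_err_op m gF qr.
have sr := gF.1 _ (upd_le qr (leqnn _)).
set c : R := ((2 ^- m) ^+ rate) ^+ 2; have c0 : 0 <= c by exact: sqr_ge0.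
apply: (@le_trans _ _ (c%:E * sqI cube (F (upd q s (r s))))%E); last first.
  rewrite [X in (_ <= X%:E)%E]exprMn -/c [leRHS]EFinM.
  apply: lee_wpmul2l; first by rewrite lee_fin.
  by apply: FB; exact: upd_le.
apply: (sqint_cube_slice (s := s)) => //; first by case: sE.
have s0 := gF.1 _ (q_le qr); have s1 := gF.1 _ (upd_le qr rs1).
apply: filterS (ae_derivs gF qr) => x dv.
set v := (fun j y => F (upd q s j) (set_coord s y x)) in dv *.
have vr : sqint u01 (v (r s)) by apply dv.1.
rewrite (sqI_fin vr) -EFinM.
have v0E y : v 0%N y = F q (set_coord s y x) by rewrite /v -(qs0 qr) upd_id.
have v0E' : (fun y => F q (set_coord s y x)) = v 0%N by apply/funext => y; rewrite v0E.
have E : (fun y => err_op m F q (set_coord s y x)) =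
   if b then (fun y => v 0%N y - kop1 (projk k m) (v 0%N) y)
   else (J (fun y => v 1%N y - kop1 (projk k m) (v 1%N) y)).
  apply/funext => y; rewrite /err_op; case: b; first by rewrite kop_slice v0E v0E'.
  rewrite kop_slice; congr (kop1 _ _ y); apply/funext => y'.
  by rewrite kop_slice.
rewrite E.
have sE' : sqint u01 (if b then (fun y => v 0%N y - kop1 (projk k m) (v 0%N) y)
   else (J (fun y => v 1%N y - kop1 (projk k m) (v 1%N) y))).
  have v0 : sqint u01 (v 0%N) by apply dv.1.
  have v1 : sqint u01 (v 1%N) by apply dv.1.
  case: b; first exact: (sqintB v0 (sqint_kop1 (bpj m) v0)).
  exact: (sqint_kop1 bp (sqintB v1 (sqint_kop1 (bpj m) v1))).
rewrite (sqI_fin sE') lee_fin /c.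
move: dv; rewrite rs /rate; case: b => dv; first exact: proj_est dv.
exact: prim_proj_est dv.
Qed.

(** [level m.+1] is an error on mesh $2^{-m}$, and this shift of the index costs $2^{rate}$, which
    also covers [level 0]. The difference of two consecutive levels costs another factor 2. *)
Lemma sqI_incr N F m q (B : R) : 0 <= B -> good r F -> (forall i, q i <= upd r s 0 i)%N ->
  (forall q, (forall i, q i <= r i)%N -> sqI cube (F q) <= (B ^+ 2)%:E)%E ->
  (sqI cube (incr N m F q) <= ((2 ^+ rate.+1 * 2 ^- (rate * m) * B) ^+ 2)%:E)%E.
Proof.
move=> B0 gF qr FB.
pose e m : R := 2 ^+ rate * 2 ^- (rate * m) * B.
have e0 j : 0 <= e j by rewrite !mulr_ge0// invr_ge0 exprn_ge0.
have le j : (sqI cube (level j F q) <= (e j ^+ 2)%:E)%E.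
  case: j => [|j] /=.
    apply: le_trans (FB _ (q_le qr)) _; rewrite lee_fin lerXn2r ?nnegrE//.
    by rewrite /e muln0 expr0 invr1 mulr1 ler_peMl// exprn_ege1// ler1n.
  apply: le_trans (sqI_err_op j gF qr FB) _; rewrite lee_fin.
  rewrite /e mulnS exprD invfM mulrA mulfV ?expf_neq0// mul1r.
  by rewrite exprVn -exprM mulnC.
have ej j : e j.+1 <= e j.
  rewrite /e ler_wpM2r// ler_wpM2l ?exprn_ge0//.
  rewrite lef_pV2 ?posrE ?exprn_gt0//; apply: ler_weXn2l; first by rewrite ler1n.
  by rewrite leq_mul2l leqnSn orbT.
have -> : 2 ^+ rate.+1 * 2 ^- (rate * m) * B = 2 * e m.
  by rewrite /e exprS !mulrA.
have sl j := sqint_level j gF qr.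
rewrite /incr; case: ltnP => _; last first.
  apply: le_trans (le m) _; rewrite lee_fin lerXn2r ?nnegrE//.
    by rewrite mulr_ge0.
  by rewrite ler_peMl// ler1n.
have sB := sqintB (sl m) (sl m.+1).
have lm := le m; have lm1 := le m.+1.
rewrite (sqI_fin (sl m)) lee_fin in lm; rewrite (sqI_fin (sl m.+1)) lee_fin in lm1.
rewrite (sqI_fin sB) lee_fin.
have i1 := sqint_sqr (sl m); have i2 := sqint_sqr (sl m.+1).
apply: (@le_trans _ _ (\int[cube]_x (2 * (level m F q x ^+ 2 + level m.+1 F q x ^+ 2)))).
  apply: le_Rintegral => //; first exact: sqint_sqr.
    exact: (integrableZl measurableT 2 (integrableD measurableT i1 i2)).
  by move=> x _; have := sqr_ge0 (level m F q x + level m.+1 F q x); nra.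
rewrite RintegralZl//; last exact: (integrableD measurableT i1 i2).
rewrite RintegralD//.
have : e m.+1 ^+ 2 <= e m ^+ 2 by rewrite lerXn2r ?nnegrE.
have -> : (2 * e m) ^+ 2 = 4 * e m ^+ 2 by move: (e m) => y; ring.
move: lm lm1; set X := \int[_]_x _; set Y := \int[_]_x _.
by move=> h1 h2 h3; lra.
Qed.

(** Below the top level an increment is the actual $\Pi_m-\Pi_{m-1}$, as the identities cancel
    between two levels. The interpolants see [u] only up to null sets on almost every line, so a.e.
    equality is enough. *)
Lemma acting_in_Delta N F m q u : good r F -> (forall i, q i <= upd r s 0 i)%N ->
  {ae cube, forall x, u x = F q x} -> (m < N)%N ->
  {ae cube, forall x, acting_in s (Delta b k m) u x = incr N m F q x}.
Proof.
move=> gF qr uF mN.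
have s0 := gF.1 _ (q_le qr); have s1 := gF.1 _ (upd_le qr rs1).
have p01 : is_prim s (F q) (F (upd q s 1)).
  have := gF.2 q s (q_le qr); rewrite (qs0 qr); apply; exact: rs1.
have key j : {ae cube, forall x,
    Pi_op b k j (fun t => u (set_coord s t x)) (x 0 s) = F q x - err_op j F q x}.
  rewrite /Pi_op /err_op; case: b.
    apply: filterS2 (filterI (ae_slice s uF) (ae_sqint_slice s s0))
      (ae_coord s (@ae_open_cell R j)) => x [ux sx] [i ij xi].
    by rewrite (Pi1E k sx ux ij xi) subKr kopE.
  apply: filterS2 (filterI (ae_slice s uF) (is_prim_slice s0 s1 p01))
    (ae_coord s (@ae_u01_in R)) => x [ux [c [h1 h2 sfx sgx]]] x01.
  have vE : {ae u01, forall y, u (set_coord s y x) =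
      c + J (fun y => F (upd q s 1) (set_coord s y x)) y}.
    by apply: filterS2 ux h1 => y ->.
  have x01' : 0 <= x 0 s <= 1 by case/andP : x01 => ? ?; rewrite !ltW.
  have kE : kop (@primk R) s
      (fun z => F (upd q s 1) z - kop (projk k j) s (F (upd q s 1)) z) x =
      J (fun y => F (upd q s 1) (set_coord s y x) -
        kop1 (projk k j) (fun y => F (upd q s 1) (set_coord s y x)) y) (x 0 s).
    have sl y : F (upd q s 1) (set_coord s y x) -
          kop (projk k j) s (F (upd q s 1)) (set_coord s y x) =
        F (upd q s 1) (set_coord s y x) -
          kop1 (projk k j) (fun y => F (upd q s 1) (set_coord s y x)) y.
      by rewrite kop_slice.
    exact: (congr1 (fun w : R -> R => kop1 (@primk R) w (x 0 s)) (funext sl)).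
  apply: (etrans (Pi0E k j sgx vE x01')).
  exact: (congr2 (fun y z => y - z) (esym h2) (esym kE)).
rewrite /incr mN; case: m mN => [|m] mN /=.
  by apply: filterS (key 0%N) => x; rewrite /acting_in /Delta => ->.
have aux (y z t : R) : y - t - (y - z) = z - t by ring.
apply: filterS2 (key m) (key m.+1) => x e1 e2; rewrite /acting_in /Delta e1 e2.
exact: aux.
Qed.

End one_direction.

End derivative_families.

(** The triangle inequality in L^2: Cauchy-Schwarz bounds the cross term by $ab$. *)
Lemma sqI_minkowski {R : realType} {disp} {T : measurableType disp}
    (mu : {finite_measure set T -> \bar R}) (f g : T -> R) (a b : R) :
  0 <= a -> 0 <= b -> sqint mu f -> sqint mu g ->
  (sqI mu f <= (a ^+ 2)%:E)%E -> (sqI mu g <= (b ^+ 2)%:E)%E ->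
  (sqI mu (fun x => (f x + g x)%R) <= ((a + b) ^+ 2)%:E)%E.
Proof.
move=> a0 b0 sf sg; rewrite (sqI_fin sf) (sqI_fin sg) (sqI_fin (sqintD sf sg)) !lee_fin.
move=> fa gb.
have if2 := sqint_sqr sf; have ig2 := sqint_sqr sg; have ifg := sqintM sf sg.
have := cauchy_schwarz_int sf sg.
have -> : \int[mu]_x ((f x + g x) ^+ 2) =
    \int[mu]_x (f x ^+ 2) + 2 * \int[mu]_x (f x * g x) + \int[mu]_x (g x ^+ 2).
  rewrite -RintegralZl// -RintegralD//; last exact: (integrableZl measurableT 2 ifg).
  rewrite -RintegralD//; last first.
    exact: (integrableD measurableT if2 (integrableZl measurableT 2 ifg)).
  by apply: eq_Rintegral => x _; ring.
move: fa gb; set X := \int[_]_x (f x ^+ 2); set Y := \int[_]_x _; set Z := \int[_]_x _.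
move=> fa gb h.
have X0 : 0 <= X by apply: Rintegral_ge0 => x _; exact: sqr_ge0.
have Y0 : 0 <= Y by apply: Rintegral_ge0 => x _; exact: sqr_ge0.
have Zab : Z <= a * b.
  have [//|abZ] := lerP Z (a * b).
  have ab0 : 0 <= a * b by exact: mulr_ge0.
  suff : Z ^+ 2 <= (a * b) ^+ 2 by nra.
  by rewrite exprMn; apply: le_trans h _; exact: ler_pM.
have -> : (a + b) ^+ 2 = a ^+ 2 + 2 * (a * b) + b ^+ 2 by ring.
by lra.
Qed.

Lemma sqI_sum {R : realType} {disp} {T : measurableType disp}
    (mu : {finite_measure set T -> \bar R}) I (s : seq I) (P : pred I)
    (F : I -> T -> R) (w : I -> R) :
  (forall i, P i -> 0 <= w i) -> (forall i, P i -> sqint mu (F i)) ->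
  (forall i, P i -> sqI mu (F i) <= (w i ^+ 2)%:E)%E ->
  (sqI mu (fun x => (\sum_(i <- s | P i) F i x)%R) <=
    ((\sum_(i <- s | P i) w i) ^+ 2)%:E)%E.
Proof.
move=> w0 sF Fw; elim: s => [|i s IH].
  rewrite big_nil expr0n/=; under [X in sqI _ X]eq_fun do rewrite big_nil.
  rewrite /sqI; under eq_integral do rewrite expr0n/=.
  by rewrite integral0.
have [Pi|nPi] := boolP (P i); last first.
  by under [X in sqI _ X]eq_fun do rewrite big_cons (negbTE nPi);
    rewrite big_cons (negbTE nPi).
under [X in sqI _ X]eq_fun do rewrite big_cons Pi; rewrite big_cons Pi.
exact: (sqI_minkowski (w0 _ Pi) (sumr_ge0 _ w0) (sF _ Pi) (sqint_sum s sF) (Fw _ Pi) IH).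
Qed.

(** * Tensorization and summation *)

Section finite_support_sums.
Variables (V : nmodType) (d N : nat).
Implicit Types (m : {ffun 'I_d -> 'I_N.+1}) (L : seq 'I_d).

Definition set_entry m s j : {ffun 'I_d -> 'I_N.+1} :=
  [ffun i => if i == s then j else m i].

(** Freezing the entries outside [L] at zero lets sums over all multi-indices be built by induction
    on a list of directions. *)
Definition supported L m := [forall i, (i \in L) || (m i == ord0)].

Lemma supported_off L m s : supported L m -> s \notin L -> m s = ord0.
Proof. by move=> /forallP/(_ s); case: (s \in L) => // /eqP. Qed.

Lemma sum_supported0 (f : {ffun 'I_d -> 'I_N.+1} -> V) :
  \sum_(m | supported [::] m) f m = f [ffun=> ord0].
Proof.
rewrite (big_pred1 [ffun=> ord0])// => m; apply/forallP/eqP => /=.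
  by move=> m0; apply/ffunP => i; rewrite ffunE; apply/eqP; exact: m0.
by move=> -> i; rewrite ffunE.
Qed.

Lemma sum_supported_cons L s (f : {ffun 'I_d -> 'I_N.+1} -> V) : s \notin L ->
  \sum_(m | supported (s :: L) m) f m =
  \sum_(m | supported L m) \sum_j f (set_entry m s j).
Proof.
move=> sL; rewrite (reindex_onto (fun p => set_entry p.1 s p.2)
  (fun m => (set_entry m s ord0, m s))) /=; last first.
  by move=> m _; apply/ffunP => i; rewrite !ffunE; case: eqP => [->|].
rewrite (pair_big (supported L) xpredT (fun m j => f (set_entry m s j)))/=.
apply: eq_bigl => -[m j] /=; rewrite andbT.
apply/andP/idP => [[/forallP h /eqP[e _]]|h].
  apply/forallP => i; have := h i; rewrite inE !ffunE; case: eqP => [si _|//].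
  by rewrite -e ffunE si eqxx eqxx orbT.
have ms := supported_off h sL; split.
  apply/forallP => i; rewrite inE ffunE; case: eqP => [//|_ /=].
  exact: (forallP h i).
apply/eqP; rewrite ffunE eqxx; congr pair.
by apply/ffunP => i; rewrite !ffunE; case: eqP => [->|].
Qed.

Lemma sum_supportedT L (f : {ffun 'I_d -> 'I_N.+1} -> V) : (forall i, i \in L) ->
  \sum_(m | supported L m) f m = \sum_m f m.
Proof.
by move=> aL; apply: eq_bigl => m; apply/forallP => i; rewrite aL.
Qed.

End finite_support_sums.

Section iterated_increments.
Context {R : realType} {d : nat}.
Local Notation cube := (@cube R d).
Variables (b : 'I_d -> bool) (k N : nat) (r : 'I_d -> nat).
Hypothesis r_rate : forall s, r s = rate (b s) k.
Implicit Types (L : seq 'I_d) (m q : 'I_d -> nat) (F : @family R d).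

Definition incrs L m F : @family R d :=
  foldr (fun s G => incr (b s) k s N (m s) G) F L.

(* Each operator in the direction [s] consumes all the derivatives in [x_s]. *)
Definition rank_off L : 'I_d -> nat := fun i => if i \in L then 0%N else r i.

(** The factor that [sqI_incr] charges to direction [s]. *)
Definition weight (m : 'I_d -> nat) s : R := 2 ^+ (r s).+1 * 2 ^- (r s * m s).

Lemma weight_gt0 m s : 0 < weight m s.
Proof. by rewrite mulr_gt0 ?invr_gt0 ?exprn_gt0. Qed.

Lemma rank_off_cons s L : s \notin L ->
  rank_off (s :: L) = upd (rank_off L) s 0 /\ rank_off L s = rate (b s) k.
Proof.
move=> sL; split; last by rewrite /rank_off (negbTE sL).
by apply/funext => i; rewrite /rank_off /upd inE; case: (i =P s).
Qed.

Lemma good_incrs L m F : uniq L -> good r F -> good (rank_off L) (incrs L m F).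
Proof.
elim: L => [_ //|s L IH] /= /andP[sL uL] gF.
have [-> rs] := rank_off_cons sL.
exact: (good_incr rs N (m s) (IH uL gF)).
Qed.

Lemma sqI_incrs L m F q (B : R) : uniq L -> 0 <= B -> good r F ->
  (forall q, (forall i, q i <= r i)%N -> sqI cube (F q) <= (B ^+ 2)%:E)%E ->
  (forall i, q i <= rank_off L i)%N ->
  (sqI cube (incrs L m F q) <= ((\prod_(s <- L) weight m s * B) ^+ 2)%:E)%E.
Proof.
move=> uL B0 gF FB; elim: L uL q => [_ q qr|s L IH /= /andP[sL uL] q].
  by rewrite big_nil mul1r; exact: FB.
have [-> rs] := rank_off_cons sL => qr.
have B'0 : 0 <= \prod_(t <- L) weight m t * B.
  by rewrite mulr_ge0// prodr_ge0// => t _; exact/ltW/weight_gt0.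
have h := sqI_incr rs N (m s) B'0 (good_incrs m uL gF) qr (IH uL).
rewrite big_cons -mulrA {1}/weight r_rate.
exact: h.
Qed.

Lemma acting_incrs L m F u : uniq L -> good r F ->
  {ae cube, forall x, u x = F (fun=> 0%N) x} -> (forall s, s \in L -> m s < N)%N ->
  {ae cube, forall x,
    foldr (fun s => acting_in s (Delta (b s) k (m s))) u L x =
    incrs L m F (fun=> 0%N) x}.
Proof.
move=> uL gF uF; elim: L uL => [_ _ //|s L IH /= /andP[sL uL] mN].
have [_ rs] := rank_off_cons sL.
have q0 i : (0 <= upd (rank_off L) s 0 i)%N by [].
apply: (acting_in_Delta rs (good_incrs m uL gF) q0 _ (mN s (mem_head _ _))).
by apply: IH => // t tL; apply: mN; rewrite inE tL orbT.
Qed.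

Lemma eq_incrs L m m' F : {in L, m =1 m'} -> incrs L m F = incrs L m' F.
Proof.
elim: L => [//|s L IH] mm' /=; rewrite (mm' s (mem_head _ _)) IH// => t tL.
by apply: mm'; rewrite inE tL orbT.
Qed.

(** The new direction telescopes by [sum_incr], since the increments in the directions of [L] do not
    see the entry at [s]. *)
Lemma sum_incrs_supported L F q x : uniq L ->
  \sum_(m : {ffun 'I_d -> 'I_N.+1} | supported L m)
    incrs L (fun i => m i) F q x = F q x.
Proof.
elim: L => [_|s L IH /= /andP[sL uL]]; first by rewrite sum_supported0.
rewrite sum_supported_cons// -[RHS](IH uL); apply: eq_bigr => m _.
rewrite -[RHS](sum_incr (b s) k s N); apply: eq_bigr => j _.
rewrite ffunE eqxx (@eq_incrs _ _ (fun i => m i))// => i iL.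
by rewrite ffunE; case: eqP iL => // ->; rewrite (negbTE sL).
Qed.

Lemma sum_incrs L F q x : uniq L -> (forall i, i \in L) ->
  \sum_(m : {ffun 'I_d -> 'I_N.+1}) incrs L (fun i => m i) F q x = F q x.
Proof.
move=> uL aL; rewrite -(sum_incrs_supported F q x uL); apply: eq_bigl => m.
by apply/esym/forallP => i; rewrite aL.
Qed.

End iterated_increments.

(** * Geometric sums over the complement of the sparse index set *)

Section weight_sums.
Context {R : realType} {d : nat}.
Implicit Types (n t N M : nat).
Local Notation h j := (2 ^- j : R).

Let h_gt0 j : 0 < h j.
Proof. by rewrite invr_gt0 exprn_gt0. Qed.

Let hS j : h j = 2 * h j.+1.
Proof. by rewrite exprS invfM mulrA mulfV// mul1r. Qed.

Let hD i j : h (i + j) = h i * h j.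
Proof. by rewrite exprD invfM. Qed.

Let h_le i j : (i <= j)%N -> h j <= h i.
Proof.
by move=> ij; rewrite lef_pV2 ?posrE ?exprn_gt0//; apply: ler_weXn2l => //; rewrite ler1n.
Qed.

Let sub_eq0 i j : (i <= j)%N -> (i - j = 0)%N.
Proof. by rewrite -subn_eq0 => /eqP. Qed.

(** The subtractions are truncated: for $t\le n$ the bound is 2, beyond it is a geometric tail. The
    stronger claim adds twice the next term, which makes the induction on [M] close. *)
Lemma geometric_above t n M : \sum_(j < M | (n <= t + j)%N) h (t + j - n) <= 2 * h (t - n).
Proof.
suff : \sum_(j < M | (n <= t + j)%N) h (t + j - n) + 2 * h (t + M - n) <= 2 * h (t - n).
  by have := h_gt0 (t + M - n); lra.
elim: M => [|M IH]; first by rewrite big_ord0 add0r addn0.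
rewrite big_mkcond big_ord_recr/= -big_mkcond addnS.
case: ifPn => [nt|]; last first.
  rewrite -ltnNge => tn; rewrite addr0.
  by move: IH; rewrite (sub_eq0 (ltnW tn)) (sub_eq0 tn).
rewrite subSn//; move: IH (hS (t + M - n)).
by move: (h (t + M - n)) (h (t + M - n).+1) => y z; lra.
Qed.

(** The terms equal 1 as long as $t+j\le n$ and decay geometrically afterwards; this is the source
    of the powers of $n+1$. *)
Lemma geometric_trunc t n M : \sum_(j < M) h (t + j - n) <= (n + 2)%:R * h (t - n).
Proof.
suff : \sum_(j < M) h (t + j - n) + 2 * h (t + M - n) <= (minn M n + 2)%:R * h (t - n).
  move=> le1; have := h_gt0 (t + M - n).
  have : (minn M n + 2)%:R * h (t - n) <= (n + 2)%:R * h (t - n).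
    by rewrite ler_pM2r// ler_nat leq_add2r geq_minr.
  by lra.
elim: M => [|M IH]; first by rewrite big_ord0 add0r addn0 min0n.
rewrite big_ord_recr/= addnS; have [nt|tn] := leqP n (t + M).
  rewrite subSn//; apply: (@le_trans _ _ ((minn M n + 2)%:R * h (t - n))).
    move: IH (hS (t + M - n)).
    by move: (h (t + M - n)) (h (t + M - n).+1) => y z; lra.
  rewrite ler_pM2r// ler_nat leq_add2r leq_min geq_minr andbT.
  by rewrite (leq_trans (geq_minl _ _)).
have Mn : (M < n)%N by rewrite (leq_ltn_trans _ tn)// leq_addl.
have tn' : (t <= n)%N by rewrite (leq_trans _ (ltnW tn))// leq_addr.
move: IH; rewrite (sub_eq0 (ltnW tn)) (sub_eq0 tn) (sub_eq0 tn').
rewrite (minn_idPl (ltnW Mn)) (minn_idPl Mn) expr0 invr1 !natrD.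
by rewrite -[M.+1]addn1 natrD; lra.
Qed.

(** In a direction of faster decay the surplus $2^{-j}$ is summable by itself, so no factor growing
    with [n] arises. *)
Lemma geometric_damped t n M : \sum_(j < M) h (t + j - n) * h j <= 2 * h (t - n).
Proof.
apply: (@le_trans _ _ (h (t - n) * \sum_(j < M) h j)).
  rewrite mulr_sumr; apply: ler_sum => j _; rewrite ler_pM2r//.
  by apply: h_le; rewrite leq_sub2r// leq_addr.
rewrite mulrC ler_pM2r//; have := geometric_above 0 0 M.
by rewrite expr0 invr1 mulr1; under eq_bigr do rewrite add0n subn0.
Qed.

Section counting.
Variables (A : pred 'I_d) (n N : nat).
Implicit Types (m : {ffun 'I_d -> 'I_N.+1}) (L : seq 'I_d).

(* [A] is the set of directions with the slowest decay. *)
Let S m := (\sum_i m i)%N.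
Let U m := (\sum_(i | ~~ A i) m i)%N.

Let S_set m s j : m s = ord0 -> S (set_entry m s j) = (S m + j)%N.
Proof.
move=> ms; rewrite /S (bigD1 s)// [in RHS](bigD1 s)//= ms ffunE eqxx add0n addnC.
by congr addn; apply: eq_bigr => i /negbTE si; rewrite ffunE si.
Qed.

Let U_set m s j : m s = ord0 ->
  U (set_entry m s j) = (U m + (if A s then 0 else j))%N.
Proof.
move=> ms; rewrite /U; case: ifPn => As.
  rewrite addn0; apply: eq_bigr => i Ai; rewrite ffunE; case: eqP Ai => // ->.
  by rewrite As.
rewrite (bigD1 s)// [in RHS](bigD1 s)//= ms ffunE eqxx add0n addnC.
by congr addn; apply: eq_bigr => i /andP[_ /negbTE si]; rewrite ffunE si.
Qed.

(** A direction of slowest decay costs $2(n+1)\ge n+2$, any other one costs 2. *)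
Let c s : R := 2 * (if A s then n.+1%:R else 1).

Let c_ge0 s : 0 <= c s.
Proof. by rewrite mulr_ge0//; case: ifP. Qed.

(** The directions of [L] are summed one by one. Totals below [n] are included; there the truncated
    subtraction makes the first factor 1. *)
Lemma sum_below L : uniq L ->
  \sum_(m | supported L m) h (S m - n) * h (U m) <= \prod_(s <- L) c s.
Proof.
elim: L => [_|s L IH /= /andP[sL uL]].
  rewrite sum_supported0 big_nil /S /U !big1 => [|i _|i _]; rewrite ?ffunE//.
  by rewrite sub0n !expr0 invr1 mulr1.
rewrite sum_supported_cons// big_cons.
apply: (@le_trans _ _ (\sum_(m | supported L m) c s * (h (S m - n) * h (U m)))).
  apply: ler_sum => m mL; have ms := supported_off mL sL.
  under eq_bigr do rewrite S_set// U_set//.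
  rewrite /c; case: ifP => _.
    under eq_bigr do rewrite addn0; rewrite -mulr_suml mulrA ler_pM2r//.
    apply: le_trans (geometric_trunc _ _ _) _; rewrite ler_pM2r//.
    by rewrite -[n.+1]addn1 !natrD; have := ler0n R n; lra.
  under eq_bigr do rewrite hD mulrCA; rewrite -mulr_sumr mulr1 mulrA [leRHS]mulrC.
  by rewrite ler_pM2l//; exact: geometric_damped.
by rewrite -mulr_sumr ler_wpM2l//; exact: IH.
Qed.

(** One slowest direction [i0] is reserved for the constraint on the total, which bounds its sum by
    the geometric factor 2 instead of $2(n+1)$ and so saves one power of $n+1$. *)
Lemma sum_above i0 : A i0 ->
  \sum_(m | (n <= S m)%N) h (S m - n) * h (U m) <=
  2 ^+ d * n.+1%:R ^+ (#|A| - 1).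
Proof.
move=> Ai0; pose L := enum (predC1 i0).
have i0L : i0 \notin L by rewrite mem_enum inE eqxx.
have uL : uniq L by exact: enum_uniq.
have aL i : i \in i0 :: L by rewrite inE mem_enum inE orbN.
rewrite big_mkcond -(sum_supportedT _ aL) sum_supported_cons//.
apply: (@le_trans _ _ (\sum_(m | supported L m) 2 * (h (S m - n) * h (U m)))).
  apply: ler_sum => m mL; have ms := supported_off mL i0L.
  under eq_bigr do rewrite S_set// U_set// Ai0 addn0.
  rewrite -big_mkcond/= -mulr_suml mulrA ler_pM2r//; exact: geometric_above.
rewrite -mulr_sumr; apply: (@le_trans _ _ (2 * \prod_(s <- L) c s)).
  by rewrite ler_wpM2l//; exact: sum_below.
rewrite /L big_enum/= /c big_split/= prodr_const cardC1 card_ord.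
rewrite mulrA -exprS prednK ?(leq_ltn_trans _ (ltn_ord i0))//.
rewrite ler_wpM2l ?exprn_ge0// -big_mkcondr/= prodr_const.
rewrite (cardD1 i0 A) [i0 \in A]Ai0 add1n subn1/= ler_weXn2l ?ler1n//.
Qed.

End counting.

Lemma weight_sum k (I : {set 'I_d}) n N : (0 < d)%N ->
  \sum_(m : {ffun 'I_d -> 'I_N.+1} | (n + d <= \sum_i m i)%N)
    \prod_s weight (mixed_order k I) (fun i => m i) s <=
  (2 ^+ (k.+3 * d) * 2 ^+ d) * error_rate R #|I| k d n.
Proof.
(* For $l=0$ every direction has rate $k+2$, so all are slowest; otherwise the slowest are those of
   [I]. This is the case distinction in [error_rate]. *)
move=> d0; pose A : pred 'I_d := fun s => (s \in I) || (#|I| == 0)%N.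
pose a := if (#|I| == 0)%N then k.+2 else k.+1.
have a0 : (0 < a)%N by rewrite /a; case: ifP.
have [i0 Ai0] : exists i0, A i0.
  rewrite /A; have [I0|] := eqVneq #|I| 0%N; last first.
    by rewrite -lt0n => /card_gt0P[i iI]; exists i; rewrite iI.
  by exists (Ordinal d0); rewrite orbT.
have rE s : mixed_order k I s = (a + (~~ A s))%N.
  rewrite /mixed_order /a /A; case: ifPn => [sI|sI] /=; last first.
    by case: ifP => _; rewrite ?addn0 ?addn1.
  by rewrite (negbTE (_ : #|I| != 0%N)) ?addn0// -lt0n; apply/card_gt0P; exists s.
have cardA : error_rate R #|I| k d n = h (a * n) * n.+1%:R ^+ (#|A| - 1).
  rewrite /error_rate /a /A; case E : #|I| => [|l] /=.
    congr (_ * _ ^+ (_ - 1)); rewrite -[LHS]card_ord; apply: eq_card => s.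
    by rewrite [RHS]unfold_in/= orbT.
  congr (_ * _ ^+ _); rewrite -[l in LHS](subn1 l.+1) -E.
  by congr subn; apply: eq_card => s; rewrite [RHS]unfold_in/= E orbF.
(* The range is enlarged to $|m|\ge n$, and $2^{(k+3)d}$ bounds the product of the factors
   $2^{r_s+1}$. *)
apply: (@le_trans _ _ (\sum_(m : {ffun 'I_d -> 'I_N.+1} | (n <= \sum_i m i)%N)
   2 ^+ (k.+3 * d) * h (a * n) *
   (h ((\sum_i m i) - n) * h (\sum_(i | ~~ A i) m i)))); last first.
  by rewrite -mulr_sumr cardA [leRHS]mulrACA ler_wpM2l//; exact: sum_above Ai0.
rewrite big_mkcond [leRHS]big_mkcond; apply: ler_sum => m _.
have term_ge0 : 0 <= 2 ^+ (k.+3 * d) * h (a * n) *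
   (h ((\sum_i m i) - n) * h (\sum_(i | ~~ A i) m i)).
  by rewrite !mulr_ge0 ?exprn_ge0// ltW.
case: ifPn => [nd|_]; last by case: ifP.
have nS : (n <= \sum_i m i)%N by rewrite (leq_trans _ nd)// leq_addr.
rewrite nS /weight big_split/= -mulrA.
apply: ler_pM.
- by apply: prodr_ge0 => s _; rewrite exprn_ge0.
- by apply: prodr_ge0 => s _; rewrite ltW.
- rewrite exprM -[X in _ ^+ X](card_ord d) -prodr_const; apply: ler_prod => s _.
  rewrite exprn_ge0//= ler_weXn2l ?ler1n// ltnS /mixed_order.
  by case: ifP.
rewrite prodfV -expr_sum -!hD; apply: h_le.
have -> : (\sum_i mixed_order k I i * m i = a * \sum_i m i + \sum_(i | ~~ A i) m i)%N.
  rewrite big_distrr/= [X in (_ + X)%N]big_mkcond -big_split/=.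
  by apply: eq_bigr => i _; rewrite rE mulnDl; case: (A i); rewrite ?mul0n ?mul1n.
(* $a|m|\ge an+(|m|-n)$: for the excess over [n] only decay of rate one is kept, which the geometric
   sums require. *)
rewrite addnA leq_add2r -{2}(subnKC nS) mulnDr leq_add2l.
by rewrite leq_pmull.
Qed.

End weight_sums.

(** * From the weak derivatives of one coefficient to its error *)

Section coefficient.
Context {R : realType} {d : nat}.
Local Notation space := 'rV[R]_d.
Local Notation cube := (@cube R d).
Local Notation leb := (@lebesgue_rV R d).
Local Notation Om := (@Omega R d).
Implicit Types (q : 'I_d -> nat) (v g : space -> R) (s : 'I_d) (I : {set 'I_d}).

Lemma weak_partial_tensor q v g v' g' (phi : 'I_d -> R -> R) :
  {ae cube, forall x, v x = v' x} -> {ae cube, forall x, g x = g' x} ->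
  weak_partial q v g -> (forall i, test1 (phi i)) ->
  \int[cube]_x (v' x * tensor (fun j => derive1n (q j) (phi j)) x) =
  (-1) ^+ (\sum_i q i)%N * \int[cube]_x (g' x * tensor phi x).
Proof.
move=> vv' gg' wk tphi; have := wk _ (test_fun_tensor tphi).
rewrite multi_partial_tensor; last by move=> i; apply (tphi i).1.
have rep f f' (h : space -> R) : {ae cube, forall x, f x = f' x} ->
    \int[leb]_(x in Om) (f x * h x) = \int[cube]_x (f' x * h x).
  move=> ff'; congr fine; rewrite -integral_cube; apply: ae_eq_integralW => //.
  by apply: filterS ff' => x -> _.
by rewrite (rep _ _ _ vv') (rep _ _ _ gg').
Qed.

Lemma test1_derive1 (f : R -> R) : test1 f -> test1 (derive1 f).
Proof.
move=> [sf [a [b [a0 b1 fab]]]]; split; first exact: smooth_derive1.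
exists a, b; split => // t; rewrite negb_and -!ltNge => nt.
have f0 : \forall y \near t, cst 0 y = f y.
  by case/orP: nt => [/lt_nbhsl|/lt_nbhsr]; apply: filterS => y yab;
    rewrite fab// negb_and -!ltNge yab ?orbT.
apply: derive1_is_derive; apply: near_eq_is_derive f0 _.
Qed.

Section family.
Variables (k : nat) (I : {set 'I_d}) (v : space -> R).
Hypothesis Xv : Xspace k I v.
Local Notation r := (mixed_order k I).

(** [wpartial] is an arbitrary element of its class, whereas slicing requires a Borel function. *)
Definition deriv_rep q : space -> R :=
  xget (fun=> 0) [set g | sqint cube g /\ {ae cube, forall x, wpartial q v x = g x}].

Lemma wpartialP q : (forall s, q s <= r s)%N ->
  L2 leb Om (wpartial q v) /\ weak_partial q v (wpartial q v).
Proof.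
move=> qr; have [g Lg wg] := Xv.2 q qr.
have /xgetPex : exists g, [set g | L2 leb Omega g /\ weak_partial q v g] g by exists g.
by move=> /(_ (fun=> 0)).
Qed.

Lemma deriv_repP q : (forall s, q s <= r s)%N ->
  sqint cube (deriv_rep q) /\ {ae cube, forall x, wpartial q v x = deriv_rep q x}.
Proof.
move=> qr; have [g sg wg] := L2_sqint (@measurable_Omega R d) (wpartialP qr).1.
have /xgetPex : exists g, [set g | sqint cube g /\
  {ae cube, forall x, wpartial q v x = g x}] g by exists g.
by move=> /(_ (fun=> 0)).
Qed.

(** A weak derivative of order zero has the same integrals as [v] against all tensor tests, so
    [tensor_fundamental] identifies the two. *)
Lemma deriv_rep0 : {ae cube, forall x, v x = deriv_rep (fun=> 0%N) x}.
Proof.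
have [v' sv' vv'] := L2_sqint (@measurable_Omega R d) Xv.1.
have [s0 e0] := deriv_repP (q := fun=> 0%N) (fun=> leq0n _).
have [_ w0] := wpartialP (q := fun=> 0%N) (fun=> leq0n _).
have := tensor_fundamental (sqintB sv' s0).
have h phi : (forall i, test1 (phi i)) ->
    \int[cube]_x ((v' x - deriv_rep (fun=> 0%N) x) * tensor phi x) = 0.
  move=> tphi; have := weak_partial_tensor vv' e0 w0 tphi.
  rewrite big1// expr0 mul1r => e.
  have [M phiM] := bounded_tensor (fun i => bounded_test1 (tphi i)).
  have mphi := measurable_tensor (fun i => measurable_smooth (tphi i).1).
  have st := sqint_bounded cube mphi phiM.
  under eq_Rintegral do rewrite mulrBl.
  rewrite (RintegralB measurableT (sqintM sv' st) (sqintM s0 st)) -[X in _ - X]e.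
  exact: subrr.
move=> /(_ h) h0; apply: filterS2 vv' h0 => x -> /eqP.
by rewrite subr_eq0 => /eqP.
Qed.

(** Each weak derivative is defined from [v] alone. Testing order $q$ with $\partial_s\phi$ and
    order $q+e_s$ with $\phi$ produces the same integral of [v], with opposite signs, which links
    the two. *)
Lemma is_prim_deriv_rep q s : (forall s, q s <= r s)%N -> (q s < r s)%N ->
  is_prim s (deriv_rep q) (deriv_rep (upd q s (q s).+1)).
Proof.
move=> qr qs; have [v' sv' vv'] := L2_sqint (@measurable_Omega R d) Xv.1.
have q'r t : (upd q s (q s).+1 t <= r t)%N by rewrite /upd; case: eqP => [->|].
have [s0 e0] := deriv_repP qr; have [_ w0] := wpartialP qr.
have [s1 e1] := deriv_repP q'r; have [_ w1] := wpartialP q'r.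
apply: (weak_is_prim s0 s1) => phi tphi.
have tpsi i : test1 (update phi s (derive1 (phi s)) i).
  by rewrite /update; case: eqP => // _; exact: test1_derive1.
have := weak_partial_tensor vv' e0 w0 tpsi.
have := weak_partial_tensor vv' e1 w1 tphi.
have -> : (fun j => derive1n (upd q s (q s).+1 j) (phi j)) =
    (fun j => derive1n (q j) (update phi s (derive1 (phi s)) j)).
  apply/funext => j; rewrite /upd /update; case: eqP => // ->.
  exact: derive1Sn.
have -> : (\sum_i upd q s (q s).+1 i = (\sum_i q i).+1)%N.
  rewrite (bigD1 s)// [in RHS](bigD1 s)//= upd_same addSn; congr (_ + _).+1.
  by apply: eq_bigr => i si; rewrite upd_neq.
move=> ->; rewrite exprS mulN1r mulNr => /eqP; rewrite eq_sym -mulrN => /eqP.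
by move/(can_inj (signrMK _)).
Qed.

Lemma good_deriv_rep : good r deriv_rep.
Proof.
split=> [q qr|q s qr qs]; first exact: (deriv_repP qr).1.
exact: is_prim_deriv_rep.
Qed.

Lemma sqI_deriv_rep q : (forall s, q s <= r s)%N ->
  sqI cube (deriv_rep q) = (L2norm leb Om (wpartial q v) ^+ 2)%E.
Proof.
move=> qr; rewrite (L2norm_sqr (@measurable_Omega R d) (wpartialP qr).1).
exact/esym/ae_eq_sqI/(deriv_repP qr).2.
Qed.

(** Every derivative of admissible order is one term of the sum defining the norm, so the norm
    serves as the common bound [B]. *)
Lemma Xnorm_bound : exists2 B : R, 0 <= B & (Xnorm k I v ^+ 2 = (B ^+ 2)%:E)%E /\
  forall q, (forall s, q s <= r s)%N -> (sqI cube (deriv_rep q) <= (B ^+ 2)%:E)%E.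
Proof.
set Sm := (\sum_(q : {ffun 'I_d -> 'I_k.+3}
          | [forall s, (q s <= mixed_order k I s)%N])
      L2norm leb Om (wpartial (fun s => q s) v) ^+ 2)%E.
have S0 : (0 <= Sm)%E by apply: sume_ge0 => q _; exact: sqre_ge0.
have Sfin : Sm \is a fin_num.
  rewrite ge0_fin_numE//; apply: lte_sum_pinfty => q /forallP qr.
  by rewrite -sqI_deriv_rep//; case: (deriv_repP qr).1.
exists (Num.sqrt (fine Sm)); first exact: sqrtr_ge0.
rewrite sqr_sqrtr ?fine_ge0// fineK//; split; first by rewrite sqr_poweR_half.
move=> q qr.
have q3 s : (q s < k.+3)%N.
  by rewrite (leq_ltn_trans (qr s))// /mixed_order; case: ifP.
pose q' : {ffun 'I_d -> 'I_k.+3} := [ffun s => Ordinal (q3 s)].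
have qE : (fun s => q' s : nat) = q by apply/funext => s; rewrite ffunE.
have q'r : [forall s, (q' s <= mixed_order k I s)%N].
  by apply/forallP => s; rewrite ffunE; exact: qr.
rewrite sqI_deriv_rep// -qE /Sm (bigD1 q')//= leeDl//.
by apply: sume_ge0 => p _; exact: sqre_ge0.
Qed.

End family.

(** With $N=n+d$ every index of the sparse set has entries below [N], so its increments are the
    genuine ones; the identity [sum_incrs] then leaves exactly the indices with $|m|\ge n+d$ as the
    error. *)
Lemma sparse_interp_error k I n v (B : R) : (0 < d)%N -> 0 <= B ->
  (exists2 F, good (mixed_order k I) F & {ae cube, forall x, v x = F (fun=> 0%N) x} /\
    forall q, (forall s, q s <= mixed_order k I s)%N -> (sqI cube (F q) <= (B ^+ 2)%:E)%E) ->
  exists2 e, sqint cube e & {ae cube, forall x, v x - sparse_interp k n I v x = e x} /\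
    (sqI cube e <= ((2 ^+ (k.+3 * d) * 2 ^+ d * error_rate R #|I| k d n * B) ^+ 2)%:E)%E.
Proof.
move=> d0 B0 [F gF [vF FB]].
pose b (s : 'I_d) := s \in I; pose L := enum I ++ enum (~: I).
have uL : uniq L.
  rewrite cat_uniq !enum_uniq andbT /=; apply/hasPn => s.
  by rewrite !mem_enum inE.
have aL s : s \in L by rewrite mem_cat !mem_enum inE orbN.
have rr s : mixed_order k I s = rate (b s) k by [].
pose N := (n + d)%N; pose z : 'I_d -> nat := fun=> 0%N.
pose G m := incrs b k N L m F z.
have z0 s : (z s <= rank_off (mixed_order k I) L s)%N by [].
have sG m : sqint cube (G m) := (good_incrs N rr m uL gF).1 z z0.
exists (fun x => \sum_(m : {ffun 'I_d -> 'I_N.+1} | (n + d <= \sum_i m i)%N)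
  G (fun i => m i) x); first by apply: sqint_sum => m _; exact: sG.
split; last first.
  pose w (m : {ffun 'I_d -> 'I_N.+1}) : R :=
    \prod_s weight (mixed_order k I) (fun i => m i) s * B.
  have w0 m : 0 <= w m.
    by rewrite mulr_ge0// prodr_ge0// => s _; exact/ltW/weight_gt0.
  have Gw (m : {ffun 'I_d -> 'I_N.+1}) :
      (sqI cube (G (fun i => m i)) <= (w m ^+ 2)%:E)%E.
    have := sqI_incrs N rr (fun i => m i) uL B0 gF FB z0.
    rewrite (_ : \prod_(s <- L) _ = \prod_s weight (mixed_order k I) (fun i => m i) s)//.
    apply: perm_big; apply: uniq_perm => //; first exact: index_enum_uniq.
    by move=> s; rewrite aL mem_index_enum.
  apply: le_trans (sqI_sum _ (fun m _ => w0 m) (fun m _ => sG _) (fun m _ => Gw m)) _.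
  rewrite lee_fin -mulr_suml lerXn2r ?nnegrE//.
  - by rewrite mulr_ge0// sumr_ge0// => m _; rewrite prodr_ge0// => s _; exact/ltW/weight_gt0.
  - rewrite mulr_ge0// mulr_ge0// ?mulr_ge0 ?exprn_ge0// /error_rate.
    by case: #|I| => [|l]; rewrite mulr_ge0 ?exprn_ge0// invr_ge0 exprn_ge0.
  - by rewrite ler_wpM2r//; exact: weight_sum.
have HG : {ae cube, forall x, forall m : {ffun 'I_d -> 'I_N},
    H_op k I (fun s => m s) v x = G (fun s => m s) x}.
  apply: filter_forall => m.
  by apply: (acting_incrs rr uL gF vF) => s _; exact: ltn_ord.
apply: filterS2 vF HG => x vx Hx; rewrite vx.
rewrite -(sum_incrs b k N F z x uL aL).
rewrite (bigID (fun m : {ffun 'I_d -> 'I_N.+1} => n + d <= \sum_i m i)%N) /=.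
rewrite -[RHS]addr0 -addrA; congr (_ + _); apply/eqP; rewrite subr_eq0; apply/eqP.
rewrite /sparse_interp (eq_bigr _ (fun m _ => Hx m)).
have N0 : (0 < N)%N by rewrite addn_gt0 d0 orbT.
(* The interpolant has entries below [N], the decomposition entries up to [N]. On the sparse set the
   two index types correspond, and the default of [insubd] is not reached. *)
pose up (m : {ffun 'I_d -> 'I_N}) : {ffun 'I_d -> 'I_N.+1} :=
  [ffun i => widen_ord (leqnSn N) (m i)].
pose down (m : {ffun 'I_d -> 'I_N.+1}) : {ffun 'I_d -> 'I_N} :=
  [ffun i => insubd (Ordinal N0) (m i : nat)].
have upE m : (fun i => up m i : nat) = (fun i => m i : nat).
  by apply/funext => i; rewrite ffunE.
have downE (m : {ffun 'I_d -> 'I_N.+1}) : (\sum_i m i < N)%N ->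
    (fun i => down m i : nat) = (fun i => m i : nat).
  move=> mN; apply/funext => i; rewrite ffunE val_insubd ifT//.
  by apply: leq_ltn_trans mN; rewrite (bigD1 i)//= leq_addr.
rewrite (reindex_onto up down); last first.
  move=> m; rewrite -ltnNge => mN; apply/ffunP => i; apply/val_inj.
  by rewrite ffunE/=; have := downE _ mN => /(congr1 (@^~ i)).
apply: eq_big => [m|m _]; last first.
  by rewrite -[in RHS](upE m).
have -> : down (up m) == m.
  by apply/eqP/ffunP => i; apply/val_inj; rewrite ffunE val_insubd ffunE /= ltn_ord.
rewrite andbT -ltnNge -(eq_bigr _ (fun i _ => congr1 (@^~ i) (upE m)))/=.
by rewrite -[(_ <= n + d - 1)%N]ltnS subn1 prednK.
Qed.

Lemma coefficient_error k I n v : (0 < d)%N -> Xspace k I v ->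
  (L2norm leb Om (fun x => (v x - sparse_interp k n I v x)%R) ^+ 2 <=
   ((2 ^+ (k.+3 * d) * 2 ^+ d * error_rate R #|I| k d n) ^+ 2)%:E * Xnorm k I v ^+ 2)%E.
Proof.
move=> d0 Xv; have [B B0 [XB FB]] := Xnorm_bound Xv.
have [e se [ve eB]] := sparse_interp_error n d0 B0
  (ex_intro2 _ _ _ (good_deriv_rep Xv) (conj (deriv_rep0 Xv) FB)).
rewrite (L2norm_sqr (@measurable_Omega R d) (sqint_L2 (mD := @measurable_Omega R d) se ve)).
by rewrite (ae_eq_sqI ve) XB -EFinM -exprMn.
Qed.

End coefficient.

Theorem theorem4p2 (R : realType) (d k l : nat) (d_ge1 : (1 <= d)%N)
    (l_le_d : (l <= d)%N) :
  exists C : R, forall (n : nat) (omega : lform R d l), form_Xspace k omega ->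
    (form_norm (form_sub omega (form_sparse_interp k n omega))
       <= C%:E * (error_rate R l k d n)%:E * form_Xnorm k omega)%E.
Proof.
exists (2 ^+ (k.+3 * d) * 2 ^+ d) => n omega Xomega; rewrite -EFinM.
set c := (_ * error_rate _ _ _ _ _); rewrite /form_norm /form_Xnorm.
have c0 : 0 <= c.
  rewrite !mulr_ge0 ?exprn_ge0// /error_rate.
  by case: (l) => [|l']; rewrite mulr_ge0 ?exprn_ge0// invr_ge0 exprn_ge0.
have X0 : (0 <= \sum_I Xnorm k (val I) (omega I) ^+ 2)%E.
  by apply: sume_ge0 => I _; exact: sqre_ge0.
(* As the root of its square, [c] can enter the root defining the norms; it remains to compare sums
   of squares coefficient by coefficient. *)
have cE : c%:E = ((c ^+ 2)%:E `^ 2^-1)%E.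
  rewrite poweR_EFin; congr EFin.
  by rewrite -powR_mulrn// -powRrM mulfV// powRr1.
rewrite cE -poweRM// ?lee_fin ?sqr_ge0//.
apply: gt0_ler_poweR; first by rewrite invr_ge0.
- rewrite in_itv/= leey andbT; apply: sume_ge0 => I _; exact: sqre_ge0.
- by rewrite in_itv/= leey andbT mule_ge0// lee_fin sqr_ge0.
rewrite ge0_sume_distrr; last by move=> I _; exact: sqre_ge0.
apply: lee_sum => I _; have := coefficient_error n d_ge1 (Xomega I).
by rewrite (eqP (valP I)).
Qed.
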